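(* Let $H$ be a semisimple Hopf algebra over a field $\Bbbk$ with bijective antipode and let $B/A$ be an $H$-Galois extension. Suppose that the following two hypotheses hold. (I) There exists a resolution $K$ of $A$ by left $\Gamma$-modules such that each $K_m$ is projective as an $A^e$-module. (II) There exists a morphism $T\colon K\to K\otimes_A K$ of complexes of left $\Gamma$-modules which lifts the canonical isomorphism $A\cong A\otimes_A A$. Then the isomorphism $\mathrm{H}^\bullet(A,B)^H\cong \mathrm{HH}^\bullet(B)$ induced by the isomorphism of complexes $$\Theta\colon \operatorname{Hom}_{A^e}(K,B)^H\longrightarrow \operatorname{Hom}_{B^e}(B^e\otimes_\Gamma K,B),\qquad \Theta(f)(b\otimes b'\otimes_\Gamma k)=bf(k)b',$$ preserves cup products, where $\mathrm{H}^\bullet(A,B)^H$ is a subalgebra of $\mathrm{H}^\bullet(A,B)$ under the cup product.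
   Context: Unadorned $\otimes,\operatorname{Hom}$ are over $\Bbbk$; $A^e=A\otimes A^{\mathrm{op}}$, and $A$-bimodules are identified with $A^e$-modules. $\mathrm{H}^\bullet(A,N)=\operatorname{Ext}^\bullet_{A^e}(A,N)$ and $\mathrm{HH}^\bullet(B)=\mathrm{H}^\bullet(B,B)$. $H$ has comultiplication $\Delta$, counit $\varepsilon$, antipode $S$ (Sweedler notation). $H$-Galois extension: $B$ is a right $H$-comodule algebra with coaction $b\mapsto\sum b_{[0]}\otimes b_{[1]}$ (iterated: $\sum b_{[0]}\otimes b_{[1]}\otimes b_{[2]}$, etc.), $A=\{b\in B\mid \sum b_{[0]}\otimes b_{[1]}=b\otimes1\}$, and the map $\beta\colon B\otimes_A B\to B\otimes H$, $b\otimes_A b'\mapsto\sum bb'_{[0]}\otimes b'_{[1]}$, is bijective. Write $\beta^{-1}(1\otimes h)=\sum_i l_i(h)\otimes_A r_i(h)$. $\Gamma$ is the subalgebra of $B^e=B\otimes B^{\mathrm{op}}$ consisting of all $\sum_p x_p\otimes y_p$ with $\sum_p x_{p[0]}\otimes x_{p[1]}\otimes y_p=\sum_p x_p\otimes S^{-1}y_{p[1]}\otimes y_{p[0]}$; it contains $A^e$. For a left $\Gamma$-module $M$ and $m\in M$, $\sum_p x_p m y_p$ denotes $(\sum_p x_p\otimes y_p)\cdot m$. $A$ is a left $\Gamma$-module via $a\mapsto \sum_p x_p a y_p$, and $B^e\otimes_\Gamma A\cong B$ via $(b\otimes b')\otimes_\Gamma a\mapsto bab'$. For left $\Gamma$-modules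 $K,N$, the tensor product $K\otimes_A N$ is a left $\Gamma$-module via $(\sum_p x_p\otimes y_p)\cdot(k\otimes_A n)=\sum_{i,p}x_{p[0]}\,k\,l_i(x_{p[1]})\otimes_A r_i(x_{p[1]})\,n\,y_p$. For a complex $K$, $K\otimes_A K$ is the usual tensor product complex with differential $d(x\otimes_A y)=d(x)\otimes_A y+(-1)^{|x|}x\otimes_A d(y)$. For a left $\Gamma$-module $M$ and a $B$-bimodule $N$, $\operatorname{Hom}_{A^e}(M,N)$ is a right $H$-module via $(f\leftharpoonup h)(m)=\sum_{i,j}l_i(h_{(1)})f\big(r_i(h_{(1)})\,m\,l_j(h_{(2)})\big)r_j(h_{(2)})$. Applied to $K$ this induces a right $H$-action on $\mathrm{H}^\bullet(A,N)$, computed by $\operatorname{Hom}_{A^e}(K,N)$. For a right $H$-module $X$, $X^H=\{x\in X\mid x\cdot h=\varepsilon(h)x\ \forall h\in H\}$. Cup products: for an algebra map $A\to B$ and any projective $A$-bimodule resolution $P$ of $A$ with a comparison map $T\colon P\to P\otimes_A P$ of $A$-bimodule complexes lifting $A\cong A\otimes_A A$, the cup product on $\mathrm{H}^\bullet(A,B)$ is induced by $f\smile g=\mu\circ(f\otimes_A g)\circ T$, where $\mu$ is the multiplication of $B$ (cochains are extended by zero to the other degrees); it does not depend on $(P,T)$. $\mathrm{HH}^\bullet(B)$ carries the cup product for the identity map $B\to B$. *)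

(* Defs.v *)
From HB Require Import structures.
From mathcomp Require Import all_boot all_algebra.
From mathcomp Require Import finmap monalg.
From mathcomp Require Import boolp classical_sets functions.

Set Implicit Arguments.
Unset Strict Implicit.
Unset Printing Implicit Defensive.

Import GRing.Theory.
Local Open Scope ring_scope.
Local Open Scope quotient_scope.

Section LinearFacts.
Variables (R : pzRingType) (U : lmodType R) (V : lmodType R) (f : U -> V).
Hypothesis fL : linear f.

Lemma linD u v : f (u + v) = f u + f v.
Proof. by have := fL 1 u v; rewrite !scale1r. Qed.
Lemma lin0 : f 0 = 0.
Proof. by apply: (addrI (f 0)); rewrite -linD !addr0. Qed.
Lemma linZ c u : f (c *: u) = c *: f u.
Proof. by have := fL c u 0; rewrite !addr0 lin0 addr0. Qed.
Lemma linN u : f (- u) = - f u.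
Proof. by rewrite -scaleN1r linZ scaleN1r. Qed.
Lemma linB u v : f (u - v) = f u - f v.
Proof. by rewrite linD linN. Qed.
Lemma lin_sum I (r : seq I) (F : I -> U) :
  f (\sum_(i <- r) F i) = \sum_(i <- r) f (F i).
Proof.
elim: r => [|i r IH]; first by rewrite !big_nil lin0.
by rewrite !big_cons linD IH.
Qed.
End LinearFacts.

Lemma linear_comp (R : pzRingType) (U V W : lmodType R) (f : V -> W) (g : U -> V) :
  linear f -> linear g -> linear (fun x => f (g x)).
Proof. by move=> fL gL c u v; rewrite gL fL. Qed.

Definition restr (R S : pzRingType) (j : {rmorphism R -> S}) (M : lmodType S) :
  Type := M.

Section Restr.
Variables (R S : pzRingType) (j : {rmorphism R -> S}) (M : lmodType S).
Local Notation restr := (restr j M).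
HB.instance Definition _ := GRing.Zmodule.on restr.

Definition restr_scale (r : R) (m : restr) : restr := (j r *: (m : M))%R.

Fact restr_scaleA a b v : restr_scale a (restr_scale b v) = restr_scale (a * b) v.
Proof. by rewrite /restr_scale scalerA rmorphM. Qed.
Fact restr_scale1 : left_id 1 restr_scale.
Proof. by move=> v; rewrite /restr_scale rmorph1 scale1r. Qed.
Fact restr_scaleDr : right_distributive restr_scale +%R.
Proof. by move=> r u v; rewrite /restr_scale scalerDr. Qed.
Fact restr_scaleDl v : {morph restr_scale^~ v: a b / a + b}.
Proof. by move=> a b; rewrite /restr_scale rmorphD scalerDl. Qed.
HB.instance Definition _ := GRing.Zmodule_isLmodule.Build R restr
  restr_scaleA restr_scale1 restr_scaleDr restr_scaleDl.
End Restr.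

(* V / span S *)
Section Quotient.
Variables (R : pzRingType) (V : lmodType R) (S : V -> Prop).

Definition in_span (v : V) : Prop :=
  forall U : V -> Prop, (forall s, S s -> U s) -> U 0 ->
    (forall c u w, U u -> U w -> U (c *: u + w)) -> U v.

Definition span : {pred V} := [pred v | `[< in_span v >]].

Lemma spanP v : reflect (in_span v) (v \in span).
Proof. exact: asboolP. Qed.

Fact span_zmod_closed : zmod_closed span.
Proof.
split=> [|u v /spanP Hu /spanP Hv]; apply/spanP => U US U0 UD //.
by rewrite addrC -scaleN1r; apply: (UD); [exact: Hv | exact: Hu].
Qed.
HB.instance Definition _ := GRing.isZmodClosed.Build V span span_zmod_closed.

Lemma spanZ c v : v \in span -> c *: v \in span.
Proof.
move=> /spanP Hv; apply/spanP => U US U0 UD.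
by rewrite -[_ *: _]addr0; apply: (UD) => //; exact: Hv.
Qed.

Lemma mem_span s : S s -> s \in span.
Proof. by move=> Ss; apply/spanP => U US _ _; apply: US. Qed.

Definition quotmod : Type := Quotient.quot span.
HB.instance Definition _ := GRing.Zmodule.on quotmod.

Definition qclass (v : V) : quotmod := \pi_(Quotient.quot span) v.
Definition qrepr (x : quotmod) : V := repr (x : Quotient.quot span).

Lemma qreprK x : qclass (qrepr x) = x.
Proof. exact: reprK. Qed.

Lemma qclassP u v : qclass u = qclass v <-> u - v \in span.
Proof.
rewrite (Quotient.idealrBE span u v).
by split=> [E|/eqP //]; apply/eqP.
Qed.

Lemma qclassD u v : qclass (u + v) = qclass u + qclass v.
Proof. exact: (raddfD (\pi_(Quotient.quot span))). Qed.

Definition qscale (c : R) (x : quotmod) : quotmod := qclass (c *: qrepr x).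

Lemma qclassZ c v : qclass (c *: v) = qscale c (qclass v).
Proof.
apply/qclassP; rewrite -scalerBr; apply: spanZ.
by apply/qclassP; rewrite qreprK.
Qed.

Fact qscaleA a b v : qscale a (qscale b v) = qscale (a * b) v.
Proof. by rewrite -[v]qreprK -!qclassZ scalerA. Qed.
Fact qscale1 : left_id 1 qscale.
Proof. by move=> v; rewrite -[v]qreprK -!qclassZ scale1r. Qed.
Fact qscaleDr : right_distributive qscale +%R.
Proof.
move=> c u v; rewrite -[u]qreprK -[v]qreprK -qclassD -!qclassZ -qclassD.
by rewrite scalerDr.
Qed.
Fact qscaleDl v : {morph qscale^~ v: a b / a + b}.
Proof. by move=> a b; rewrite -[v]qreprK -!qclassZ -qclassD scalerDl. Qed.
HB.instance Definition _ := GRing.Zmodule_isLmodule.Build R quotmod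
  qscaleA qscale1 qscaleDr qscaleDl.

Lemma qclass_linear : linear qclass.
Proof. by move=> c u v; rewrite qclassD qclassZ. Qed.

Lemma qlift_eq (W : lmodType R) (f : V -> W) :
  linear f -> (forall s, S s -> f s = 0) ->
  forall u v, qclass u = qclass v -> f u = f v.
Proof.
move=> fL fS u v /qclassP /spanP H; apply/eqP; rewrite -subr_eq0 -linB //.
apply/eqP; apply: (H (fun v => f v = 0)) => //; first exact: lin0.
by move=> c x y fx fy; rewrite fL fx fy scaler0 addr0.
Qed.
End Quotient.

(* The tensor product of V and W over k, divided further by the relations
   (v . i) (x) w = v (x) (i . w), where [ra] and [la] are a right and a left
   action of the same set of scalars [I].  Taking for [I] an algebra acting on
   both sides gives the tensor product over that algebra; [void] gives the
   tensor product over k. *)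
Section Tens.
Variables (k : fieldType) (V W : lmodType k).
Variables (I : Type) (ra : I -> V -> V) (la : I -> W -> W).

Definition formal : lmodType k := malg (V * W)%type k.
Definition fgen (v : V) (w : W) : formal := mkmalgU (v, w) 1.

Inductive tens_rel : formal -> Prop :=
| tens_rel_linl c v v' w :
    tens_rel (fgen (c *: v + v') w - (c *: fgen v w + fgen v' w))
| tens_rel_linr c v w w' :
    tens_rel (fgen v (c *: w + w') - (c *: fgen v w + fgen v w'))
| tens_rel_bal i v w : tens_rel (fgen (ra i v) w - fgen v (la i w)).

Definition tens : Type := quotmod tens_rel.
HB.instance Definition _ := GRing.Lmodule.on tens.

Definition tpair (v : V) (w : W) : tens := qclass tens_rel (fgen v w).

Definition fext (U : lmodType k) (phi : V -> W -> U) (g : formal) : U :=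
  \sum_(x <- msupp g) mcoeff x g *: phi x.1 x.2.

(* The map induced by [phi] when [phi] is balanced ([tlift_pair]).  It is
   defined through a representative, so that no proof has to be supplied; it is
   used below only where [phi] is balanced. *)
Definition tlift (U : lmodType k) (phi : V -> W -> U) (t : tens) : U :=
  fext phi (qrepr t).

Record balanced (U : lmodType k) (phi : V -> W -> U) : Prop := Balanced {
  bal_linl : forall w, linear (phi^~ w);
  bal_linr : forall v, linear (phi v);
  bal_mid : forall i v w, phi (ra i v) w = phi v (la i w) }.

Lemma fextEw (U : lmodType k) (phi : V -> W -> U) (D : {fset (V * W)%type}) g :
  (msupp g `<=` D)%fset ->
  fext phi g = \sum_(x <- D) mcoeff x g *: phi x.1 x.2.
Proof.
move=> le; rewrite /fext (big_fset_incl _ le) //= => x _.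
by move=> /mcoeff_outdom ->; rewrite scale0r.
Qed.

Lemma fext_linear (U : lmodType k) (phi : V -> W -> U) : linear (fext phi).
Proof.
move=> c g h; pose D := (msupp (c *: g + h) `|` (msupp g `|` msupp h))%fset.
have le1 : (msupp (c *: g + h) `<=` D)%fset by exact: fsubsetUl.
have le2 : (msupp g `<=` D)%fset by rewrite fsubsetU // fsubsetUl orbT.
have le3 : (msupp h `<=` D)%fset by rewrite fsubsetU // fsubsetUr orbT.
rewrite (fextEw phi le1) (fextEw phi le2) (fextEw phi le3).
rewrite scaler_sumr -big_split /=; apply: eq_bigr => x _.
by rewrite mcoeffD mcoeffZ scalerDl scalerA.
Qed.

Lemma fext_gen (U : lmodType k) (phi : V -> W -> U) v w :
  fext phi (fgen v w) = phi v w.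
Proof.
by rewrite (fextEw phi msuppU_le) big_seq_fset1 mcoeffUU scale1r.
Qed.

Lemma formalE (g : formal) :
  g = \sum_(x <- msupp g) mcoeff x g *: fgen x.1 x.2.
Proof.
rewrite {1}[g]monalgE; apply: eq_bigr => -[v w] _ /=.
by apply/malgP => y; rewrite mcoeffZ !mcoeffU mulr_natr.
Qed.

Lemma tlift_class (U : lmodType k) (phi : V -> W -> U) : balanced phi ->
  forall g, tlift phi (qclass tens_rel g) = fext phi g.
Proof.
move=> [lL lR lM] g; apply: (qlift_eq (S := tens_rel)); last exact: qreprK.
  exact: fext_linear.
have fL := fext_linear phi.
move=> _ [c v v' w|c v w w'|i v w].
- by rewrite linB // fL !fext_gen (lL w) subrr.
- by rewrite linB // fL !fext_gen (lR v) subrr.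
- by rewrite linB // !fext_gen lM subrr.
Qed.

Lemma tlift_pair (U : lmodType k) (phi : V -> W -> U) : balanced phi ->
  forall v w, tlift phi (tpair v w) = phi v w.
Proof. by move=> bphi v w; rewrite tlift_class // fext_gen. Qed.

Lemma tlift_linear (U : lmodType k) (phi : V -> W -> U) : balanced phi ->
  linear (tlift phi).
Proof.
move=> bphi c s t; rewrite -[s]qreprK -[t]qreprK -qclass_linear.
by rewrite !tlift_class // fext_linear.
Qed.

Lemma tpair_balanced : balanced tpair.
Proof.
split=> [w c v v'|v c w w'|i v w].
- transitivity (qclass tens_rel (c *: fgen v w + fgen v' w)).
    exact/(qclassP _ _ _).2/mem_span/tens_rel_linl.
  exact: qclass_linear.
- transitivity (qclass tens_rel (c *: fgen v w + fgen v w')).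
    exact/(qclassP _ _ _).2/mem_span/tens_rel_linr.
  exact: qclass_linear.
- exact/(qclassP _ _ _).2/mem_span/tens_rel_bal.
Qed.

Lemma tensE (t : tens) :
  {s : seq (k * (V * W)) | t = \sum_(x <- s) x.1 *: tpair x.2.1 x.2.2}.
Proof.
exists [seq (mcoeff x (qrepr t), x) | x <- msupp (qrepr t)].
rewrite big_map -{1}[t]qreprK {1}[qrepr t]formalE.
rewrite (lin_sum (@qclass_linear _ _ tens_rel)); apply: eq_bigr => x _ /=.
by rewrite (linZ (@qclass_linear _ _ tens_rel)).
Qed.

Lemma tens_ext (U : lmodType k) (f g : tens -> U) : linear f -> linear g ->
  (forall v w, f (tpair v w) = g (tpair v w)) -> f =1 g.
Proof.
move=> fL gL fg t; have [s ->] := tensE t.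
rewrite !lin_sum //; apply: eq_bigr => x _; by rewrite !linZ // fg.
Qed.
End Tens.

Lemma tlift_linear_arg (k : fieldType) (X V W U : lmodType k) (I : Type)
    (ra : I -> V -> V) (la : I -> W -> W) (phi : X -> V -> W -> U) (t : tens ra la) :
  (forall v w, linear (fun x => phi x v w)) -> linear (fun x => tlift (phi x) t).
Proof.
move=> pL c x y; rewrite /tlift /fext scaler_sumr -big_split /=.
by apply: eq_bigr => z _; rewrite pL scalerDr !scalerA mulrC.
Qed.

Section KTens.
Variables (k : fieldType) (V W : lmodType k).

Definition ktens : Type :=
  tens (fun (_ : void) (v : V) => v) (fun (_ : void) (w : W) => w).
HB.instance Definition _ := GRing.Lmodule.on ktens.

Definition kpair (v : V) (w : W) : ktens := tpair _ _ v w.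

Definition bilin (U : lmodType k) (phi : V -> W -> U) : Prop :=
  (forall w, linear (phi^~ w)) /\ (forall v, linear (phi v)).

Definition klift (U : lmodType k) (phi : V -> W -> U) (t : ktens) : U :=
  tlift phi t.

Lemma bilin_balanced (U : lmodType k) (phi : V -> W -> U) :
  bilin phi -> balanced (fun (_ : void) (v : V) => v) (fun (_ : void) (w : W) => w) phi.
Proof. by case=> lL lR; split. Qed.

Lemma klift_pair (U : lmodType k) (phi : V -> W -> U) :
  bilin phi -> forall v w, klift phi (kpair v w) = phi v w.
Proof. by move=> /bilin_balanced; exact: tlift_pair. Qed.

Lemma klift_linear (U : lmodType k) (phi : V -> W -> U) :
  bilin phi -> linear (klift phi).
Proof. by move=> /bilin_balanced; exact: tlift_linear. Qed.

Lemma kpair_bilin : bilin kpair.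
Proof. by split=> [w|v]; case: (tpair_balanced (fun (_ : void) (v : V) => v) (fun (_ : void) (w : W) => w)). Qed.

Lemma ktens_ext (U : lmodType k) (f g : ktens -> U) : linear f -> linear g ->
  (forall v w, f (kpair v w) = g (kpair v w)) -> f =1 g.
Proof. exact: tens_ext. Qed.
End KTens.

Notation "V \ox W" := (ktens V W) (at level 40, left associativity) : type_scope.
Notation "v \ot w" := (kpair v w) (at level 40, left associativity) : ring_scope.

Lemma kpair_linl (k : fieldType) (V W : lmodType k) (w : W) :
  linear (fun v : V => v \ot w).
Proof. exact: (kpair_bilin V W).1. Qed.

Lemma kpair_linr (k : fieldType) (V W : lmodType k) (v : V) :
  linear (fun w : W => v \ot w).
Proof. exact: (kpair_bilin V W).2. Qed.

Lemma klift_linear_arg (k : fieldType) (X V W U : lmodType k)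
    (phi : X -> V -> W -> U) (t : V \ox W) :
  (forall v w, linear (fun x => phi x v w)) -> linear (fun x => klift (phi x) t).
Proof. exact: tlift_linear_arg. Qed.

Section TensorMaps.
Variables (k : fieldType).

Definition tmap (V W V' W' : lmodType k) (f : V -> V') (g : W -> W') :
  V \ox W -> V' \ox W' := klift (fun v w => f v \ot g w).

Definition tassoc (U V W : lmodType k) : (U \ox V) \ox W -> U \ox (V \ox W) :=
  klift (fun t w => klift (fun u v => u \ot (v \ot w)) t).

Definition tmul (A C : algType k) (s t : A \ox C) : A \ox C :=
  klift (fun a c => klift (fun a' c' => (a * a') \ot (c * c')) t) s.

Lemma tmap_bilin (V W V' W' : lmodType k) (f : V -> V') (g : W -> W') :
  linear f -> linear g -> bilin (fun v w => f v \ot g w).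
Proof.
move=> fL gL; split=> [w|v].
  exact: (linear_comp (kpair_linl (g w)) fL).
exact: (linear_comp (kpair_linr (f v)) gL).
Qed.

Lemma tmap_pair (V W V' W' : lmodType k) (f : V -> V') (g : W -> W') :
  linear f -> linear g -> forall v w, tmap f g (v \ot w) = f v \ot g w.
Proof. by move=> fL gL v w; rewrite /tmap klift_pair //; exact: tmap_bilin. Qed.

Lemma tmap_linear (V W V' W' : lmodType k) (f : V -> V') (g : W -> W') :
  linear f -> linear g -> linear (tmap f g).
Proof. by move=> fL gL; apply: klift_linear; exact: tmap_bilin. Qed.

Lemma tassoc_bilin1 (U V W : lmodType k) (w : W) :
  bilin (fun (u : U) (v : V) => u \ot (v \ot w)).
Proof.
split=> [v|u]; first exact: kpair_linl.
exact: (linear_comp (kpair_linr u) (kpair_linl w)).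
Qed.

Lemma tassoc_bilin (U V W : lmodType k) :
  bilin (fun (t : U \ox V) (w : W) => klift (fun u v => u \ot (v \ot w)) t).
Proof.
split=> [w|t]; first exact/klift_linear/tassoc_bilin1.
apply: klift_linear_arg => u v.
exact: (linear_comp (kpair_linr u) (kpair_linr v)).
Qed.

Lemma tassoc_pair (U V W : lmodType k) (u : U) (v : V) (w : W) :
  tassoc ((u \ot v) \ot w) = u \ot (v \ot w).
Proof.
rewrite /tassoc klift_pair; last exact: tassoc_bilin.
by rewrite klift_pair //; exact: tassoc_bilin1.
Qed.

Lemma tassoc_linear (U V W : lmodType k) : linear (@tassoc U V W).
Proof. exact/klift_linear/tassoc_bilin. Qed.

Lemma mul_linl (A : algType k) (a : A) : linear (fun x => x * a).
Proof. by move=> c x y; rewrite mulrDl scalerAl. Qed.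

Lemma mul_linr (A : algType k) (a : A) : linear (fun x => a * x).
Proof. by move=> c x y; rewrite mulrDr scalerAr. Qed.

Lemma tmul_bilin1 (A C : algType k) (a : A) (c : C) :
  bilin (fun (a' : A) (c' : C) => (a * a') \ot (c * c')).
Proof. by apply: tmap_bilin; exact: mul_linr. Qed.

Lemma tmul_bilin2 (A C : algType k) (t : A \ox C) :
  bilin (fun (a : A) (c : C) => klift (fun a' c' => (a * a') \ot (c * c')) t).
Proof.
split=> [c|a]; apply: klift_linear_arg => a' c'.
  exact: (linear_comp (kpair_linl _) (mul_linl _)).
exact: (linear_comp (kpair_linr _) (mul_linl _)).
Qed.

Lemma tmul_pair (A C : algType k) (a a' : A) (c c' : C) :
  tmul (a \ot c) (a' \ot c') = (a * a') \ot (c * c').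
Proof.
rewrite /tmul klift_pair; last exact: tmul_bilin2.
by rewrite klift_pair //; exact: tmul_bilin1.
Qed.

Lemma tmul_bilin (A C : algType k) : bilin (@tmul A C).
Proof.
split=> [t|s]; first exact/klift_linear/tmul_bilin2.
apply: klift_linear_arg => a c; exact/klift_linear/tmul_bilin1.
Qed.
End TensorMaps.

(* B (x) B^op *)
Section Env.
Variables (k : fieldType) (B : algType k).

Definition env : Type := B \ox B.
HB.instance Definition _ := GRing.Lmodule.on env.

Definition epair (x y : B) : env := x \ot y.

Definition env_mul (s t : env) : env :=
  klift (fun x y => klift (fun x' y' => (x * x') \ot (y' * y)) t) s.

Let env_bilin1 (x y : B) : bilin (fun x' y' => (x * x') \ot (y' * y)).
Proof. by apply: tmap_bilin; [exact: mul_linr | exact: mul_linl]. Qed.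

Let env_bilin2 (t : env) :
  bilin (fun x y => klift (fun x' y' => (x * x') \ot (y' * y)) t).
Proof.
split=> [y|x]; apply: klift_linear_arg => x' y'.
  exact: (linear_comp (kpair_linl _) (mul_linl _)).
exact: (linear_comp (kpair_linr _) (mul_linr _)).
Qed.

Lemma env_mul_pair (x y x' y' : B) :
  env_mul (epair x y) (epair x' y') = epair (x * x') (y' * y).
Proof. by rewrite /env_mul klift_pair ?klift_pair. Qed.

Lemma env_mul_linl (t : env) : linear (env_mul^~ t).
Proof. exact: klift_linear. Qed.

Lemma env_mul_linr (s : env) : linear (env_mul s).
Proof. by apply: klift_linear_arg => x y; exact: klift_linear. Qed.

Lemma env_ext (U : lmodType k) (f g : env -> U) : linear f -> linear g ->
  (forall x y, f (epair x y) = g (epair x y)) -> f =1 g.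
Proof. exact: ktens_ext. Qed.

Fact env_mulA : associative env_mul.
Proof.
move=> r s t; move: r.
apply: env_ext => [||x y]; [exact: env_mul_linl | | ].
  exact: (linear_comp (env_mul_linl t) (env_mul_linl s)).
move: s; apply: env_ext => [||x' y'].
- exact: (linear_comp (env_mul_linr _) (env_mul_linl t)).
- exact: (linear_comp (env_mul_linl t) (env_mul_linr _)).
move: t; apply: env_ext => [||x2 y2].
- exact: (linear_comp (env_mul_linr _) (env_mul_linr _)).
- exact: env_mul_linr.
by rewrite !env_mul_pair !mulrA.
Qed.

Fact env_mul1 : left_id (epair 1 1) env_mul.
Proof.
apply: env_ext => [||x y]; [exact: env_mul_linr | by [] | ].
by rewrite env_mul_pair mul1r mulr1.
Qed.

Fact env_mulr1 : right_id (epair 1 1) env_mul.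
Proof.
apply: env_ext => [||x y]; [exact: env_mul_linl | by [] | ].
by rewrite env_mul_pair mul1r mulr1.
Qed.

Fact env_mulDl : left_distributive env_mul +%R.
Proof. by move=> s s' t; exact: (linD (env_mul_linl t)). Qed.

Fact env_mulDr : right_distributive env_mul +%R.
Proof. by move=> s t t'; exact: (linD (env_mul_linr s)). Qed.

HB.instance Definition _ := GRing.Zmodule_isPzRing.Build env
  env_mulA env_mul1 env_mulr1 env_mulDl env_mulDr.

Lemma epairM (x y x' y' : B) : epair x y * epair x' y' = epair (x * x') (y' * y).
Proof. exact: env_mul_pair. Qed.

Lemma env_scaleAl c (s t : env) : c *: (s * t) = (c *: s) * t.
Proof. exact/esym/(linZ (env_mul_linl t)). Qed.

Lemma env_scaleAr c (s t : env) : c *: (s * t) = s * (c *: t).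
Proof. exact/esym/(linZ (env_mul_linr s)). Qed.

Definition env_const (c : k) : env := c *: epair 1 1.
Fact env_const_zmod : zmod_morphism env_const.
Proof. by move=> c d; rewrite /env_const scalerBl. Qed.
Fact env_const_monoid : monoid_morphism env_const.
Proof.
split=> [|c d]; rewrite /env_const ?scale1r //.
by rewrite -env_scaleAl (mul1r (d *: epair 1 1 : env)) scalerA.
Qed.
HB.instance Definition _ := GRing.isZmodMorphism.Build k env env_const env_const_zmod.
HB.instance Definition _ := GRing.isMonoidMorphism.Build k env env_const env_const_monoid.

(* (x (x) y) . b = x b y *)
Definition sandwich (z : env) (b : B) : B := klift (fun x y => x * b * y) z.

Let sandwich_bilin b : bilin (fun x y : B => x * b * y).
Proof.
split=> [y|x]; last exact: mul_linr.
exact: (linear_comp (mul_linl y) (mul_linl b)).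
Qed.

Lemma sandwich_pair x y b : sandwich (epair x y) b = x * b * y.
Proof. exact: klift_pair. Qed.

Lemma sandwich_linl b : linear (sandwich^~ b).
Proof. exact: klift_linear. Qed.

Lemma sandwich_linr z : linear (sandwich z).
Proof.
apply: klift_linear_arg => x y.
exact: (linear_comp (mul_linl y) (mul_linr x)).
Qed.

(* B as a left module over its enveloping algebra. *)
Definition bireg : Type := B.
HB.instance Definition _ := GRing.Zmodule.on bireg.

Fact bireg_scaleA s t (b : bireg) : sandwich s (sandwich t b) = sandwich (s * t) b.
Proof.
move: s; apply: env_ext => [||x y]; [exact: sandwich_linl | | ].
  exact: (linear_comp (sandwich_linl b) (env_mul_linl t)).
move: t; apply: env_ext => [||x' y'].
- exact: (linear_comp (sandwich_linr _) (sandwich_linl b)).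
- exact: (linear_comp (sandwich_linl b) (env_mul_linr _)).
by rewrite epairM !sandwich_pair !mulrA.
Qed.
Fact bireg_scale1 : left_id 1 sandwich.
Proof. by move=> b; rewrite sandwich_pair mul1r mulr1. Qed.
Fact bireg_scaleDr : right_distributive sandwich +%R.
Proof. by move=> z b b'; exact: (linD (sandwich_linr z)). Qed.
Fact bireg_scaleDl b : {morph sandwich^~ b : s t / s + t}.
Proof. by move=> s t; exact: (linD (sandwich_linl b)). Qed.
HB.instance Definition _ := GRing.Zmodule_isLmodule.Build env bireg
  bireg_scaleA bireg_scale1 bireg_scaleDr bireg_scaleDl.
End Env.

Section EnvMap.
Variables (k : fieldType) (A B : algType k) (iota : {lrmorphism A -> B}).

Definition env_map (z : env A) : env B := tmap iota iota z.

Let iotaL : linear iota. Proof. exact: linearP. Qed.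

Lemma env_map_pair a a' : env_map (epair a a') = epair (iota a) (iota a').
Proof. exact: tmap_pair. Qed.

Lemma env_map_linear : linear env_map.
Proof. exact: tmap_linear. Qed.

Fact env_map_zmod : zmod_morphism env_map.
Proof. by move=> s t; exact: (linB env_map_linear). Qed.
Fact env_map_monoid : monoid_morphism env_map.
Proof.
split=> [|s t]; first by rewrite env_map_pair rmorph1.
move: s; apply: env_ext => [||x y].
- exact: (linear_comp env_map_linear (env_mul_linl t)).
- exact: (linear_comp (env_mul_linl _) env_map_linear).
move: t; apply: env_ext => [||x' y'].
- exact: (linear_comp env_map_linear (env_mul_linr _)).
- exact: (linear_comp (env_mul_linr _) env_map_linear).
by rewrite epairM !env_map_pair epairM !rmorphM.
Qed.
HB.instance Definition _ := GRing.isZmodMorphism.Build (env A) (env B) env_map env_map_zmod.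
HB.instance Definition _ := GRing.isMonoidMorphism.Build (env A) (env B) env_map env_map_monoid.
End EnvMap.

Section KliftFacts.
Variables (k : fieldType) (V W : lmodType k).

Lemma klift_out (U U' : lmodType k) (f : U -> U') (phi : V -> W -> U) t :
  linear f -> f (klift phi t) = klift (fun v w => f (phi v w)) t.
Proof.
move=> fL; rewrite /klift /tlift /fext lin_sum //.
by apply: eq_bigr => x _; rewrite linZ.
Qed.

Lemma eq_klift (U : lmodType k) (phi psi : V -> W -> U) t :
  (forall v w, phi v w = psi v w) -> klift phi t = klift psi t.
Proof. by move=> E; rewrite /klift /tlift /fext; apply: eq_bigr => x _; rewrite E. Qed.

Lemma klift_exch (V' W' U : lmodType k) (phi : V -> W -> V' -> W' -> U) s t :
  klift (fun v w => klift (phi v w) t) s =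
  klift (fun v' w' => klift (fun v w => phi v w v' w') s) t.
Proof.
rewrite /klift /tlift /fext.
under eq_bigr => x _ do rewrite scaler_sumr.
rewrite exchange_big; apply: eq_bigr => y _ /=.
by rewrite scaler_sumr; apply: eq_bigr => x _; rewrite !scalerA mulrC.
Qed.

Lemma kliftZ (U : lmodType k) (phi : V -> W -> U) c t :
  klift (fun v w => c *: phi v w) t = c *: klift phi t.
Proof.
by rewrite -(klift_out phi t (f := fun u => c *: u)) // => d u v;
  rewrite scalerDr !scalerA mulrC.
Qed.

End KliftFacts.

Lemma klift_lift3 (k : fieldType) (V W X U : lmodType k) (phi : V -> W -> X -> U) t :
  (forall w x, linear (fun v => phi v w x)) ->
  (forall v x, linear (fun w => phi v w x)) ->
  (forall v w, linear (phi v w)) ->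
  klift (fun v u => klift (phi v) u) (tassoc t) =
  klift (fun s x => klift (fun v w => phi v w x) s) t.
Proof.
move=> L1 L2 L3.
have B0 v : bilin (phi v) by split.
have B1 : bilin (fun v (u : ktens W X) => klift (phi v) u).
  by split=> [u|v]; [apply: klift_linear_arg | apply: klift_linear].
rewrite /tassoc (klift_out _ _ (klift_linear B1)).
apply: eq_klift => s x; rewrite (klift_out _ _ (klift_linear B1)).
by apply: eq_klift => v w; rewrite !klift_pair.
Qed.

Lemma klift_tmap (k : fieldType) (V W V' W' U : lmodType k) (f : V -> V')
    (g : W -> W') (phi : V' -> W' -> U) t : bilin phi ->
  klift phi (tmap f g t) = klift (fun v w => phi (f v) (g w)) t.
Proof.
move=> B; rewrite /tmap (klift_out _ _ (klift_linear B)).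
by apply: eq_klift => v w; rewrite klift_pair.
Qed.

Lemma klift_tmul (k : fieldType) (A C : algType k) (U : lmodType k)
    (phi : A -> C -> U) s t : bilin phi ->
  klift phi (tmul s t) =
  klift (fun a c => klift (fun a' c' => phi (a * a') (c * c')) t) s.
Proof.
move=> B; rewrite /tmul (klift_out _ _ (klift_linear B)).
apply: eq_klift => a c; rewrite (klift_out _ _ (klift_linear B)).
by apply: eq_klift => a' c'; rewrite klift_pair.
Qed.

(* Hopf algebras with bijective antipode; [antipV] is the inverse antipode. *)
Record hopf (k : fieldType) (H : algType k) : Type := Hopf {
  comul : {linear H -> (H \ox H)%type};
  counit : {lrmorphism H -> k^o};
  antip : {linear H -> H};
  antipV : H -> H;
  comulA : forall h, tassoc (tmap comul id (comul h)) = tmap id comul (comul h);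
  comul_counitl : forall h, klift (fun x y => (counit x : k) *: y) (comul h) = h;
  comul_counitr : forall h, klift (fun x y => (counit y : k) *: x) (comul h) = h;
  comul1 : comul 1 = 1 \ot 1;
  comulM : forall g h, comul (g * h) = tmul (comul g) (comul h);
  antip_left : forall h, klift (fun x y => antip x * y) (comul h) = (counit h : k) *: 1;
  antip_right : forall h, klift (fun x y => x * antip y) (comul h) = (counit h : k) *: 1;
  antipK : cancel antip antipV;
  antipVK : cancel antipV antip }.

Section HopfFacts.
Variables (k : fieldType) (H : algType k) (hH : hopf H).
Local Notation S := (antip hH).
Local Notation D := (comul hH).
Local Notation eps := (counit hH : H -> k).

Let DL : linear D. Proof. exact: linearP. Qed.
Let SL : linear S. Proof. exact: linearP. Qed.
Let idL (V : lmodType k) : linear (@id V). Proof. by []. Qed.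

Lemma coassoc (U : lmodType k) (phi : H -> H -> H -> U) h :
  (forall w x, linear (fun v => phi v w x)) ->
  (forall v x, linear (fun w => phi v w x)) ->
  (forall v w, linear (phi v w)) ->
  klift (fun x y => klift (phi x) (D y)) (D h) =
  klift (fun x y => klift (fun x1 x2 => phi x1 x2 y) (D x)) (D h).
Proof.
move=> L1 L2 L3.
have B1 : bilin (fun v (u : ktens H H) => klift (phi v) u).
  by split=> [u|v]; [apply: klift_linear_arg | apply: klift_linear].
have B2 : bilin (fun (s : ktens H H) x => klift (fun v w => phi v w x) s).
  by split=> [u|v]; [apply: klift_linear | apply: klift_linear_arg].
transitivity (klift (fun v u => klift (phi v) u) (tmap id D (D h))).
  by rewrite (klift_tmap id D (D h) B1).
by rewrite -comulA klift_lift3 // (klift_tmap D id (D h) B2).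
Qed.

Lemma antip1 : S 1 = 1.
Proof.
have := antip_left hH 1; rewrite comul1 klift_pair.
  by rewrite mulr1 rmorph1 scale1r.
split=> [w|v]; last exact: mul_linr.
exact: (linear_comp (mul_linl w) SL).
Qed.

Let F a b c h1 h2 h3 := S (a * h1) * (b * (h2 * (S h3 * S c))).

Let FLh1 a b c h2 h3 : linear (fun h1 => F a b c h1 h2 h3).
Proof. exact: (linear_comp (mul_linl _) (linear_comp SL (mul_linr _))). Qed.
Let FLh2 a b c h1 h3 : linear (fun h2 => F a b c h1 h2 h3).
Proof. exact: (linear_comp (mul_linr _) (linear_comp (mul_linr _) (mul_linl _))). Qed.
Let FLh3 a b c h1 h2 : linear (fun h3 => F a b c h1 h2 h3).
Proof.
exact: (linear_comp (mul_linr _) (linear_comp (mul_linr _)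
  (linear_comp (mul_linr _) (linear_comp (mul_linl _) SL)))).
Qed.
Let FLa b c h1 h2 h3 : linear (fun a => F a b c h1 h2 h3).
Proof. exact: (linear_comp (mul_linl _) (linear_comp SL (mul_linl _))). Qed.
Let FLb a c h1 h2 h3 : linear (fun b => F a b c h1 h2 h3).
Proof. exact: (linear_comp (mul_linr _) (mul_linl _)). Qed.
Let FLc a b h1 h2 h3 : linear (fun c => F a b c h1 h2 h3).
Proof.
exact: (linear_comp (mul_linr _) (linear_comp (mul_linr _)
  (linear_comp (mul_linr _) (linear_comp (mul_linr _) SL)))).
Qed.

Let E1 g h :
  klift (fun g1 g' => klift (fun g2 g3 => klift (fun h1 h' =>
    klift (fun h2 h3 => F g1 g2 g3 h1 h2 h3) (D h')) (D h)) (D g')) (D g) =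
  S (g * h).
Proof.
transitivity (klift (fun g1 g' => eps g' *: S (g1 * h)) (D g)); last first.
  rewrite -[in RHS](comul_counitr hH g).
  rewrite (klift_out _ _ (linear_comp SL (mul_linl h))).
  by apply: eq_klift => x y; rewrite -scalerAl linearZ.
apply: eq_klift => g1 g'.
transitivity (klift (fun g2 g3 => S (g1 * h) * (g2 * S g3)) (D g')); last first.
  by rewrite -(klift_out _ _ (mul_linr _)) antip_right -scalerAr mulr1.
apply: eq_klift => g2 g3.
transitivity (klift (fun h1 h' => eps h' *: (S (g1 * h1) * (g2 * S g3))) (D h)).
  apply: eq_klift => h1 h'.
  transitivity (klift (fun h2 h3 => S (g1 * h1) * (g2 * ((h2 * S h3) * S g3))) (D h')).
    by apply: eq_klift => h2 h3; rewrite /F !mulrA.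
  rewrite -(klift_out _ _ (linear_comp (mul_linr _) (linear_comp (mul_linr _) (mul_linl _)))).
  by rewrite antip_right -scalerAl mul1r -!scalerAr.
rewrite -[in RHS](comul_counitr hH h).
rewrite (klift_out _ _ (linear_comp (mul_linl _) (linear_comp SL (mul_linr g1)))).
by apply: eq_klift => x y; rewrite -scalerAr linearZ -scalerAl.
Qed.

Let E2 g h :
  klift (fun g1 g' => klift (fun g2 g3 => klift (fun h1 h' =>
    klift (fun h2 h3 => F g1 g2 g3 h1 h2 h3) (D h')) (D h)) (D g')) (D g) =
  S h * S g.
Proof.
transitivity (klift (fun g1 g' => klift (fun g2 g3 => klift (fun h' h3 =>
    klift (fun h1 h2 => F g1 g2 g3 h1 h2 h3) (D h')) (D h)) (D g')) (D g)).
  by apply: eq_klift => g1 g'; apply: eq_klift => g2 g3; rewrite coassoc.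
rewrite coassoc; last 3 first.
- move=> b c; apply: klift_linear_arg => x y; apply: klift_linear_arg => x' y'; exact: FLa.
- move=> a c; apply: klift_linear_arg => x y; apply: klift_linear_arg => x' y'; exact: FLb.
- move=> a b; apply: klift_linear_arg => x y; apply: klift_linear_arg => x' y'; exact: FLc.
transitivity (klift (fun g' g3 => klift (fun h' h3 => (eps g' * eps h') *: (S h3 * S g3)) (D h)) (D g)).
  apply: eq_klift => g' g3; rewrite klift_exch; apply: eq_klift => h' h3.
  transitivity (klift (fun g1 g2 => klift (fun h1 h2 =>
     (S (g1 * h1) * (g2 * h2)) * (S h3 * S g3)) (D h')) (D g')).
    by apply: eq_klift => ? ?; apply: eq_klift => ? ?; rewrite /F !mulrA.
  transitivity (klift (fun g1 g2 => klift (fun h1 h2 =>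
     S (g1 * h1) * (g2 * h2)) (D h') * (S h3 * S g3)) (D g')).
    by apply: eq_klift => ? ?; rewrite -(klift_out _ _ (mul_linl _)).
  rewrite -(klift_out _ _ (mul_linl _)).
  rewrite -(klift_tmul (phi := fun x y => S x * y)); last first.
    split=> [w|v]; last exact: mul_linr.
    exact: (linear_comp (mul_linl w) SL).
  by rewrite -comulM antip_left -scalerAl mul1r rmorphM.
transitivity (klift (fun g' g3 => eps g' *: (S h * S g3)) (D g)).
  apply: eq_klift => g' g3.
  rewrite -[in RHS](comul_counitl hH h).
  rewrite (klift_out _ _ (linear_comp (mul_linl _) SL)) -kliftZ.
  by apply: eq_klift => x y; rewrite linearZ /= -scalerAl scalerA.
rewrite -[in RHS](comul_counitl hH g).
rewrite (klift_out _ _ (linear_comp (mul_linr _) SL)).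
by apply: eq_klift => x y; rewrite linearZ /= -scalerAr.
Qed.

Lemma antipM g h : S (g * h) = S h * S g.
Proof. by rewrite -E1 E2. Qed.

Lemma antipV1 : antipV hH 1 = 1.
Proof. by rewrite -{1}antip1 antipK. Qed.

Lemma antipVM g h : antipV hH (g * h) = antipV hH h * antipV hH g.
Proof. by apply: (can_inj (antipK hH)); rewrite antipM !antipVK. Qed.

Lemma antipV_linear : linear (antipV hH).
Proof.
by move=> c u v; apply: (can_inj (antipK hH)); rewrite linearP /= !antipVK.
Qed.
End HopfFacts.

Record comod_alg (k : fieldType) (H : algType k) (hH : hopf H) (B : algType k) :
    Type := ComodAlg {
  coact : {linear B -> (B \ox H)%type};
  coactA : forall b, tassoc (tmap coact id (coact b)) = tmap id (comul hH) (coact b);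
  coact_counit : forall b, klift (fun x h => (counit hH h : k) *: x) (coact b) = b;
  coact1 : coact 1 = 1 \ot 1;
  coactM : forall b b', coact (b * b') = tmul (coact b) (coact b') }.

Section BalancedSquare.
Variables (k : fieldType) (A B : algType k) (iota : {lrmorphism A -> B}).

Definition btens : Type :=
  tens (fun (a : A) (b : B) => b * iota a) (fun (a : A) (b : B) => iota a * b).
HB.instance Definition _ := GRing.Lmodule.on btens.

Definition bpair (b b' : B) : btens := tpair _ _ b b'.
End BalancedSquare.

(* A is presented by an injective algebra map onto the coinvariants of B;
   [can] is the map beta and [canV] its inverse. *)
Record galois_ext (k : fieldType) (H : algType k) (hH : hopf H) (A B : algType k)
    (cB : comod_alg hH B) : Type := GaloisExt {
  incl : {lrmorphism A -> B};
  incl_inj : injective incl;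
  coinvP : forall b, (exists a, incl a = b) <-> coact cB b = b \ot 1;
  can : btens incl -> B \ox H :=
    tlift (fun b b' => klift (fun x h => (b * x) \ot h) (coact cB b'));
  canV : B \ox H -> btens incl;
  canK : cancel can canV;
  canVK : cancel canV can }.

(* For z = sum_p x_p (x) y_p,
     gammaL z = sum_p x_p[0] (x) x_p[1] (x) y_p,
     gammaR z = sum_p x_p (x) S^-1 y_p[1] (x) y_p[0]. *)
Section Gamma.
Variables (k : fieldType) (H : algType k) (hH : hopf H) (B : algType k).
Variable cB : comod_alg hH B.
Local Notation rho := (coact cB).

Definition gammaL (z : env B) : B \ox (H \ox B) :=
  klift (fun x y => klift (fun x0 x1 => x0 \ot (x1 \ot y)) (rho x)) z.
Definition gammaR (z : env B) : B \ox (H \ox B) :=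
  klift (fun x y => klift (fun y0 y1 => x \ot (antipV hH y1 \ot y0)) (rho y)) z.

Definition in_gamma : {pred env B} := [pred z | `[< gammaL z = gammaR z >]].

Let rhoL : linear rho. Proof. exact: linearP. Qed.

Let gL0 (y : B) : bilin (fun (x0 : B) (x1 : H) => x0 \ot (x1 \ot y)).
Proof. exact: tassoc_bilin1. Qed.

Let gL1 : bilin (fun x y : B => klift (fun (x0 : B) (x1 : H) => x0 \ot (x1 \ot y)) (rho x)).
Proof.
split=> [y|x]; first exact: (linear_comp (klift_linear (gL0 y)) rhoL).
by apply: klift_linear_arg => v w; exact: (linear_comp (kpair_linr _) (kpair_linr _)).
Qed.

Let gR0 (x : B) : bilin (fun (y0 : B) y1 => x \ot (antipV hH y1 \ot y0)).
Proof.
split=> [y1|y0]; first exact: (linear_comp (kpair_linr _) (kpair_linr _)).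
exact: (linear_comp (kpair_linr _) (linear_comp (kpair_linl _) (antipV_linear hH))).
Qed.

Let gR1 : bilin (fun x y : B => klift (fun (y0 : B) y1 => x \ot (antipV hH y1 \ot y0)) (rho y)).
Proof.
split=> [y|x]; last exact: (linear_comp (klift_linear (gR0 x)) rhoL).
by apply: klift_linear_arg => v w; exact: kpair_linl.
Qed.

Lemma gammaL_linear : linear gammaL. Proof. exact: (klift_linear gL1). Qed.
Lemma gammaR_linear : linear gammaR. Proof. exact: (klift_linear gR1). Qed.

Lemma gammaL_pair x y :
  gammaL (epair x y) = klift (fun x0 x1 => x0 \ot (x1 \ot y)) (rho x).
Proof. exact: (klift_pair gL1). Qed.
Lemma gammaR_pair x y :
  gammaR (epair x y) = klift (fun y0 y1 => x \ot (antipV hH y1 \ot y0)) (rho y).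
Proof. exact: (klift_pair gR1). Qed.

Let mulHB (u v : H \ox B) : H \ox B :=
  klift (fun h y => klift (fun h' y' => (h * h') \ot (y' * y)) v) u.
Let mul3 (s t : B \ox (H \ox B)) : B \ox (H \ox B) :=
  klift (fun x u => klift (fun x' u' => (x * x') \ot mulHB u u') t) s.

Let mHB1 (h : H) (y : B) : bilin (fun h' y' => (h * h') \ot (y' * y)).
Proof. by apply: tmap_bilin; [exact: mul_linr | exact: mul_linl]. Qed.
Let mHB2 (v : H \ox B) :
  bilin (fun (h : H) (y : B) => klift (fun h' y' => (h * h') \ot (y' * y)) v).
Proof.
split=> [y|x]; apply: klift_linear_arg => x' y'.
  exact: (linear_comp (kpair_linl _) (mul_linl _)).
exact: (linear_comp (kpair_linr _) (mul_linr _)).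
Qed.
Let mHB_linl v : linear (mulHB^~ v). Proof. exact: (klift_linear (mHB2 v)). Qed.
Let mHB_linr u : linear (mulHB u).
Proof. by apply: klift_linear_arg => x y; exact: (klift_linear (mHB1 x y)). Qed.
Let mHB_pair h y h' y' : mulHB (h \ot y) (h' \ot y') = (h * h') \ot (y' * y).
Proof. by rewrite /mulHB klift_pair ?klift_pair. Qed.
Let m3_1 (x : B) (u : H \ox B) : bilin (fun x' u' => (x * x') \ot mulHB u u').
Proof. by apply: tmap_bilin => //; exact: mul_linr. Qed.
Let m3_2 t : bilin (fun (x : B) (u : H \ox B) =>
  klift (fun x' u' => (x * x') \ot mulHB u u') t).
Proof.
split=> [u|x]; apply: klift_linear_arg => x' u'.
  exact: (linear_comp (kpair_linl _) (mul_linl _)).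
exact: (linear_comp (kpair_linr _) (mHB_linl u')).
Qed.
Let m3_linl t : linear (mul3^~ t). Proof. exact: (klift_linear (m3_2 t)). Qed.
Let m3_linr s : linear (mul3 s).
Proof. by apply: klift_linear_arg => x y; exact: (klift_linear (m3_1 x y)). Qed.
Let m3_pair x h y x' h' y' : mul3 (x \ot (h \ot y)) (x' \ot (h' \ot y')) =
  (x * x') \ot ((h * h') \ot (y' * y)).
Proof. by rewrite /mul3 klift_pair ?klift_pair ?mHB_pair. Qed.

Let gammaLM s t : gammaL (s * t) = mul3 (gammaL s) (gammaL t).
Proof.
move: s; apply: env_ext => [||x y].
- exact: (linear_comp gammaL_linear (env_mul_linl t)).
- exact: (linear_comp (m3_linl _) gammaL_linear).
move: t; apply: env_ext => [||x' y'].
- exact: (linear_comp gammaL_linear (env_mul_linr _)).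
- exact: (linear_comp (m3_linr _) gammaL_linear).
rewrite epairM !gammaL_pair coactM.
etransitivity; first exact: (klift_tmul _ _ (gL0 (y' * y))).
rewrite (klift_out _ _ (m3_linl _)); apply: eq_klift => x0 x1.
rewrite (klift_out _ _ (m3_linr _)); apply: eq_klift => x0' x1'.
by rewrite m3_pair.
Qed.

Let gammaRM s t : gammaR (s * t) = mul3 (gammaR s) (gammaR t).
Proof.
move: s; apply: env_ext => [||x y].
- exact: (linear_comp gammaR_linear (env_mul_linl t)).
- exact: (linear_comp (m3_linl _) gammaR_linear).
move: t; apply: env_ext => [||x' y'].
- exact: (linear_comp gammaR_linear (env_mul_linr _)).
- exact: (linear_comp (m3_linr _) gammaR_linear).
rewrite epairM !gammaR_pair coactM.
etransitivity; first exact: (klift_tmul _ _ (gR0 (x * x'))).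
rewrite klift_exch.
rewrite (klift_out _ _ (m3_linl _)); apply: eq_klift => y0 y1.
rewrite (klift_out _ _ (m3_linr _)); apply: eq_klift => y0' y1'.
by rewrite m3_pair antipVM.
Qed.

Fact in_gamma_subring : subring_closed in_gamma.
Proof.
split=> [|s t /asboolP Es /asboolP Et|s t /asboolP Es /asboolP Et]; apply/asboolP.
- have EL : gammaL (epair 1 1) = 1 \ot (1 \ot 1).
    by rewrite gammaL_pair coact1; exact: (klift_pair (gL0 1)).
  have ER : gammaR (epair 1 1) = 1 \ot (1 \ot 1).
    rewrite gammaR_pair coact1; etransitivity; first exact: (klift_pair (gR0 1)).
    by rewrite antipV1.
  exact: etrans EL (esym ER).
- by rewrite (linB gammaL_linear) (linB gammaR_linear) Es Et.
- by rewrite gammaLM gammaRM Es Et.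
Qed.
HB.instance Definition _ := GRing.isSubringClosed.Build (env B) in_gamma in_gamma_subring.

Record Gamma : Type := MkGamma { gval : env B; gvalP : gval \in in_gamma }.
HB.instance Definition _ := [isSub for gval].
HB.instance Definition _ := [Choice of Gamma by <:].
HB.instance Definition _ := GRing.SubChoice_isSubPzRing.Build (env B) in_gamma Gamma in_gamma_subring.
End Gamma.

Section EnvGamma.
Variables (k : fieldType) (H : algType k) (hH : hopf H) (A B : algType k).
Variables (cB : comod_alg hH B) (gB : galois_ext A cB).

Fact env_map_in_gamma z : env_map (incl gB) z \in in_gamma cB.
Proof.
apply/asboolP; move: z; apply: env_ext => [||a a'].
- exact: (linear_comp (gammaL_linear cB) (env_map_linear _)).
- exact: (linear_comp (gammaR_linear cB) (env_map_linear _)).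
have E c : coact cB (incl gB c) = incl gB c \ot 1.
  by apply/(coinvP gB); exists c.
rewrite env_map_pair gammaL_pair gammaR_pair !E.
etransitivity; first exact: (klift_pair (tassoc_bilin1 _ _ _)).
apply: esym; etransitivity; first apply: klift_pair; last by rewrite antipV1.
split=> [y1|y0]; first exact: (linear_comp (kpair_linr _) (kpair_linr _)).
exact: (linear_comp (kpair_linr _) (linear_comp (kpair_linl _) (antipV_linear hH))).
Qed.

Definition env_gamma (z : env A) : Gamma cB := MkGamma (env_map_in_gamma z).

Fact env_gamma_zmod : zmod_morphism env_gamma.
Proof. by move=> s t; apply: val_inj; rewrite /= raddfB. Qed.
Fact env_gamma_monoid : monoid_morphism env_gamma.
Proof.
split=> [|s t]; apply: val_inj; first by rewrite /= rmorph1.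
by rewrite /= rmorphM.
Qed.
HB.instance Definition _ :=
  GRing.isZmodMorphism.Build (env A) (Gamma cB) env_gamma env_gamma_zmod.
HB.instance Definition _ :=
  GRing.isMonoidMorphism.Build (env A) (Gamma cB) env_gamma env_gamma_monoid.
End EnvGamma.

(* Every submodule is a direct summand. *)
Definition semisimple_module (R : pzRingType) (M : lmodType R) : Prop :=
  forall U : submodClosed M, exists W : submodClosed M,
    (forall m, exists u w, [/\ u \in U, w \in W & m = u + w]) /\
    (forall m, m \in U -> m \in W -> m = 0).

Definition semisimple_ring (R : pzRingType) : Prop := semisimple_module R^o.

Definition projective (R : pzRingType) (M : lmodType R) : Prop :=
  forall (X Y : lmodType R) (p : X -> Y) (f : M -> Y),
    linear p -> (forall y, exists x, p x = y) -> linear f ->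
    exists g : M -> X, linear g /\ forall m, p (g m) = f m.

Definition resolves (R : pzRingType) (P : nat -> lmodType R) (X : zmodType)
    (d : forall n, P n.+1 -> P n) (e : P 0%N -> X) : Prop :=
  [/\ forall x, exists m, e m = x,
      forall m, e m = 0 <-> exists m', d 0%N m' = m
    & forall n m, d n m = 0 <-> exists m', d n.+1 m' = m].

Record proj_resolution (R : pzRingType) (X : lmodType R) (P : nat -> lmodType R)
    (d : forall n, P n.+1 -> P n) (e : P 0%N -> X) : Prop := ProjResolution {
  res_d : forall n, linear (d n);
  res_e : linear e;
  res_exact : resolves d e;
  res_proj : forall n, projective (P n) }.

Record chain_map_over (R : pzRingType) (X : Type) (P Q : nat -> lmodType R)
    (dP : forall n, P n.+1 -> P n) (eP : P 0%N -> X)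
    (dQ : forall n, Q n.+1 -> Q n) (eQ : Q 0%N -> X)
    (phi : forall n, P n -> Q n) : Prop := ChainMapOver {
  cmap_linear : forall n, linear (phi n);
  cmap_d : forall n m, phi n (dP n m) = dQ n (phi n.+1 m);
  cmap_aug : forall m, eQ (phi 0%N m) = eP m }.

(* An A-bimodule is a left [env A]-module: a m a' is [epair a a' *: m]. *)
Section BimoduleTensor.
Variables (k : fieldType) (A : algType k).

Definition kmod (M : lmodType (env A)) : lmodType k := restr (@env_const k A) M.

Definition atens (M N : lmodType (env A)) : Type :=
  tens (fun (a : A) (m : kmod M) => epair 1 a *: (m : M) : kmod M)
       (fun (a : A) (n : kmod N) => epair a 1 *: (n : N) : kmod N).
HB.instance Definition _ M N := GRing.Lmodule.on (atens M N).

Definition apair (M N : lmodType (env A)) (m : M) (n : N) : atens M N :=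
  tpair _ _ (m : kmod M) (n : kmod N).

Definition alift (M N : lmodType (env A)) (U : lmodType k) (phi : M -> N -> U)
    (t : atens M N) : U :=
  tlift (phi : kmod M -> kmod N -> U) t.

Definition amap (M N M' N' : lmodType (env A)) (f : M -> M') (g : N -> N') :
  atens M N -> atens M' N' := alift (fun m n => apair (f m) (g n)).
End BimoduleTensor.

Section Cohomology.
Variables (k : fieldType) (A B : algType k) (iota : {lrmorphism A -> B}).

Definition coefB : lmodType (env A) := restr (env_map iota) (bireg B).

Definition bimod_map (M : lmodType (env A)) (f : M -> B) : Prop :=
  linear (f : M -> coefB).

Variables (P : nat -> lmodType (env A)) (d : forall n, P n.+1 -> P n).

Definition is_cocycle n : {pred P n -> B} :=
  [pred f | `[< bimod_map f /\ forall m, f (d m) = 0 >]].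

Fact is_cocycle_submod n : submod_closed (@is_cocycle n).
Proof.
have sZ c (z : env A) b : c *: sandwich (env_map iota z) b =
    sandwich (env_map iota z) (c *: b).
  by rewrite (linZ (sandwich_linr _)).
split=> [|c f g /asboolP[fL fd] /asboolP[gL gd]]; apply/asboolP; split=> //=.
- by move=> z m m'; rewrite /GRing.zero /= scaler0 addr0.
- move=> z m m'; rewrite -[RHS]/(sandwich _ (c *: f m + g m) + (c *: f m' + g m')).
  have -> : (c *: f + g) (z *: m + m') = c *: f (z *: m + m') + g (z *: m + m') by [].
  rewrite fL gL -[_ *: (_ : coefB) in LHS]/(sandwich (env_map iota z) (f m)).
  rewrite -[_ *: (g m : coefB)]/(sandwich (env_map iota z) (g m)).
  by rewrite (linD (sandwich_linr _)) scalerDr -sZ addrACA.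
- move=> m; have -> : (c *: f + g) (d m) = c *: f (d m) + g (d m) by [].
  by rewrite fd gd scaler0 addr0.
Qed.

Record cocycle n : Type := Cocycle { cval : P n -> B; cvalP : cval \in @is_cocycle n }.
HB.instance Definition _ n := [isSub for @cval n].
HB.instance Definition _ n := [Choice of cocycle n by <:].
HB.instance Definition _ n :=
  GRing.SubChoice_isSubLmodule.Build k (P n -> B) (@is_cocycle n) (cocycle n)
    (@is_cocycle_submod n).

Definition coboundary n : (P n -> B) -> Prop :=
  match n return (P n -> B) -> Prop with
  | 0 => fun f => forall m, f m = 0
  | n'.+1 => fun f => exists g : P n' -> B, bimod_map g /\ forall m, f m = g (d m)
  end.

Definition Coh n : Type := quotmod (fun z : cocycle n => coboundary (cval z)).
HB.instance Definition _ n := GRing.Lmodule.on (Coh n).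

(* The class of the cocycle f; it is 0 when f is not a cocycle. *)
Definition coh_class n (f : P n -> B) : Coh n := qclass _ (insubd (0 : cocycle n) f).

Definition coh_repr n (x : Coh n) : P n -> B := cval (qrepr x).

(* A morphism of complexes P -> P (x)_A P is given by its components
   [T (p + q) p q : P (p + q) -> P p (x)_A P q]; the components [T n p q] with
   n <> p + q play no role. *)
Record lifting (e : P 0%N -> A) (T : forall n p q, P n -> atens (P p) (P q)) : Prop :=
  Lifting {
  lift_add : forall p q (m m' : P (p + q)%N),
    T (p + q)%N p q (m + m') = T (p + q)%N p q m + T (p + q)%N p q m';
  lift_chain : forall p q (m : P (p + q)%N.+1),
    T (p + q)%N p q (d m) =
    amap (@d p) id (T (p + q)%N.+1 p.+1 q m)
    + (-1) ^+ p *: amap id (@d q) (T (p + q)%N.+1 p q.+1 m);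
  lift_aug : forall m, alift (fun u v => e u * e v) (T 0%N 0%N 0%N m) = e m }.

Definition bimod_equivariant (T : forall n p q, P n -> atens (P p) (P q)) : Prop :=
  forall p q a a' (m : P (p + q)%N),
    T (p + q)%N p q (epair a a' *: m) =
    amap (fun u => epair a 1 *: u) (fun v => epair 1 a' *: v) (T (p + q)%N p q m).

Variable T : forall n p q, P n -> atens (P p) (P q).

(* mu o (f (x) g) o T, without a Koszul sign; as f and g vanish outside degrees
   p and q only one component of T contributes. *)
Definition cup_cochain p q (f : P p -> B) (g : P q -> B) : P (p + q)%N -> B :=
  fun m => alift (fun u v => f u * g v) (T p q m).

Definition cup p q (x : Coh p) (y : Coh q) : Coh (p + q)%N :=
  coh_class (cup_cochain (coh_repr x) (coh_repr y)).
End Cohomology.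

Section GaloisActions.
Variables (k : fieldType) (H : algType k) (hH : hopf H) (A B : algType k).
Variables (cB : comod_alg hH B) (gB : galois_ext A cB).
Local Notation G := (Gamma cB).
Local Notation iota := (incl gB).
Local Notation BAB := (btens iota).

(* beta^-1 (1 (x) h) = sum_i l_i(h) (x)_A r_i(h) *)
Definition transl (h : H) : BAB := canV gB (1 \ot h).

Definition resA (M : lmodType G) : lmodType (env A) := restr (env_gamma gB) M.

(* [hact_decomp h s] says that the terms (u, g, v) of s satisfy
     sum u (x)_A g (x)_A v
       = sum l_i(h_(1)) (x)_A (r_i(h_(1)) (x) l_j(h_(2))) (x)_A r_j(h_(2)),
   with g in Gamma.  This is what gives a meaning to r_i(h_(1)) m l_j(h_(2)) in
   the definition of f <- h, which is then sum u f(g m) v.  Elements of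
   B (x)_A (B (x) B) (x)_A B are written in (B (x)_A B) (x) (B (x)_A B). *)
Definition hact_decomp (h : H) (s : seq (B * G * B)) : Prop :=
  \sum_(q <- s)
     klift (fun x y => bpair iota q.1.1 x \ot bpair iota y q.2) (gval q.1.2)
  = tmap transl transl (comul hH h) :> BAB \ox BAB.

Definition hact_terms (h : H) : seq (B * G * B) :=
  xget [::] [set s | hact_decomp h s]%classic.

Definition hact (M : lmodType G) (f : M -> B) (h : H) : M -> B :=
  fun m => \sum_(q <- hact_terms h) q.1.1 * f (q.1.2 *: m) * q.2.

Definition hinvariant (M : lmodType G) (f : M -> B) : Prop :=
  forall h m, hact f h m = (counit hH h : k) *: f m.

(* [comul_decomp g s] says that the terms (g', g'') of s satisfy, for
   g = sum_p x_p (x) y_p,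
     sum g' (x)_A g''
       = sum_p x_p[0] (x) l_i(x_p[1]) (x)_A r_i(x_p[1]) (x) y_p,
   with g' and g'' in Gamma, as needed to let the right hand side act on a
   tensor product of Gamma-modules. *)
Definition comul_decomp (g : G) (s : seq (G * G)) : Prop :=
  \sum_(q <- s)
     klift (fun x y => klift (fun x' y' => x \ot (bpair iota y x' \ot y'))
                             (gval q.2)) (gval q.1)
  = klift (fun x y => klift (fun x0 x1 => x0 \ot (transl x1 \ot y)) (coact cB x))
          (gval g) :> B \ox (BAB \ox B).

(* [act] is the action of Gamma on M (x)_A N: it is given by the formula
   sum g' m (x)_A g'' n, which makes sense for every g and does not depend on
   the choice of the terms (g', g''). *)
Record diag_action (M N : lmodType G)
    (act : G -> atens (resA M) (resA N) -> atens (resA M) (resA N)) : Prop :=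
  DiagAction {
  diag_linear : forall g, linear (act g);
  diag_decomp : forall g, exists s, comul_decomp g s;
  diag_formula : forall g s, comul_decomp g s -> forall (m : M) (n : N),
    act g (apair (m : resA M) (n : resA N)) =
    \sum_(q <- s) apair (q.1 *: m : resA M) (q.2 *: n : resA N) }.

Section Induced.
Variable M : lmodType G.

(* B^e (x)_Gamma M *)
Definition ind : Type :=
  tens (fun (g : G) (z : env B) => z * gval g)
       (fun (g : G) (m : kmod (resA M)) => (g *: (m : M) : M) : kmod (resA M)).
HB.instance Definition _ := GRing.Zmodule.on ind.

Definition ipair (z : env B) (m : M) : ind := tpair _ _ z (m : kmod (resA M)).

Definition ilift (U : lmodType k) (phi : env B -> M -> U) (t : ind) : U :=
  tlift (phi : env B -> kmod (resA M) -> U) t.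
End Induced.
End GaloisActions.

Section InducedModule.
Variables (k : fieldType) (H : algType k) (hH : hopf H) (A B : algType k).
Variables (cB : comod_alg hH B) (gB : galois_ext A cB).
Local Notation G := (Gamma cB).

Section Module.
Variable M : lmodType G.
Local Notation ra := (fun (g : G) (z : env B) => z * gval g).
Local Notation la :=
  (fun (g : G) (m : kmod (resA gB M)) => (g *: (m : M) : M) : kmod (resA gB M)).
Local Notation T := (tens ra la).

Definition ind_scale (z : env B) (t : ind gB M) : ind gB M :=
  ilift (fun w m => ipair gB (z * w) m : T) t.

Let bal (z : env B) : balanced ra la (fun w m => tpair ra la (z * w) m).
Proof.
have [L R C] := tpair_balanced ra la; split=> [m|w|g w m].
- exact: (linear_comp (L m) (env_mul_linr z)).
- exact: R.
- have E1 := congr1 (fun u => tpair ra la u m) (mulrA z w (gval g)).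
  have E2 := C g (z * w) m.
  by cbv beta in E1, E2 |- *; exact: (etrans E1 E2).
Qed.

Let scale_pair z w m : ind_scale z (tpair ra la w m) = tpair ra la (z * w) m.
Proof. exact: (tlift_pair (bal z)). Qed.

Let scale_linr z : linear (ind_scale z : T -> T).
Proof. exact: (tlift_linear (bal z)). Qed.

Let scale_linl (t : T) : linear ((fun z => ind_scale z t) : env B -> T).
Proof.
apply: tlift_linear_arg => w m.
have [L _ _] := tpair_balanced ra la.
exact: (linear_comp (L m) (env_mul_linl w)).
Qed.

Fact ind_scaleA a b (t : ind gB M) : ind_scale a (ind_scale b t) = ind_scale (a * b) t.
Proof.
move: t; apply: (tens_ext (U := T)) => [||w m].
- exact: (linear_comp (scale_linr a) (scale_linr b)).
- exact: scale_linr.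
rewrite !scale_pair; exact: (congr1 (fun u => tpair ra la u m) (mulrA a b w)).
Qed.
Fact ind_scale1 : left_id 1 ind_scale.
Proof.
apply: (tens_ext (U := T)) => [||w m]; first exact: scale_linr.
  by [].
rewrite scale_pair; exact: (congr1 (fun u => tpair ra la u m) (mul1r w)).
Qed.
Fact ind_scaleDr : right_distributive ind_scale +%R.
Proof. by move=> z s t; exact: (linD (scale_linr z)). Qed.
Fact ind_scaleDl t : {morph ind_scale^~ t : a b / a + b}.
Proof. by move=> a b; exact: (linD (scale_linl t)). Qed.
HB.instance Definition _ := GRing.Zmodule_isLmodule.Build (env B) (ind gB M)
  ind_scaleA ind_scale1 ind_scaleDr ind_scaleDl.

Definition theta (f : M -> B) : ind gB M -> B :=
  ilift (fun z m => sandwich z (f m)).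
End Module.

Definition ind_map (M N : lmodType G) (f : M -> N) (t : ind gB M) : ind gB N :=
  ilift (fun z m => ipair gB z (f m)
         : tens (fun (g : G) (z : env B) => z * gval g)
                (fun (g : G) (n : kmod (resA gB N)) =>
                   (g *: (n : N) : N) : kmod (resA gB N))) t.
End InducedModule.
Arguments theta {k H hH A B cB} gB {M} f t.
Arguments ind_map {k H hH A B cB} gB {M N} f t.

Section Main.
Variables (k : fieldType) (H : algType k) (hH : hopf H) (A B : algType k).
Variables (cB : comod_alg hH B) (gB : galois_ext A cB).
Local Notation G := (Gamma cB).
Local Notation iota := (incl gB).

Variables (K : nat -> lmodType G) (d : forall n, K n.+1 -> K n) (e : K 0%N -> A).

Record gamma_resolution : Prop := GammaResolution {
  gres_d : forall n, linear (@d n);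
  gres_eD : forall m m', e (m + m') = e m + e m';
  (* Gamma acts on A by a |-> sum_p x_p a y_p, computed in B *)
  gres_eG : forall (g : G) m, iota (e (g *: m)) = sandwich (gval g) (iota (e m));
  gres_exact : resolves d e;
  gres_proj : forall n, projective (resA gB (K n)) }.

Definition KA n : lmodType (env A) := resA gB (K n).
Definition dA n : KA n.+1 -> KA n := @d n.
Definition Kt n : lmodType (env B) := ind gB (K n).
Definition dt n : Kt n.+1 -> Kt n := ind_map gB (@d n).
Definition et : Kt 0%N -> bireg B := theta gB (fun m => iota (e m)).

Definition gamma_equivariant
    (T : forall n p q, KA n -> atens (KA p) (KA q)) : Prop :=
  forall p q, exists2 act, @diag_action _ _ _ _ _ _ gB (K p) (K q) act &
    forall g (m : K (p + q)%N), T (p + q)%N p q (g *: m) = act g (T (p + q)%N p q m).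

Definition HA n : lmodType k := Coh iota dA n.

Definition hact_class n (x : HA n) (h : H) : HA n :=
  coh_class iota dA (hact gB (coh_repr x : K n -> B) h).

Definition hinv_class n (x : HA n) : Prop :=
  forall h, hact_class x h = (counit hH h : k) *: x.

Definition coh_unit : HA 0%N := coh_class iota dA (fun m : KA 0%N => iota (e m)).

Section Psi.
Variables (P : nat -> lmodType (env B)) (dP : forall n, P n.+1 -> P n).
Variable phi : forall n, P n -> Kt n.

(* The map induced by Theta on the H-invariant classes: represent x by an
   H-invariant cocycle f and transport Theta(f) along phi : P -> B^e (x)_Gamma K,
   where P is a resolution used to compute HH(B). *)
Definition psi n (x : HA n) : Coh idfun dP n :=
  coh_class idfun dP (fun m =>
    theta gB (xget (fun=> 0)
      [set f : K n -> B | [/\ f \in @is_cocycle k A B iota KA dA n, hinvariant gB f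
                            & coh_class iota dA (f : KA n -> B) = x]]%classic)
      (phi m)).
End Psi.
End Main.

(* Main.v *)
Require Import Defs.
From mathcomp Require Import all_boot all_algebra.
From HB Require Import structures.
From mathcomp Require Import boolp classical_sets.
Set Implicit Arguments.
Unset Strict Implicit.
Unset Printing Implicit Defensive.
Import GRing.Theory.
Local Open Scope ring_scope.

(** Integrals reduce the statement to bimodules.  A semisimple Hopf algebra H has an
    integral t with eps t = 1, fixed by the antipode, and its dual has an integral lam
    with lam t = 1 (semisimple_frob_pair).  Put tau h = beta^-1 (1 (x) h) and
    tr b = b_0 lam(b_1), a map of A-bimodules from B to A.  If tau t = sum u_q (x)_A v_q,
    then b = sum u_q tr(v_q b) = sum tr(b u_q) v_q, and the elements u_q (x) 1 similarly
    present B^e as a finitely generated projective right Gamma-module (fbasis_gamma).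
    Therefore induction from Gamma to B^e is exact (ind_exact).

    In these dual bases the action of h on bimodule maps becomes an operator avg that is
    defined for coefficients in any B^e-module and satisfies one commutation rule with
    Gamma (avg_gamma).  The rule has two consequences.  Invariant bimodule maps are the
    same as Gamma-linear maps, so Theta is the adjunction between induction and
    restriction.  The operator at t turns every bimodule map into a Gamma-linear one, so
    invariant classes have invariant representatives (hinv_representative), and lifts over
    A^e can be made Gamma-linear, whence B^e (x)_Gamma K is projective (ind_projective).
    Together with exactness, B^e (x)_Gamma K is a projective resolution of B.

    For the cup product, no diagonal on B^e (x)_Gamma K is constructed.  On a projective
    resolution P of B with a diagonal, multiplication by a cocycle g is composition with
    the chain map of degree -q that contracts the diagonal by g (yoneda_cup); the
    augmentation of this chain map is cohomologous to g, because the contraction of the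
    diagonal by the augmentation is homotopic to the identity (yoneda_augmentation).
    On B^e (x)_Gamma K the diagonal T of K plays the same role: the contraction of T m by a
    Gamma-linear g, with values in B^e (x)_Gamma K, is Gamma-linear since T is equivariant
    (alift_glin, comul_decomp_right), so it extends to a chain map of degree -q that
    computes Theta(f g) from Theta(f) (theta_ind_slant) and whose augmentation is cohomologous
    to Theta(g) (ind_slant_augmentation).  A chain map of degree -q into a resolution is
    determined by the class of its augmentation, as far as its composites with cocycles are
    concerned (shifted_chain_map_unique).  So the two contractions agree along any
    comparison map from P to B^e (x)_Gamma K, and this is multiplicativity (psi_cup). *)

(** * Linear expressions in tensor products *)

Section LinearClosure.
Variables (k : fieldType).

Lemma lin_scalel (V W : lmodType k) (c : V -> k^o) (b : W) :
  linear c -> linear (fun x => (c x : k) *: b).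
Proof. by move=> cL r x y; rewrite cL scalerDl scalerA. Qed.

Lemma lin_scaler (W : lmodType k) (c : k) : linear (fun x : W => c *: x).
Proof. by move=> r x y; rewrite scalerDr !scalerA mulrC. Qed.

Lemma lin_add (V W : lmodType k) (f g : V -> W) :
  linear f -> linear g -> linear (fun x => f x + g x).
Proof. by move=> fL gL r x y; rewrite fL gL scalerDr addrACA. Qed.

Lemma lin_opp (V W : lmodType k) (f : V -> W) :
  linear f -> linear (fun x => - f x).
Proof. by move=> fL r x y; rewrite fL opprD scalerN. Qed.

Lemma lin_big (V W : lmodType k) I (s : seq I) (P : pred I) (f : I -> V -> W) :
  (forall i, linear (f i)) -> linear (fun x => \sum_(i <- s | P i) f i x).
Proof.
move=> fL r x y; rewrite scaler_sumr -big_split; apply: eq_bigr => i _.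
exact: fL.
Qed.

Lemma kliftB (V W U : lmodType k) (f g : V -> W -> U) t :
  klift (fun v w => f v w - g v w) t = klift f t - klift g t.
Proof.
rewrite /klift /tlift /fext -sumrB; apply: eq_bigr => x _.
by rewrite scalerBr.
Qed.

Lemma klift_sum (V W U : lmodType k) I (r : seq I) (f : I -> V -> W -> U) z :
  klift (fun v w => \sum_(i <- r) f i v w) z = \sum_(i <- r) klift (f i) z.
Proof.
rewrite /klift /tlift /fext exchange_big /=; apply: eq_bigr => x _.
exact: scaler_sumr.
Qed.

Lemma tmul_linl (A C : algType k) (t : A \ox C) : linear (fun s => tmul s t).
Proof. exact: (tmul_bilin A C).1. Qed.
Lemma tmul_linr (A C : algType k) (s : A \ox C) : linear (tmul s).
Proof. exact: (tmul_bilin A C).2. Qed.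

Lemma lin_id (V : lmodType k) : linear (fun x : V => x).
Proof. by []. Qed.
End LinearClosure.

(** The tactic lin proves that an expression is linear, or bilinear, in a variable by
    peeling off its outermost operation; lin_known is extended as new operations are
    introduced. *)
Ltac lin_antip :=
  lazymatch goal with
  | |- GRing.linear_for _ (antipV _) => exact: antipV_linear
  end.
Ltac lin_known := lin_antip.
Ltac lin_head :=
  match goal with
  | h : GRing.linear_for _ ?g |- GRing.linear_for _ ?f => constr_eq f g; exact h
  | |- GRing.linear_for _ (?f _) => is_var f;
      match goal with h : forall x, GRing.linear_for _ _ |- _ => exact (h _) end
  | |- GRing.linear_for _ (fun x => ?f x _) => is_var f;
      match goal with h : forall x, GRing.linear_for _ _ |- _ => exact (h _) end
  | |- GRing.linear_for _ (GRing.Linear.sort _) => exact: linearP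
  | |- GRing.linear_for _ (GRing.LRMorphism.sort _) => exact: linearP
  | |- GRing.linear_for _ (fun x => GRing.Linear.sort _ x) => exact: linearP
  | |- GRing.linear_for _ (fun x => GRing.LRMorphism.sort _ x) => exact: linearP
  | |- GRing.linear_for _ (kpair _) => exact: kpair_linr
  | |- GRing.linear_for _ (GRing.mul _) => exact: mul_linr
  | |- GRing.linear_for _ (tmul _) => exact: tmul_linr
  | |- GRing.linear_for _ (GRing.scale _) => exact: lin_scaler
  | |- GRing.linear_for _ _ => lin_known
  end.

Ltac lin_step :=
  match goal with
  | |- bilin _ => split
  | |- GRing.linear_for _ (fun x => x) => exact: lin_id
  | |- GRing.linear_for _ id => exact: lin_id
  | |- GRing.linear_for _ (fun x => GRing.add (@?a x) (@?b x)) =>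
      apply: (@lin_add _ _ _ a b)
  | |- GRing.linear_for _ (fun x => GRing.opp (@?a x)) => apply: (@lin_opp _ _ _ a)
  | |- GRing.linear_for _ (fun x => bigop _ _ _) => apply: lin_big
  | |- GRing.linear_for _ (fun x => kpair ?b (@?a x)) =>
      apply: (linear_comp (kpair_linr b) (g := a))
  | |- GRing.linear_for _ (fun x => kpair (@?a x) ?b) =>
      apply: (linear_comp (kpair_linl b) (g := a))
  | |- GRing.linear_for _ (kpair ?b) => exact: kpair_linr
  | |- GRing.linear_for _ (fun x => GRing.mul ?b (@?a x)) =>
      apply: (linear_comp (mul_linr b) (g := a))
  | |- GRing.linear_for _ (fun x => GRing.mul (@?a x) ?b) =>
      apply: (linear_comp (mul_linl b) (g := a))
  | |- GRing.linear_for _ (fun x => tmul ?b (@?a x)) =>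
      apply: (linear_comp (tmul_linr b) (g := a))
  | |- GRing.linear_for _ (fun x => tmul (@?a x) ?b) =>
      apply: (linear_comp (tmul_linl b) (g := a))
  | |- GRing.linear_for _ (fun x => GRing.scale ?b (@?a x)) =>
      apply: (linear_comp (@lin_scaler _ _ b) (g := a))
  | |- GRing.linear_for _ (fun x => GRing.scale (@?a x) ?b) =>
      apply: (lin_scalel (c := a) b)
  | |- GRing.linear_for _ (fun x => klift ?f (@?a x)) =>
      apply: (linear_comp (klift_linear (phi := f) _) (g := a))
  | |- GRing.linear_for _ (fun x => klift (@?a x) ?t) =>
      apply: (klift_linear_arg (phi := a))
  | |- GRing.linear_for _ (klift _) => apply: klift_linear
  | |- GRing.linear_for _ (fun x => tmap ?f ?g (@?a x)) =>
      apply: (linear_comp (tmap_linear (f := f) (g := g) _ _) (g := a))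
  | |- GRing.linear_for _ (tmap _ _) => apply: tmap_linear
  | |- GRing.linear_for _ (fun x => tassoc (@?a x)) =>
      apply: (linear_comp (@tassoc_linear _ _ _ _) (g := a))
  | |- GRing.linear_for _ (fun x => ?f (@?a x)) =>
      apply: (linear_comp (f := f) (g := a)); [lin_head | ]
  | |- GRing.linear_for _ (fun x => ?f (@?a x) ?b) =>
      apply: (linear_comp (f := fun y => f y b) (g := a)); [lin_head | ]
  | |- GRing.linear_for _ _ => lin_head
  end.
Ltac lin := cbv beta; intros; cbv beta; first [ lin_head | once lin_step; lin ].

Opaque klift tlift.
(** * Functionals that avoid a vector *)

Section Functional.
Variables (k : fieldType) (V : lmodType k).

Definition subsp (U : V -> Prop) : Prop :=
  U 0 /\ forall c x y, U x -> U y -> U (c *: x + y).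

(** Zorn gives a subspace that is maximal among those containing U and missing v. Adding
    a vector to it must capture v, so it has codimension one. *)
Lemma subsp_max (U : V -> Prop) v : subsp U -> ~ U v ->
  exists W : V -> Prop, [/\ subsp W, forall x, U x -> W x, ~ W v &
    forall x, exists c, W (x - c *: v)].
Proof.
move=> [U0 UL] Uv.
pose good (W : set V) := [/\ forall x, U x -> W x, ~ W v &
  forall c x y, W x -> W y -> W (c *: x + y)].
pose P (W : set V) := good [set x | U x \/ W x]%classic.
have [F FP Ft|W [PW Wmax]] := @Zorn_bigcup V P.
  pose Z := (\bigcup_(X in F) X)%classic.
  have case2 x y : (U x \/ Z x) -> (U y \/ Z y) ->
    (U x /\ U y) \/ exists X, [/\ F X, U x \/ X x & U y \/ X y].
    case=> [Ux|[X FX Xx]] [Uy|[Y FY Yy]]; first by left.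
    - by right; exists Y; split=> //; [left|right].
    - by right; exists X; split=> //; [right|left].
    - case: (Ft X Y FX FY) => le; right.
        by exists Y; split=> //; right => //; apply: le.
      by exists X; split=> //; right => //; apply: le.
  split=> [x Ux|[//|[X FX Xv]]|c x y Hx Hy].
  - by left.
  - by have [_ + _] := FP X FX; apply; right.
  - have [[Ux Uy]|[X [FX Xx Xy]]] := case2 x y Hx Hy; first by left; apply: UL.
    have [_ _ /(_ c x y Xx Xy) []] := FP X FX; first by left.
    by right; exists X.
pose W' x := U x \/ W x.
have W'U x : U x -> W' x by left.
have [_ W'v W'L] := PW.
have W's : subsp W' by split; [left|].
exists W'; split=> // x.
have [Wx|Wx] := pselect (W' x); first by exists 0; rewrite scale0r subr0.
pose W2 := [set y | exists c, W' (y - c *: x)]%classic.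
have W2L c y z : W2 y -> W2 z -> W2 (c *: y + z).
  move=> [a Ha] [b Hb]; exists (c * a + b).
  have -> : c *: y + z - (c * a + b) *: x = c *: (y - a *: x) + (z - b *: x).
    by rewrite scalerBr scalerA scalerDl opprD addrACA.
  exact: W'L.
have W2W y : W' y -> W2 y by move=> Hy; exists 0; rewrite scale0r subr0.
have W2x : W2 x by exists 1; rewrite scale1r subrr; case: W's.
have [[c Hc]|W2v] := pselect (W2 v).
  have c0 : c != 0.
    by apply/eqP => c0; move: Hc; rewrite c0 scale0r subr0.
  exists c^-1.
  have -> : x - c^-1 *: v = (- c^-1) *: (v - c *: x) + 0.
    by rewrite addr0 scalerBr scalerA mulNr mulVf // scaleN1r opprK scaleNr addrC.
  by apply: W'L => //; case: W's.
exfalso; apply: (Wmax W2).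
  by split=> [|sub]; [move=> y Wy; apply: W2W; right | apply: Wx; right; apply: sub].
have E : [set x0 | U x0 \/ W2 x0]%classic = W2.
  apply/seteqP; split=> y //=; last by right.
  by case=> // Uy; apply: W2W; left.
by rewrite /P E; split=> // y Uy; apply: W2W; left.
Qed.

(** The functional is the projection to the line of v along a subspace of codimension
    one that contains U but not v. *)
Lemma functional_avoiding (U : V -> Prop) v : subsp U -> ~ U v ->
  exists f : V -> k^o, [/\ linear f, forall x, U x -> f x = 0 & f v = 1].
Proof.
move=> Us Uv; have [W [[W0 WL] UW Wv Wc]] := subsp_max Us Uv.
pose f x := projT1 (cid (Wc x)).
have fP x : W (x - f x *: v) by rewrite /f; case: cid.
have f_uniq x c : W (x - c *: v) -> f x = c.
  move=> Wx; apply/eqP; apply/negP => /negP; rewrite -subr_eq0 => ne; apply: Wv.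
  have -> : v = (f x - c)^-1 *: ((-1) *: (x - f x *: v) + (x - c *: v)) + 0.
    rewrite addr0 scaleN1r opprB addrA subrK.
    by rewrite -scalerBl scalerA mulVf ?scale1r.
  by apply: (WL) => //; apply: (WL).
exists f; split.
- move=> c x y; apply: f_uniq.
  have -> : c *: x + y - (c *: (f x : k^o) + f y) *: v =
            c *: (x - f x *: v) + (y - f y *: v).
    by rewrite scalerBr scalerA scalerDl opprD addrACA.
  by apply: WL.
- by move=> x Ux; apply: f_uniq; rewrite scale0r subr0; apply: UW.
- by apply: f_uniq; rewrite scale1r subrr.
Qed.
End Functional.

(** * The integral of a semisimple Hopf algebra *)

Section HopfIntegral.
Variables (k : fieldType) (H : algType k) (hH : hopf H).
Local Notation S := (antip hH).
Local Notation S' := (antipV hH).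
Local Notation D := (comul hH).
Local Notation eps h := (counit hH h : k).

Lemma counit_lin : linear (counit hH : H -> k^o). Proof. exact: linearP. Qed.

Lemma counit_antip h : eps (S h) = eps h.
Proof.
have E := congr1 (counit hH) (antip_left hH h).
move: E; rewrite /= linearZ /= rmorph1 [_ *: _]mulr1 => <-.
rewrite -{1}[h](comul_counitr hH h).
rewrite (klift_out (f := fun h => counit hH (S h) : k^o)); last by lin.
rewrite (klift_out (f := counit hH : H -> k^o)); last by lin.
apply: (@eq_klift _ _ _ k^o) => x y; rewrite !linearZ /= rmorphM; exact: mulrC.
Qed.

Lemma counit_antipV h : eps (S' h) = eps h.
Proof. by rewrite -counit_antip antipVK. Qed.

Lemma antipV_left h : klift (fun x y => S' y * x) (D h) = eps h *: 1.
Proof.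
apply: (can_inj (antipK hH)); rewrite (klift_out (f := S)); last by lin.
rewrite linearZ /= antip1 -antip_left; apply: eq_klift => x y.
by rewrite antipM antipVK.
Qed.

Lemma antipV_right h : klift (fun x y => y * S' x) (D h) = eps h *: 1.
Proof.
apply: (can_inj (antipK hH)); rewrite (klift_out (f := S)); last by lin.
rewrite linearZ /= antip1 -antip_right; apply: eq_klift => x y.
by rewrite antipM antipVK.
Qed.

Lemma kpairZl (V W : lmodType k) c (v : V) (w : W) : (c *: v) \ot w = c *: (v \ot w).
Proof. exact: (linZ (kpair_linl w)). Qed.
Lemma kpairZr (V W : lmodType k) c (v : V) (w : W) : v \ot (c *: w) = c *: (v \ot w).
Proof. exact: (linZ (kpair_linr v)). Qed.

Lemma ktensE (V W : lmodType k) (t : V \ox W) :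
  exists s : seq (V * W), t = \sum_(q <- s) q.1 \ot q.2.
Proof.
have [s ->] := tensE t; exists [seq (q.1 *: q.2.1, q.2.2) | q <- s].
by rewrite big_map; apply: eq_bigr => q _ /=; rewrite kpairZl.
Qed.

(** The kernel of eps is a left ideal. The component of 1 in a complement spans a
    trivial module, as h - eps(h) 1 sends it into both summands. *)
Lemma semisimple_left_integral : semisimple_ring H ->
  exists2 t : H, eps t = 1 & forall h, h * t = eps h *: t.
Proof.
move=> ss; pose U : {pred H^o} := fun h => eps (h : H) == 0.
have Uc : submod_closed U.
  split=> [|a x y]; first by rewrite unfold_in rmorph0.
  rewrite !unfold_in => /eqP Ex /eqP Ey.
  have -> : counit hH (a *: x + y : H^o) = counit hH a * counit hH (x : H) + counit hH (y : H).
    by rewrite -rmorphM -rmorphD.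
  by rewrite Ex Ey mulr0 addr0.
pose Us := GRing.isSubmodClosed.Build H H^o U Uc.
pose US : submodClosed H^o := HB.pack U Us.
have [W [WD Wd]] := ss US.
have [u [w [Uu Ww E1]]] := WD (1 : H).
have ew : eps (w : H) = 1.
  have := congr1 (counit hH) E1; rewrite /= rmorph1 raddfD /=.
  by move: Uu; rewrite unfold_in => /eqP ->; rewrite add0r.
exists w => // h; apply/eqP; rewrite -subr_eq0; apply/eqP.
apply: (Wd (h * w - eps h *: w : H)).
  by rewrite unfold_in raddfB /= rmorphM linearZ /= ew [_ *: _]mulr1 mulr1 subrr.
have -> : (h * w - eps h *: w : H) = (h - eps h *: 1 : H) *: (w : H^o).
  by rewrite -[RHS]/((h - eps h *: 1) * (w : H)) mulrBl -scalerAl mul1r.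
exact: rpredZ.
Qed.

(** If t is a left integral then S t is a right one, so that (S t) t equals both. *)
Lemma semisimple_integral : semisimple_ring H ->
  exists t : H, [/\ eps t = 1, forall h, h * t = eps h *: t,
                    forall h, t * h = eps h *: t & S t = t].
Proof.
move=> ss; have [t et tl] := semisimple_left_integral ss.
have St h : S t * h = eps h *: S t.
  rewrite -{1}[h](antipVK hH) -antipM tl linearZ /=.
  by rewrite counit_antipV.
have E : S t = t.
  transitivity (S t * t); first by rewrite St et scale1r.
  by rewrite tl counit_antip et scale1r.
by exists t; split=> // h; rewrite -{1}E St E.
Qed.
End HopfIntegral.

(** * Integrals in the dual of a Hopf algebra *)

Section MinimalTensor.
Variables (k : fieldType).

Lemma klift_kpair (V W : lmodType k) (t : V \ox W) : klift (fun v w => v \ot w) t = t.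
Proof.
move: t; apply: ktens_ext => // [|v w]; first by lin.
by rewrite klift_pair; last by lin.
Qed.

Definition indep (V : lmodType k) n (a : 'I_n -> V) : Prop :=
  forall c : 'I_n -> k, \sum_i c i *: a i = 0 -> forall i, c i = 0.

Definition lcomb (V : lmodType k) n (a : 'I_n -> V) (x : V) : Prop :=
  exists c : 'I_n -> k, x = \sum_i c i *: a i.

Lemma lcomb_subsp (V : lmodType k) n (a : 'I_n -> V) : subsp (lcomb a).
Proof.
split=> [|r x y [c ->] [d ->]].
  by exists (fun=> 0); rewrite big1 // => i _; rewrite scale0r.
exists (fun i => r * c i + d i); rewrite scaler_sumr -big_split.
by apply: eq_bigr => i _; rewrite scalerDl scalerA.
Qed.

Lemma lcomb_mem (V : lmodType k) n (a : 'I_n -> V) i : lcomb a (a i).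
Proof.
exists (fun j => (j == i)%:R); rewrite (bigD1 i) //= eqxx scale1r.
by rewrite big1 ?addr0 // => j /negPf ->; rewrite scale0r.
Qed.

Lemma dep_solve (V : lmodType k) n (a : 'I_n.+1 -> V) c j :
  \sum_i c i *: a i = 0 -> c j != 0 ->
  a j = \sum_i (- (c j)^-1 * c (lift j i)) *: a (lift j i).
Proof.
rewrite (bigD1_ord j) //= => E cj.
have -> : a j = - (c j)^-1 *: - (c j *: a j).
  by rewrite scaleNr scalerN opprK scalerA mulVf ?scale1r.
move/eqP: E; rewrite addr_eq0 => /eqP ->; rewrite opprK scaler_sumr.
by apply: eq_bigr => i _; rewrite scalerA.
Qed.

(** A shortest expression of a tensor has independent factors on both sides, since a
    dependency would allow one term to be absorbed by the others. *)
Lemma minimal_tensor (V W : lmodType k) (t : V \ox W) :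
  exists n (a : 'I_n -> V) (b : 'I_n -> W),
    [/\ t = \sum_i a i \ot b i, indep a & indep b].
Proof.
pose ex n := `[< exists (a : 'I_n -> V) (b : 'I_n -> W), t = \sum_i a i \ot b i >].
have exn : exists n, ex n.
  have [s E] := ktensE t; exists (size s); apply/asboolP.
  exists (fun i => (nth (0, 0) s i).1), (fun i => (nth (0, 0) s i).2).
  by rewrite {1}E (big_nth (0, 0)) big_mkord.
case: (ex_minnP exn) => n /asboolP[a [b E]] nmin.
exists n, a, b; split=> // c c0 j; apply/eqP; apply: contraT => cj.
  case: n => [|n] in a b E nmin c c0 j cj *; first by case: j {cj}.
  suff /nmin : ex n by rewrite ltnn.
  apply/asboolP; exists (fun i => a (lift j i)).
  exists (fun i => (- (c j)^-1 * c (lift j i)) *: b j + b (lift j i)).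
  rewrite E (bigD1_ord j) //= {1}(dep_solve c0 cj).
  rewrite (lin_sum (kpair_linl (b j))) -big_split; apply: eq_bigr => i _ /=.
  by rewrite (linD (kpair_linr _)) kpairZl kpairZr.
case: n => [|n] in a b E nmin c c0 j cj *; first by case: j {cj}.
suff /nmin : ex n by rewrite ltnn.
apply/asboolP; exists (fun i => (- (c j)^-1 * c (lift j i)) *: a j + a (lift j i)).
exists (fun i => b (lift j i)).
rewrite E (bigD1_ord j) //= {1}(dep_solve c0 cj).
rewrite (lin_sum (kpair_linr (a j))) -big_split; apply: eq_bigr => i _ /=.
by rewrite (linD (kpair_linl _)) kpairZl kpairZr.
Qed.

(** Contract the second factors with a functional that is 1 on a nonzero w i. *)
Lemma indep_tensor_eq0 (V W : lmodType k) n (a : 'I_n -> V) (w : 'I_n -> W) :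
  indep a -> \sum_i a i \ot w i = 0 -> forall i, w i = 0.
Proof.
move=> ai E i; apply/eqP; apply: contraT => /eqP wi.
have U0 : subsp (fun x : W => x = 0).
  by split=> // c x y -> ->; rewrite scaler0 addr0.
have [f [fL _ f1]] := functional_avoiding U0 wi.
have B : bilin (fun (v : V) (x : W) => (f x : k) *: v) by split; lin.
have := congr1 (klift (fun v x => (f x : k) *: v)) E.
rewrite (lin_sum (klift_linear B)) (lin0 (klift_linear B)).
under eq_bigr => j _ do rewrite klift_pair //.
by move/ai/(_ i)/eqP; rewrite f1 oner_eq0.
Qed.

Lemma basis_functional (V : lmodType k) n (b : 'I_n -> V) (m : 'I_n -> k) :
  indep b -> (forall x, lcomb b x) ->
  exists f : V -> k^o, linear f /\ forall i, f (b i) = m i.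
Proof.
move=> bi bs; pose c x := projT1 (cid (bs x)).
have cP x : x = \sum_i c x i *: b i by rewrite /c; case: cid.
have cU x d : x = \sum_i d i *: b i -> c x = d.
  move=> E; apply/funext => i; apply/eqP; rewrite -subr_eq0; apply/eqP.
  apply: (bi (fun i => c x i - d i)).
  under eq_bigr => j _ do rewrite scalerBl.
  by rewrite sumrB -E -cP subrr.
exists (fun x => \sum_i c x i * m i); split=> [r x y|i].
  rewrite (cU (r *: x + y) (fun i => r * c x i + c y i)).
    rewrite scaler_sumr -big_split; apply: eq_bigr => i _.
    by rewrite mulrDl -mulrA.
  rewrite {1}[x]cP {1}[y]cP scaler_sumr -big_split; apply: eq_bigr => i _.
  by rewrite scalerDl scalerA.
rewrite (cU (b i) (fun j => (j == i)%:R)); last first.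
  rewrite (bigD1 i) //= eqxx scale1r.
  by rewrite big1 ?addr0 // => j /negPf ->; rewrite scale0r.
rewrite (bigD1 i) //= eqxx mul1r big1 ?addr0 // => j /negPf ->.
by rewrite mul0r.
Qed.
End MinimalTensor.

Section FrobeniusForm.
Variables (k : fieldType) (H : algType k) (hH : hopf H).
Local Notation S := (antip hH).
Local Notation S' := (antipV hH).
Local Notation D := (comul hH).
Local Notation eps h := (counit hH h : k).

Variable t : H.
Hypothesis et : eps t = 1.
Hypothesis tl : forall h, h * t = eps h *: t.

(** t_1 (x) h t_2 = S(h_1) h_2 t_1 (x) h_3 t_2 = S(h) t_1 (x) t_2, since D(h t) = eps(h)
    D(t). *)
Lemma integral_comul_antip h :
  klift (fun x y => x \ot (h * y)) (D t) = klift (fun x y => (S h * x) \ot y) (D t).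
Proof.
transitivity (klift (fun h1 h2 => klift (fun x y => (S h1 * x) \ot y) (D (h2 * t))) (D h)).
  transitivity (klift (fun h1 h' => klift (fun h2 h3 => klift (fun x y =>
     (S h1 * (h2 * x)) \ot (h3 * y)) (D t)) (D h')) (D h)); last first.
    apply: eq_klift => h1 h'; rewrite comulM klift_tmul; last by lin.
    by apply: eq_klift => x y; apply: eq_klift => x' y'.
  rewrite (@coassoc _ _ hH _ (fun h1 h2 h3 => klift (fun x y =>
     (S h1 * (h2 * x)) \ot (h3 * y)) (D t))); try by lin.
  transitivity (klift (fun h1 h2 => eps h1 *: klift (fun x y => x \ot (h2 * y)) (D t)) (D h)).
    rewrite -[in LHS](comul_counitl hH h).
    rewrite (klift_out (f := fun h => klift (fun x y => x \ot (h * y)) (D t))); last by lin.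
    by apply: eq_klift => x y; rewrite (linZ (f := fun h => klift (fun x y => x \ot (h * y)) (D t))) //; lin.
  apply: eq_klift => h1 h2; rewrite -kliftZ klift_exch; apply: eq_klift => x y.
  rewrite -kpairZl -[x in LHS]mul1r scalerAl -antip_left.
  rewrite (klift_out (f := fun h => (h * x) \ot (h2 * y))); last by lin.
  by apply: eq_klift => u v; rewrite mulrA.
transitivity (klift (fun h1 h2 => eps h2 *: klift (fun x y => (S h1 * x) \ot y) (D t)) (D h)).
  apply: eq_klift => h1 h2; rewrite tl linearZ /= (linZ (f := klift _)) //.
  by apply: klift_linear; lin.
rewrite -[in RHS](comul_counitr hH h).
rewrite (klift_out (f := fun h => klift (fun x y => (S h * x) \ot y) (D t))); last by lin.
by apply: eq_klift => x y; rewrite (linZ (f := fun h => klift (fun x y => (S h * x) \ot y) (D t))) //; lin.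
Qed.

(** In a shortest expression of D(t) the second factors span a left ideal by
    integral_comul_antip, and so do the first factors. These ideals contain 1 = S(t_1)
    t_2 and 1 = S^-1(t_2) t_1, so the factors are bases of H, and there is a functional
    lam with t_1 lam(t_2) = 1. *)
Lemma cointegral_exists : exists lam : H -> k^o,
  [/\ linear lam, lam t = 1 &
      forall h, klift (fun x y => (lam y : k) *: x) (D h) = (lam h : k) *: 1].
Proof.
have [n [a [b [E ai bi]]]] := minimal_tensor (D t).
have sumD (U : lmodType k) (phi : H -> H -> U) : bilin phi ->
    klift phi (D t) = \sum_i phi (a i) (b i).
  move=> B; rewrite E (lin_sum (klift_linear B)); apply: eq_bigr => i _.
  by rewrite klift_pair.
have bH h j : lcomb b (h * b j).
  apply: contrapT => nb; have [f [fL fb f1]] := functional_avoiding (lcomb_subsp b) nb.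
  have B : bilin (fun x y : H => (f y : k) *: x) by lin.
  have := congr1 (klift (fun x y => (f y : k) *: x)) (integral_comul_antip h).
  rewrite (sumD _ _ (_ : bilin (fun x y => x \ot (h * y)))); last by lin.
  rewrite (sumD _ _ (_ : bilin (fun x y => (S h * x) \ot y))); last by lin.
  rewrite !(lin_sum (klift_linear B)).
  under eq_bigr do rewrite (klift_pair B).
  rewrite [in RHS]big1 => [/ai /(_ j) fj|i _].
    by move/eqP: f1; rewrite fj eq_sym oner_eq0.
  rewrite (klift_pair B).
  by rewrite fb ?scale0r //; exact: lcomb_mem.
have aH h j : lcomb a (h * a j).
  apply: contrapT => na; have [f [fL fa f1]] := functional_avoiding (lcomb_subsp a) na.
  have B : bilin (fun x y : H => (f x : k) *: y) by lin.
  have := congr1 (klift (fun x y => (f x : k) *: y)) (integral_comul_antip (S' h)).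
  rewrite antipVK (sumD _ _ (_ : bilin (fun x y => x \ot (S' h * y)))); last by lin.
  rewrite (sumD _ _ (_ : bilin (fun x y => (h * x) \ot y))); last by lin.
  rewrite !(lin_sum (klift_linear B)).
  under [in RHS]eq_bigr do rewrite (klift_pair B).
  rewrite [in LHS]big1 => [/esym /bi /(_ j) fj|i _].
    by move/eqP: f1; rewrite fj eq_sym oner_eq0.
  rewrite (klift_pair B).
  by rewrite fa ?scale0r //; exact: lcomb_mem.
have sub_sum m (c : 'I_m -> H) (F : 'I_m -> H) :
    (forall i, lcomb c (F i)) -> lcomb c (\sum_i F i).
  move=> cF; have [U0 UL] := lcomb_subsp c.
  by elim/big_rec: _ => // i x _ Ux; rewrite -[F i]scale1r; apply: UL.
have b1 : lcomb b 1.
  rewrite -[1]scale1r -et -antip_left sumD; last by lin.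
  by apply: sub_sum => i; first [exact: aH | exact: bH].
have a1 : lcomb a 1.
  rewrite -[1]scale1r -et.
  rewrite -(antipV_left hH t) sumD; last by lin.
  by apply: sub_sum => i; first [exact: aH | exact: bH].
have aT x : lcomb a x.
  have [c c1] := a1; rewrite -[x]mulr1 c1 mulr_sumr; apply: sub_sum => i.
  by rewrite -scalerAr; have [U0 UL] := lcomb_subsp a; rewrite -[_ *: _]addr0; apply: UL.
have bT x : lcomb b x.
  have [c c1] := b1; rewrite -[x]mulr1 c1 mulr_sumr; apply: sub_sum => i.
  by rewrite -scalerAr; have [U0 UL] := lcomb_subsp b; rewrite -[_ *: _]addr0; apply: UL.
have [mu Emu] := aT 1; have [lam [lamL lamb]] := basis_functional mu bi bT.
have Et : klift (fun x y => (lam y : k) *: x) (D t) = 1.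
  by rewrite sumD; [rewrite Emu; apply: eq_bigr => i _; rewrite lamb | lin].
exists lam; split=> //.
  rewrite -{1}[t](comul_counitl hH) (klift_out (f := lam)) //.
  have := klift_out (fun x y => (lam y : k) *: x) (D t) (counit_lin hH).
  rewrite Et rmorph1 => ->.
  by apply: (@eq_klift _ _ _ k^o) => x y; rewrite (linZ lamL) linearZ; exact: mulrC.
(* sum t_1 (x) psi(t_2) = D(1) - 1 (x) 1 = 0, so psi vanishes on each b i. *)
pose psi h := klift (fun x y => (lam y : k) *: x) (D h) - (lam h : k) *: 1.
have psiL : linear psi by rewrite /psi; lin.
have psi0 : \sum_i a i \ot psi (b i) = 0.
  have B : bilin (fun x y : H => x \ot psi y) by lin.
  rewrite -(sumD _ _ B).
  transitivity (klift (fun x y => klift (fun y1 y2 => x \ot ((lam y2 : k) *: y1)) (D y)) (D t)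
     - klift (fun x y => (lam y : k) *: x) (D t) \ot 1).
    rewrite (klift_out (f := fun x => x \ot 1)); last by lin.
    rewrite -kliftB; apply: eq_klift => x y.
    rewrite /psi (linB (kpair_linr x)) (klift_out (f := kpair x)); last by lin.
    by rewrite kpairZl kpairZr.
  rewrite Et; apply/eqP; rewrite subr_eq0; apply/eqP.
  rewrite (@coassoc _ _ hH _ (fun x y1 y2 => x \ot ((lam y2 : k) *: y1))); try by lin.
  rewrite -(comul1 hH) -Et (klift_out (f := D)); last by lin.
  apply: eq_klift => x y; rewrite linearZ /= -[in RHS](klift_kpair (D x)) -kliftZ.
  by apply: eq_klift => u v; rewrite kpairZr.
have psib := indep_tensor_eq0 ai psi0.
move=> h; apply/eqP; rewrite -subr_eq0 -/(psi h); apply/eqP.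
have [c ->] := bT h; rewrite lin_sum // big1 // => i _.
by rewrite (linZ psiL) psib scaler0.
Qed.
End FrobeniusForm.

(** An integral in H and one in its dual, paired to 1: a Frobenius structure on H. *)
Record frob_pair (k : fieldType) (H : algType k) (hH : hopf H) := FrobPair {
  fint : H;
  flam : H -> k^o;
  fint_l : forall h, h * fint = (counit hH h : k) *: fint;
  fint_r : forall h, fint * h = (counit hH h : k) *: fint;
  fint_antip : antip hH fint = fint;
  fint_counit : (counit hH fint : k) = 1;
  flam_linear : linear flam;
  flam_fint : flam fint = 1;
  flam_comul : forall h,
    klift (fun x y => (flam y : k) *: x) (comul hH h) = (flam h : k) *: 1 }.

Lemma semisimple_frob_pair (k : fieldType) (H : algType k) (hH : hopf H) :
  semisimple_ring H -> inhabited (frob_pair hH).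
Proof.
move=> /(semisimple_integral hH)[t [et tl tr St]].
have [lam [lamL lamt lamP]] := cointegral_exists et tl.
exact: (inhabits (FrobPair tl tr St et lamL lamt lamP)).
Qed.

(** * Comparison of projective resolutions *)

Section Comparison.
Variable (R : pzRingType).

Lemma linear_big0 (U V : lmodType R) (f : U -> V) (S : U -> Prop) :
  linear f -> (forall s, S s -> f s = 0) -> forall x, in_span S x -> f x = 0.
Proof.
move=> fL fS x Hx; apply: (Hx (fun x => f x = 0)) => //; first exact: lin0.
by move=> c u w fu fw; rewrite fL fu fw scaler0 addr0.
Qed.

(** Replace the target of p, onto which p need not map, by the quotient of its source by
    its kernel. *)
Lemma projective_lift (M X Y : lmodType R) (p : X -> Y) (f : M -> Y) :
  projective M -> linear p -> linear f -> (forall m, exists x, p x = f m) ->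
  exists g : M -> X, linear g /\ forall m, p (g m) = f m.
Proof.
move=> pM pL fL ex; pose S x := p x = 0.
pose c m := projT1 (cid (ex m)).
have cE m : p (c m) = f m by rewrite /c; case: cid.
have qL : linear (fun m => qclass S (c m)).
  move=> r m m'; rewrite -qclass_linear; apply/qclassP/mem_span.
  by rewrite /S (linB pL) pL !cE fL subrr.
have [g [gL gE]] := pM _ _ _ _ (@qclass_linear _ _ S)
   (fun y => ex_intro _ (qrepr y) (qreprK y)) qL.
exists g; split=> // m; apply/eqP; rewrite -cE -subr_eq0 -linB //; apply/eqP.
have /qclassP/spanP := gE m; exact: linear_big0.
Qed.

Section Resolution.
Variables (X : lmodType R) (P Q : nat -> lmodType R).
Variables (dP : forall n, P n.+1 -> P n) (eP : P 0%N -> X).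
Variables (dQ : forall n, Q n.+1 -> Q n) (eQ : Q 0%N -> X).
Hypotheses (rP : proj_resolution dP eP) (rQ : proj_resolution dQ eQ).

Lemma res_dd n x : dQ (dQ (n := n.+1) x) = 0.
Proof. by have [_ _ H] := res_exact rQ; apply/H; exists x. Qed.
Lemma res_ed x : eQ (dQ x) = 0.
Proof. by have [_ H _] := res_exact rQ; apply/H; exists x. Qed.

(** The cycles of Q, with the augmentation as the boundary map out of degree 0. *)
Definition bd0 n : Q n -> Prop :=
  match n return Q n -> Prop with
  | 0 => fun y => eQ y = 0
  | n'.+1 => fun y => dQ y = 0
  end.

Lemma bd0_im n (y : Q n) : bd0 y -> exists x, dQ x = y.
Proof.
have [_ H0 H1] := res_exact rQ.
by case: n y => [|n] y /= Hy; [apply/H0 | apply/H1].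
Qed.

(** One degree of a chain map, with what is needed to lift the next one. *)
Definition stage n : Type :=
  {f : P n -> Q n | linear f /\ forall x, bd0 (f (dP x))}.

Lemma stage0 : exists f : P 0%N -> Q 0%N, linear f /\ forall x, eQ (f x) = eP x.
Proof.
have [sQ _ _] := res_exact rQ.
by apply: projective_lift => //; [exact: res_proj rP 0%N | exact: res_e rQ | exact: res_e rP].
Qed.

Lemma stageS n (s : stage n) :
  exists f : P n.+1 -> Q n.+1, linear f /\ forall x, dQ (f x) = sval s (dP x).
Proof.
case: s => f /= [fL fd]; apply: projective_lift => [||| x].
- exact: res_proj rP n.+1.
- exact: (res_d rQ (n := n)).
- exact: (linear_comp fL (res_d rP (n := n))).
- exact: bd0_im.
Qed.
End Resolution.

Lemma comparison (X : lmodType R) (P Q : nat -> lmodType R)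
  (dP : forall n, P n.+1 -> P n) (eP : P 0%N -> X)
  (dQ : forall n, Q n.+1 -> Q n) (eQ : Q 0%N -> X) :
  proj_resolution dP eP -> proj_resolution dQ eQ ->
  exists phi : forall n, P n -> Q n, chain_map_over dP eP dQ eQ phi.
Proof.
move=> rP rQ; have [f0 [f0L f0E]] := stage0 rP rQ.
have f0d x : bd0 dQ eQ (f0 (dP 0%N x)) by rewrite /= f0E (res_ed rP).
pose s0 : stage dP dQ eQ 0 := exist _ f0 (conj f0L f0d).
have nextP n (s : stage dP dQ eQ n) :
    {s' : stage dP dQ eQ n.+1 | forall x, dQ n (sval s' x) = sval s (dP n x)}.
  have [f [fL fE]] := cid (stageS rP rQ s).
  have fd x : bd0 dQ eQ (f (dP n.+1 x)).
    by rewrite /= fE (res_dd rP); exact: lin0 (svalP s).1.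
  by exists (exist _ f (conj fL fd)).
pose next n s := sval (nextP n s).
pose s n : stage dP dQ eQ n := nat_rect (stage dP dQ eQ) s0 next n.
exists (fun n => sval (s n)); split=> [n|n m|m]; last exact: f0E.
  exact: (svalP (s n)).1.
exact: esym (svalP (nextP n (s n)) m).
Qed.

Section Homotopy.
Variables (X : lmodType R) (P Q : nat -> lmodType R).
Variables (dP : forall n, P n.+1 -> P n).
Variables (dQ : forall n, Q n.+1 -> Q n) (eQ : Q 0%N -> X).
Hypotheses (dPL : forall n, linear (@dP n)) (dPd : forall n x, dP (dP (n := n.+1) x) = 0).
Hypothesis pP : forall n, projective (P n).
Hypotheses (dQL : forall n, linear (@dQ n)) (eQL : linear eQ) (rQ : resolves dQ eQ).
Variable D : forall n, P n -> Q n.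
Hypotheses (DL : forall n, linear (@D n)) (Dd : forall n x, D (dP x) = dQ (D (n := n.+1) x)).
Variable sg : P 0%N -> Q 0%N.
Hypotheses (sgL : linear sg) (sgd : forall x, sg (dP x) = 0)
  (sgE : forall x, eQ (D x) = eQ (sg x)).

Lemma lin_sub (U V : lmodType R) (f g : U -> V) :
  linear f -> linear g -> linear (fun x => f x - g x).
Proof. by move=> fL gL c x y; rewrite fL gL scalerBr opprD addrACA. Qed.

(** The usual homotopy from D to 0, except that in degree 0 the map D is compared with a
    map sg that has the same augmentation and kills boundaries. *)
Lemma homotopy0 : exists s : P 0%N -> Q 1%N,
  linear s /\ forall x, dQ (s x) = D x - sg x.
Proof.
have [_ H0 _] := rQ; apply: projective_lift => // [|x]; first exact: lin_sub.
by apply/H0; rewrite (linB eQL) sgE subrr.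
Qed.

Lemma homotopyS n (s : P n -> Q n.+1) : linear s ->
  (forall x, dQ (s (dP x)) = D (dP x)) ->
  exists s' : P n.+1 -> Q n.+2,
    linear s' /\ forall x, dQ (s' x) = D x - s (dP x).
Proof.
move=> sL sE; have [_ _ H1] := rQ; apply: projective_lift => // [|x].
  by apply: lin_sub => //; exact: (linear_comp sL).
by apply/H1; rewrite (linB (@dQL _)) sE Dd subrr.
Qed.

(** Carrying only the values of the homotopy relation on boundaries through the
    induction avoids the choice of a whole sequence of maps. *)
Lemma homotopy n : exists s : P n -> Q n.+1,
  linear s /\ forall x, dQ (s (dP x)) = D (dP x).
Proof.
elim: n => [|n [s [sL sE]]].
  have [s [sL sE]] := homotopy0; exists s; split=> // x.
  by rewrite sE sgd subr0.
have [s' [sL' sE']] := homotopyS sL sE; exists s'; split=> // x.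
by rewrite sE' dPd (lin0 sL) subr0.
Qed.

(** A cocycle kills the part d s of a homotopy, so its composite with the chain map D is
    a coboundary in positive degrees and is determined by sg in degree 0. *)
Lemma cocycle_homotopy0 (Y : zmodType) (f : Q 0%N -> Y) :
  (forall x y, f (x + y) = f x + f y) -> (forall x, f (dQ x) = 0) ->
  forall x, f (D x) = f (sg x).
Proof.
move=> fD fd x; have [s [_ sE]] := homotopy0.
by rewrite -[D x](subrK (sg x)) -sE fD fd add0r.
Qed.

Lemma cocycle_homotopyS n (Y : zmodType) (f : Q n.+1 -> Y) :
  (forall x y, f (x + y) = f x + f y) -> (forall x, f (dQ x) = 0) ->
  exists s : P n -> Q n.+1, linear s /\ forall x, f (D x) = f (s (dP x)).
Proof.
move=> fD fd; have [s [sL sE]] := homotopy n.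
exists s; split=> // x; have [s' [_ sE']] := homotopyS sL sE.
by rewrite -[D x](subrK (s (dP x))) -sE' fD fd add0r.
Qed.
End Homotopy.
End Comparison.

(** * Cocycles and their classes *)

Section CohomologyClasses.
Variables (k : fieldType) (A B : algType k) (iota : {lrmorphism A -> B}).
Variables (P : nat -> lmodType (env A)) (d : forall n, P n.+1 -> P n).

Lemma env_map_scale (M : lmodType (env A)) (f : M -> B) : bimod_map iota f ->
  forall z m, f (z *: m) = sandwich (env_map iota z) (f m).
Proof. by move=> fL z m; exact: (linZ fL). Qed.

Lemma bimod_add (M : lmodType (env A)) (f : M -> B) : bimod_map iota f ->
  forall m m', f (m + m') = f m + f m'.
Proof. by move=> fL m m'; exact: (linD fL). Qed.

Lemma bimod_intro (M : lmodType (env A)) (f : M -> B) :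
  (forall m m', f (m + m') = f m + f m') ->
  (forall z m, f (z *: m) = sandwich (env_map iota z) (f m)) -> bimod_map iota f.
Proof. by move=> fD fZ z m m'; rewrite fD fZ. Qed.

Lemma bimod_comb (M : lmodType (env A)) (f g : M -> B) c :
  bimod_map iota f -> bimod_map iota g -> bimod_map iota (fun m => c *: f m + g m).
Proof.
move=> fL gL; apply: bimod_intro => [m m'|z m].
  by rewrite !bimod_add // scalerDr addrACA.
rewrite !(env_map_scale) //.
by rewrite (linD (sandwich_linr _)) (linZ (sandwich_linr _)).
Qed.

Lemma cocycleP n (f : P n -> B) : f \in @is_cocycle k A B iota P d n <->
  bimod_map iota f /\ forall m, f (d m) = 0.
Proof. by split=> [/asboolP|H]; [| apply/asboolP]. Qed.

Lemma cocycle_comb n (f g : P n -> B) c :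
  f \in @is_cocycle k A B iota P d n -> g \in @is_cocycle k A B iota P d n ->
  (fun m => c *: f m + g m) \in @is_cocycle k A B iota P d n.
Proof.
move=> /cocycleP[fL fd] /cocycleP[gL gd]; apply/cocycleP; split.
  exact: bimod_comb.
by move=> m; rewrite fd gd scaler0 addr0.
Qed.

Lemma coboundary_comb n (f g : P n -> B) c : coboundary iota d f -> coboundary iota d g ->
  coboundary iota d (fun m => c *: f m + g m).
Proof.
case: n f g => [|n] f g /=; first by move=> f0 g0 m; rewrite f0 g0 scaler0 addr0.
move=> [u [uL uE]] [v [vL vE]]; exists (fun m => c *: u m + v m).
by split=> [|m]; [exact: bimod_comb | rewrite uE vE].
Qed.

Lemma coboundary0 n : coboundary iota d (fun _ : P n => 0).
Proof.
case: n => [|n] //=; exists (fun=> 0); split=> //.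
by apply: bimod_intro => [m m'|z m]; rewrite ?addr0 // (lin0 (sandwich_linr _)).
Qed.

Lemma cval_comb n (u v : cocycle iota d n) c m : cval (c *: u + v) m = c *: cval u m + cval v m.
Proof. by []. Qed.

Lemma cval_insubd n (f : P n -> B) : f \in @is_cocycle k A B iota P d n ->
  cval (insubd (0 : cocycle iota d n) f) = f.
Proof. by move=> fc; exact: (insubdK (0 : cocycle iota d n) fc). Qed.

Lemma coh_classE n (f g : P n -> B) :
  f \in @is_cocycle k A B iota P d n -> g \in @is_cocycle k A B iota P d n ->
  coh_class iota d f = coh_class iota d g <-> coboundary iota d (fun m => f m - g m).
Proof.
move=> fc gc; rewrite /coh_class.
have E : cval (insubd (0 : cocycle iota d n) f - insubd (0 : cocycle iota d n) g) = (fun m => f m - g m).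
  by apply/funext => m; rewrite -{2}(cval_insubd fc) -{2}(cval_insubd gc).
split=> [/qclassP/spanP H|cb]; last by apply/qclassP/mem_span; rewrite E.
rewrite -E; apply: (H (fun z => coboundary iota d (cval z))) => // [|c u w Hu Hw].
  exact: coboundary0.
exact: (coboundary_comb c Hu Hw).
Qed.

Lemma coh_class_comb n (f g : P n -> B) c :
  f \in @is_cocycle k A B iota P d n -> g \in @is_cocycle k A B iota P d n ->
  coh_class iota d (fun m => c *: f m + g m) =
  c *: coh_class iota d f + coh_class iota d g.
Proof.
move=> fc gc; rewrite /coh_class -qclass_linear; congr (qclass _ _).
apply: val_inj; apply: (etrans (cval_insubd (cocycle_comb c fc gc))).
by apply/funext => m; rewrite [RHS]cval_comb !cval_insubd.
Qed.

Lemma coh_reprP n (x : Coh iota d n) : coh_repr x \in @is_cocycle k A B iota P d n.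
Proof. exact: cvalP. Qed.

Lemma coh_reprK n (x : Coh iota d n) : coh_class iota d (coh_repr x) = x.
Proof. by rewrite /coh_class /coh_repr -[RHS]qreprK; congr (qclass _ _); exact: valKd. Qed.
End CohomologyClasses.

(** * Tensor products of bimodules and the cup product *)

Section BimoduleTensorFacts.
Variables (k : fieldType) (A : algType k).
Implicit Types (M N : lmodType (env A)).

Definition abal M N (U : lmodType k) (phi : M -> N -> U) : Prop :=
  balanced (fun (a : A) (m : kmod M) => epair 1 a *: (m : M) : kmod M)
           (fun (a : A) (n : kmod N) => epair a 1 *: (n : N) : kmod N)
           (phi : kmod M -> kmod N -> U).

Lemma env_const_mulC (z : env A) c : z * env_const A c = env_const A c * z.
Proof.
rewrite /env_const -env_scaleAr -env_scaleAl.
by apply: (congr1 (fun z : env A => c *: z)); exact: etrans (mulr1 z) (esym (mul1r z)).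
Qed.

Lemma env_const_mul (z : env A) c : env_const A c * z = c *: z.
Proof.
rewrite /env_const -env_scaleAl.
by apply: (congr1 (fun z : env A => c *: z)); exact: mul1r.
Qed.

Lemma act_linearl M (m : M) : linear (fun z : env A => (z *: m : kmod M)).
Proof.
move=> c u v; rewrite scalerDl; congr (_ + _).
exact: etrans (congr1 (fun z => z *: m) (esym (env_const_mul u c))) (esym (scalerA _ _ m)).
Qed.

Lemma act_linearr M z : linear (fun m : kmod M => (z *: (m : M) : kmod M)).
Proof.
move=> c u v; rewrite scalerDr; congr (_ + _).
have E := congr1 (fun w => w *: (u : M)) (env_const_mulC z c).
exact: etrans (scalerA z _ _) (etrans E (esym (scalerA _ z _))).
Qed.

Lemma kmod_lin M N (f : M -> N) : linear f -> linear (f : kmod M -> kmod N).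
Proof. by move=> fL c u v; exact: fL. Qed.

Lemma apair_bal M N : abal (fun (m : M) (n : N) => apair m n).
Proof. exact: tpair_balanced. Qed.

Lemma alift_pair M N (U : lmodType k) (phi : M -> N -> U) : abal phi ->
  forall m n, alift phi (apair m n) = phi m n.
Proof. by move=> pb m n; exact: (tlift_pair pb). Qed.

Lemma alift_linear M N (U : lmodType k) (phi : M -> N -> U) : abal phi -> linear (alift phi).
Proof. by move=> pb; exact: (tlift_linear pb). Qed.

Lemma atensE M N (t : atens M N) :
  exists s : seq (M * N), t = \sum_(q <- s) apair q.1 q.2.
Proof.
have [s ->] := tensE t; exists [seq ((q.1 *: q.2.1 : kmod M) : M, q.2.2 : N) | q <- s].
rewrite big_map; apply: eq_bigr => q _ /=.
exact: esym (linZ (bal_linl (apair_bal M N) _) _ _).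
Qed.

Lemma atens_ext M N (X : zmodType) (f g : atens M N -> X) :
  (forall x y, f (x + y) = f x + f y) -> (forall x y, g (x + y) = g x + g y) ->
  (forall m n, f (apair m n) = g (apair m n)) -> f =1 g.
Proof.
move=> fD gD E x; have [s ->] := atensE x.
have z0 (h : atens M N -> X) : (forall x y, h (x + y) = h x + h y) -> h 0 = 0.
  by move=> hD; apply: (addrI (h 0)); rewrite -hD !addr0.
elim: s => [|q s IH]; first by rewrite !big_nil !z0.
by rewrite !big_cons fD gD E IH.
Qed.

Section Map.
Variables (M N M' N' : lmodType (env A)) (f : M -> M') (g : N -> N').
Hypotheses (fL : linear f) (gL : linear g).

Lemma abal_comp (U : lmodType k) (phi : M' -> N' -> U) :
  abal phi -> abal (fun m n => phi (f m) (g n)).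
Proof.
move=> [L R C]; split=> [n|m|a m n].
- exact: (linear_comp (L (g n)) (kmod_lin fL)).
- exact: (linear_comp (R (f m)) (kmod_lin gL)).
- by rewrite (linZ fL) (linZ gL) C.
Qed.

Lemma amap_linear : linear (amap f g).
Proof. exact: alift_linear (abal_comp (apair_bal _ _)). Qed.

Lemma amap_pair m n : amap f g (apair m n) = apair (f m) (g n).
Proof. exact: alift_pair (abal_comp (apair_bal _ _)) _ _. Qed.

Lemma alift_amap (U : lmodType k) (phi : M' -> N' -> U) t : abal phi ->
  alift phi (amap f g t) = alift (fun m n => phi (f m) (g n)) t.
Proof.
move=> pb; have L := alift_linear pb; have L' := alift_linear (abal_comp pb).
move: t; apply: atens_ext => [x y|x y|m n].
- by rewrite (linD amap_linear) (linD L).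
- exact: (linD L').
- by rewrite amap_pair !alift_pair //; exact: abal_comp.
Qed.
End Map.

(** The left action on M and the right action on N are not A^e-linear, but the tensor
    product over A is balanced over the inner actions, which they respect. *)
Section Outer.
Variables (M N : lmodType (env A)) (a a' : A).
Let l (m : M) := epair a 1 *: m.
Let r (n : N) := epair 1 a' *: n.

Lemma abal_outer (U : lmodType k) (phi : M -> N -> U) :
  abal phi -> abal (fun m n => phi (l m) (r n)).
Proof.
move=> [L R C]; split=> [n|m|b m n].
- exact: (linear_comp (L (r n)) (act_linearr _)).
- exact: (linear_comp (R (l m)) (act_linearr _)).
- have El : l (epair 1 b *: m) = epair 1 b *: l m by rewrite /l !scalerA !epairM !(mul1r, mulr1).
  have Er : r (epair b 1 *: n) = epair b 1 *: r n by rewrite /r !scalerA !epairM !(mul1r, mulr1).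
  by rewrite El Er C.
Qed.

Lemma alift_outer (U : lmodType k) (phi : M -> N -> U) t : abal phi ->
  alift phi (amap l r t) = alift (fun m n => phi (l m) (r n)) t.
Proof.
move=> pb; have L := alift_linear pb; have L' := alift_linear (abal_outer pb).
have b0 := abal_outer (apair_bal M N).
have aD x y : amap l r (x + y) = amap l r x + amap l r y by exact: (linD (alift_linear b0)).
have aP m n : amap l r (apair m n) = apair (l m) (r n) by exact: (alift_pair b0).
move: t; apply: atens_ext => [x y|x y|m n].
- by rewrite aD (linD L).
- exact: (linD L').
- by rewrite aP (alift_pair pb) (alift_pair (abal_outer pb)).
Qed.
End Outer.
End BimoduleTensorFacts.

Section Cup.
Variables (k : fieldType) (A B : algType k) (iota : {lrmorphism A -> B}).
Variables (P : nat -> lmodType (env A)) (d : forall n, P n.+1 -> P n).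
Variable T : forall n p q, P n -> atens (P p) (P q).
Hypothesis Tadd : forall p q (m m' : P (p + q)%N),
  @T (p + q)%N p q (m + m') = @T (p + q)%N p q m + @T (p + q)%N p q m'.
Hypothesis Tchain : forall p q (m : P (p + q)%N.+1),
    @T (p + q)%N p q (d m) =
    amap (@d p) id (@T (p + q)%N.+1 p.+1 q m)
    + (-1) ^+ p *: amap id (@d q) (@T (p + q)%N.+1 p q.+1 m).
Hypothesis Tequi : bimod_equivariant T.
Hypothesis dL : forall n, linear (@d n).
Local Notation cocyc n := (@is_cocycle k A B iota P d n).

Lemma env_mapc c : env_map iota (env_const A c) = env_const B c.
Proof. by rewrite /env_const (linZ (env_map_linear iota)) env_map_pair rmorph1. Qed.

Lemma sandwichc c (b : B) : sandwich (env_const B c) b = c *: b.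
Proof. by rewrite /env_const (linZ (sandwich_linl b)) sandwich_pair mul1r mulr1. Qed.

Lemma bimod_klin (M : lmodType (env A)) (f : M -> B) : bimod_map iota f ->
  linear (f : kmod M -> B).
Proof.
move=> fL c u v; rewrite (bimod_add fL); congr (_ + _).
by etransitivity; [exact: (env_map_scale fL) | rewrite env_mapc sandwichc].
Qed.

Lemma cup_bal (M N : lmodType (env A)) (f : M -> B) (g : N -> B) :
  bimod_map iota f -> bimod_map iota g -> abal (fun u v => f u * g v).
Proof.
move=> fL gL; have fk := bimod_klin fL; have gk := bimod_klin gL; split=> [n|m|a m n].
- exact: (linear_comp (mul_linl _) fk).
- exact: (linear_comp (mul_linr _) gk).
- rewrite (env_map_scale fL) (env_map_scale gL) !env_map_pair !sandwich_pair.
  by rewrite rmorph1 mul1r mulr1 mulrA.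
Qed.

Lemma cup_bimod p q (f : P p -> B) (g : P q -> B) :
  bimod_map iota f -> bimod_map iota g -> bimod_map iota (cup_cochain T f g).
Proof.
move=> fL gL; have pb := cup_bal fL gL; have L := alift_linear pb.
have add m m' : cup_cochain T f g (m + m') = cup_cochain T f g m + cup_cochain T f g m'.
  by rewrite /cup_cochain Tadd (linD L).
apply: bimod_intro => // z m; have [s ->] := ktensE z.
elim: s => [|[a a'] s IH].
  rewrite big_nil scale0r.
  rewrite (_ : env_map iota 0 = 0) ?(lin0 (sandwich_linl _)); last exact: (lin0 (env_map_linear iota)).
  by apply: (addrI (cup_cochain T f g 0)); rewrite -add !addr0.
rewrite big_cons scalerDl add IH (linD (env_map_linear iota)) (linD (sandwich_linl _)).
congr (_ + _); rewrite -[kpair _ _]/(epair a a') /cup_cochain Tequi (alift_outer _ _ _ pb).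
rewrite env_map_pair sandwich_pair.
move: (@T _ _ _ m); apply: atens_ext => [x y|x y|u v].
- exact: (linD (alift_linear (abal_outer a a' pb))).
- by rewrite (linD L) mulrDr mulrDl.
rewrite (alift_pair (abal_outer a a' pb)) (alift_pair pb).
rewrite (env_map_scale fL) (env_map_scale gL) !env_map_pair !sandwich_pair.
by rewrite rmorph1 mul1r mulr1 !mulrA.
Qed.

Lemma alift0 (M N : lmodType (env A)) (U : lmodType k) (phi : M -> N -> U) t :
  (forall m n, phi m n = 0) -> alift phi t = 0.
Proof.
move=> p0; have pb : abal phi.
  by split=> [n|m|a m n]; [move=> c u v | move=> c u v | ]; rewrite !p0 ?scaler0 ?addr0.
move: t; apply: atens_ext => [x y|x y|m n]; [exact: (linD (alift_linear pb)) | by rewrite addr0 |].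
by rewrite alift_pair.
Qed.

Lemma alift_d p q (U : lmodType k) (phi : P p -> P q -> U) (m : P (p + q)%N.+1) : abal phi ->
  alift phi (@T (p + q)%N p q (d m)) =
  alift (fun u v => phi (d u) v) (@T (p + q)%N.+1 p.+1 q m)
  + (-1) ^+ p *: alift (fun u v => phi u (d v)) (@T (p + q)%N.+1 p q.+1 m).
Proof.
move=> pb; rewrite Tchain (linD (alift_linear pb)) (linZ (alift_linear pb)).
by rewrite !alift_amap.
Qed.

Lemma cup_cocycle p q (f : P p -> B) (g : P q -> B) :
  f \in cocyc p -> g \in cocyc q -> cup_cochain T f g \in cocyc (p + q)%N.
Proof.
move=> /cocycleP[fL fd] /cocycleP[gL gd]; apply/cocycleP; split; first exact: cup_bimod.
move=> m; rewrite /cup_cochain alift_d; last exact: cup_bal.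
by rewrite !alift0 ?scaler0 ?addr0 // => u v; rewrite ?fd ?gd ?mul0r ?mulr0.
Qed.

Lemma cup_coboundaryl p q (f : P p -> B) (g : P q -> B) :
  bimod_map iota f -> coboundary iota d f -> g \in cocyc q ->
  coboundary iota d (cup_cochain T f g).
Proof.
case: p f => [|p] f fL /= fc /cocycleP[gL gd].
  case: q g gL gd => [|q] g gL gd.
    by move=> m; rewrite /cup_cochain alift0 // => u v; rewrite fc mul0r.
  rewrite (_ : cup_cochain T f g = fun=> 0); first exact: coboundary0.
  by apply/funext => m; rewrite /cup_cochain alift0 // => u v; rewrite fc mul0r.
have [s [sL sE]] := fc; exists (cup_cochain T s g); split; first exact: cup_bimod.
move=> m; rewrite /cup_cochain alift_d; last exact: cup_bal.
rewrite [X in _ + _ *: X]alift0 => [|u v]; last by rewrite gd mulr0.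
by rewrite scaler0 addr0; congr (alift _ _); apply/funext => u; apply/funext => v; rewrite sE.
Qed.

(** The degrees p + q.+1 and (p + q).+1 are equal but not convertible. *)
Lemma coboundary_shift n n' (E : n.+1 = n') (f : P n' -> B) (s : P n -> B) :
  bimod_map iota s -> (forall m : P n.+1, f (ecast i (P i) E m) = s (d m)) ->
  coboundary iota d f.
Proof. by case: n' / E f => f sL fE; exists s. Qed.

(** For a cocycle f, the cup product f (s d) is (-1)^p times the coboundary of f s. *)
Lemma cup_coboundaryr p q (f : P p -> B) (g : P q -> B) :
  f \in cocyc p -> bimod_map iota g -> coboundary iota d g ->
  coboundary iota d (cup_cochain T f g).
Proof.
move=> /cocycleP[fL fd]; case: q g => [|q] g gL /= gc.
  rewrite (_ : cup_cochain T f g = fun=> 0); first exact: coboundary0.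
  by apply/funext => m; rewrite /cup_cochain alift0 // => u v; rewrite gc mulr0.
have [s [sL sE]] := gc.
apply: (@coboundary_shift (p + q)%N _ (esym (addnS p q)) _ (fun m => (-1) ^+ p *: cup_cochain T f s m)).
  have sc := cup_bimod fL sL.
  rewrite (_ : (fun m => _) = (fun m => (-1) ^+ p *: cup_cochain T f s m + 0)); last by apply/funext => m; rewrite addr0.
  apply: bimod_comb => //; apply: bimod_intro => [m m'|z m]; rewrite ?addr0 // (lin0 (sandwich_linr _)) //.
move=> m; have -> : cup_cochain T f g (ecast i (P i) (esym (addnS p q)) m) =
    alift (fun u v => f u * g v) (@T (p + q)%N.+1 p q.+1 m).
  by rewrite /cup_cochain; case: _ / (esym (addnS p q)).
rewrite /cup_cochain alift_d; last exact: cup_bal.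
rewrite [X in X + _]alift0 => [|u v]; last by rewrite fd mul0r.
rewrite add0r scalerA -expr2 sqrr_sign scale1r.
by congr (alift _ _); apply/funext => u; apply/funext => v; rewrite sE.
Qed.

(** f' g' - f g = (f' - f) g' + f (g' - g), and both terms are coboundaries. *)
Lemma cup_class p q (f : P p -> B) (g : P q -> B) : f \in cocyc p -> g \in cocyc q ->
  cup T (coh_class iota d f) (coh_class iota d g) = coh_class iota d (cup_cochain T f g).
Proof.
move=> fc gc; rewrite /cup.
set f' := coh_repr _; set g' := coh_repr _.
have f'c : f' \in cocyc p by exact: coh_reprP.
have g'c : g' \in cocyc q by exact: coh_reprP.
have [fL _] := (cocycleP _ _ _).1 fc; have [gL _] := (cocycleP _ _ _).1 gc.
have [f'L _] := (cocycleP _ _ _).1 f'c; have [g'L _] := (cocycleP _ _ _).1 g'c.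
have subL (M : lmodType (env A)) (u v : M -> B) : bimod_map iota u -> bimod_map iota v ->
    bimod_map iota (fun m => u m - v m).
  move=> uL vL; rewrite (_ : (fun m => u m - v m) = (fun m => (-1) *: v m + u m)); first exact: bimod_comb.
  by apply/funext => m; rewrite scaleN1r addrC.
have df : coboundary iota d (fun m => f' m - f m) by apply/coh_classE => //; exact: coh_reprK.
have dg : coboundary iota d (fun m => g' m - g m) by apply/coh_classE => //; exact: coh_reprK.
apply/coh_classE; [exact: cup_cocycle | exact: cup_cocycle | ].
have E : (fun m => cup_cochain T f' g' m - cup_cochain T f g m) =
    (fun m => 1 *: cup_cochain T (fun m => f' m - f m) g' m + cup_cochain T f (fun m => g' m - g m) m).
  apply/funext => m; rewrite scale1r /cup_cochain.
  have b1 := cup_bal f'L g'L; have b2 := cup_bal fL gL.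
  have b3 := cup_bal (subL _ _ _ f'L fL) g'L; have b4 := cup_bal fL (subL _ _ _ g'L gL).
  move: (@T _ _ _ m); apply: atens_ext => [x y|x y|u v].
  - by rewrite (linD (alift_linear b1)) (linD (alift_linear b2)) opprD addrACA.
  - by rewrite (linD (alift_linear b3)) (linD (alift_linear b4)) addrACA.
  by rewrite !alift_pair // mulrBl mulrBr addrA subrK.
rewrite E; apply: coboundary_comb.
  by apply: cup_coboundaryl => //; exact: subL.
by apply: cup_coboundaryr => //; exact: subL.
Qed.
End Cup.

(** * Maps between resolutions of an algebra *)

Section BimoduleMaps.
Variables (k : fieldType) (B : algType k).

Lemma env_map_id (z : env B) : env_map idfun z = z.
Proof. exact: klift_kpair. Qed.

Lemma bimod_linear (M : lmodType (env B)) (f : M -> B) :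
  bimod_map idfun f <-> linear (f : M -> bireg B).
Proof.
split=> [fL c u v|fL].
  rewrite (bimod_add fL) (env_map_scale fL).
  by rewrite env_map_id.
apply: bimod_intro => [m m'|z m]; first exact: (linD fL).
by rewrite env_map_id; exact: (linZ fL).
Qed.
End BimoduleMaps.

Section ProjectiveResolutions.
Variables (k : fieldType) (B : algType k).

Lemma coboundary_eq (A : algType k) (iota : {lrmorphism A -> B}) (P : nat -> lmodType (env A))
    (d : forall n, P n.+1 -> P n) n (f g : P n -> B) :
  f =1 g -> coboundary iota d f -> coboundary iota d g.
Proof. by move=> /funext ->. Qed.

Section Endo.
Variables (P : nat -> lmodType (env B)) (d : forall n, P n.+1 -> P n) (e : P 0%N -> bireg B).
Hypothesis rP : proj_resolution d e.
Variable U : forall n, P n -> P n.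
Hypotheses (UL : forall n, linear (@U n)) (Ud : forall n (m : P n.+1), U (d m) = d (U m)).
Hypothesis Ue : forall m, e (U m) = e m.

(** A chain endomorphism over the identity is homotopic to the identity. *)
Lemma endomorphism_cohomologous q (g : P q -> B) :
  bimod_map idfun g -> (forall m, g (d m) = 0) ->
  coboundary idfun d (fun m => g (U m) - g m).
Proof.
move=> gL gd; pose D n (m : P n) := U m - m.
have dL n := res_d rP (n := n).
have DL n : linear (@D n) by apply: lin_sub => //; exact: UL.
have Dd n x : D n (d x) = d (D n.+1 x) by rewrite /D Ud (linB (@dL n)).
have H := cocycle_homotopyS dL (res_dd rP) (res_proj rP) dL (res_e rP) (res_exact rP) DL Dd
  (sg := fun=> 0).
have H0 := cocycle_homotopy0 (res_proj rP) dL (res_e rP) (res_exact rP) DL (sg := fun=> 0).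
have s0 (x : P 0%N) : e (D 0%N x) = e 0.
  by rewrite /D (linB (res_e rP)) Ue subrr (lin0 (res_e rP)).
have zL : linear (fun _ : P 0%N => 0 : P 0%N) by move=> c x y; rewrite scaler0 addr0.
have gD x y : g (x + y) = g x + g y := bimod_add gL x y.
have E m : g (U m) - g m = g (D q m) by apply: esym (linB ((bimod_linear g).1 gL) _ _).
case: q g gL gd gD E => [|n] g gL gd gD E.
  move=> m; rewrite E (H0 zL s0 _ _ gD gd).
  by apply: (addrI (g 0)); rewrite -gD !addr0.
have [s [sL sE]] := H zL (fun x => erefl) s0 _ _ _ gD gd.
exists (fun x => g (s x)); split=> [|m]; last by rewrite E sE.
by apply/bimod_linear; exact: (linear_comp ((bimod_linear g).1 gL) sL).
Qed.
End Endo.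

Section TwoResolutions.
Variables (P : nat -> lmodType (env B)) (dP : forall n, P n.+1 -> P n) (eP : P 0%N -> bireg B).
Variables (Q : nat -> lmodType (env B)) (dQ : forall n, Q n.+1 -> Q n) (eQ : Q 0%N -> bireg B).
Hypotheses (rP : proj_resolution dP eP) (rQ : proj_resolution dQ eQ).

(** A coboundary w = s d lifts through the augmentation of Q to a map that factors
    through d: lift s. Hence its composites with cochains are coboundaries too. *)
Lemma augmentation_lift q (w : P q -> B) : coboundary idfun dP w ->
  exists sg : P q -> Q 0%N, [/\ linear sg, forall x, sg (dP x) = 0,
    forall x, w x = (eQ (sg x) : B)
    & forall h : Q 0%N -> B, bimod_map idfun h -> coboundary idfun dP (fun m => h (sg m))].
Proof.
case: q w => [|q] w /= cb.
  exists (fun=> 0); split=> [c x y|//|x|h hL m]; first by rewrite scaler0 addr0.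
    by rewrite cb (lin0 (res_e rQ)).
  exact: lin0 ((bimod_linear h).1 hL).
have [s [sL sE]] := cb; have [sQ _ _] := res_exact rQ.
have [s0 [s0L s0E]] := projective_lift (res_proj rP (n := q)) (res_e rQ) ((bimod_linear s).1 sL)
  (fun m => sQ (s m)).
exists (fun x => s0 (dP x)); split=> [|x|x|h hL].
- exact: (linear_comp s0L (res_d rP (n := q))).
- by rewrite (res_dd rP) (lin0 s0L).
- by rewrite sE s0E.
exists (fun x => h (s0 x)); split=> //; apply/bimod_linear.
exact: (linear_comp ((bimod_linear h).1 hL) s0L).
Qed.

Section Shifted.
Variable q : nat.
Variables Y Y' : forall p, P (p + q)%N -> Q p.
Hypotheses (YL : forall p, linear (@Y p)) (YL' : forall p, linear (@Y' p)).
Hypotheses (Yd : forall p (m : P (p + q)%N.+1), @Y p (dP m) = dQ (@Y p.+1 m)).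
Hypotheses (Yd' : forall p (m : P (p + q)%N.+1), @Y' p (dP m) = dQ (@Y' p.+1 m)).

(** The difference of the two maps is a chain map whose augmentation is a coboundary, so
    augmentation_lift provides the map sg of the homotopy in degree 0, and cocycles turn
    it into a coboundary. *)
Lemma shifted_chain_map_unique p (f : Q p -> B) :
  coboundary idfun dP (fun m : P q => (eQ (@Y 0%N m) : B) - eQ (@Y' 0%N m)) ->
  bimod_map idfun f -> (forall m, f (dQ m) = 0) ->
  coboundary idfun dP (fun m : P (p + q)%N => f (@Y p m) - f (@Y' p m)).
Proof.
move=> cb fL fd; pose X n := P (n + q)%N; pose dX n : X n.+1 -> X n := @dP (n + q)%N.
pose D n (m : X n) : Q n := Y m - Y' m.
have dXL n : linear (@dX n) := res_d rP (n := (n + q)%N).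
have dQL n := res_d rQ (n := n).
have DL n : linear (@D n) by apply: lin_sub; [exact: YL | exact: YL'].
have Dd n x : D n (dX n x) = dQ (D n.+1 x) by rewrite /D /dX Yd Yd' (linB (@dQL n)).
have pX n : projective (X n) := res_proj rP (n := (n + q)%N).
have ddX n x : dX n (dX n.+1 x) = 0 := res_dd rP x.
have H := cocycle_homotopyS dXL ddX pX dQL (res_e rQ) (res_exact rQ) DL Dd.
have H0 := cocycle_homotopy0 pX dQL (res_e rQ) (res_exact rQ) DL.
have fD x y : f (x + y) = f x + f y := bimod_add fL x y.
have fL' := (bimod_linear f).1 fL.
have E m : f (@Y p m) - f (@Y' p m) = f (D p m) by apply: esym (linB fL' _ _).
suff c0 : coboundary idfun dP (fun m : P (p + q)%N => f (D p m)).
  by apply: coboundary_eq c0 => m; rewrite -E.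
have eD m : (eQ (@Y 0%N m) : B) - eQ (@Y' 0%N m) = eQ (D 0%N m).
  exact: esym (linB (res_e rQ) _ _).
have [sg [sgL sgd sgE sgc]] := augmentation_lift cb.
have sgE' x : eQ (D 0%N x) = eQ (sg x) by rewrite -eD sgE.
case: p f fL fd fD fL' {E} => [|n] f fL fd fD fL'.
  by apply: coboundary_eq (sgc f fL) => m; rewrite (H0 sg sgL sgE' _ _ fD fd).
have [s [sL sE]] := H sg sgL sgd sgE' _ _ _ fD fd.
exists (fun x => f (s x)); split; last exact: sE.
by apply/bimod_linear; exact: (linear_comp fL' sL).
Qed.
End Shifted.
Section Comparison.
Variable phi : forall n, P n -> Q n.
Hypothesis cphi : chain_map_over dP eP dQ eQ phi.

(** Any comparison map in the opposite direction is inverse to phi up to homotopy. *)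
Lemma comparison_surjective n (g : P n -> B) : bimod_map idfun g -> (forall m, g (dP m) = 0) ->
  exists f : Q n -> B, [/\ bimod_map idfun f, forall m, f (dQ m) = 0
    & coboundary idfun dP (fun m => f (phi m) - g m)].
Proof.
move=> gL gd; have [psi cpsi] := comparison rQ rP.
exists (fun x => g (psi n x)); split=> [|m|].
- apply/bimod_linear.
  exact: (linear_comp ((bimod_linear g).1 gL) (cmap_linear cpsi (n := n))).
- by rewrite (cmap_d cpsi) gd.
apply: (endomorphism_cohomologous rP (U := fun n m => psi n (phi m))) => //.
- move=> i; exact: (linear_comp (cmap_linear cpsi (n := i)) (cmap_linear cphi (n := i))).
- by move=> i m; rewrite (cmap_d cphi) (cmap_d cpsi).
- by move=> m; rewrite (cmap_aug cpsi) (cmap_aug cphi).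
Qed.

Lemma comparison_injective n (f : Q n -> B) : bimod_map idfun f -> (forall m, f (dQ m) = 0) ->
  coboundary idfun dP (fun m => f (phi m)) -> coboundary idfun dQ f.
Proof.
move=> fL fd cb; have [psi cpsi] := comparison rQ rP.
have UL i : linear (fun m : Q i => phi (psi i m)).
  exact: (linear_comp (cmap_linear cphi (n := i)) (cmap_linear cpsi (n := i))).
have c1 : coboundary idfun dQ (fun m => f (phi (psi n m)) - f m).
  apply: (endomorphism_cohomologous rQ (U := fun n m => phi (psi n m)) UL) => //.
  - by move=> i m; rewrite (cmap_d cpsi) (cmap_d cphi).
  - by move=> m; rewrite (cmap_aug cphi) (cmap_aug cpsi).
have c2 : coboundary idfun dQ (fun m => f (phi (psi n m))).
  clear c1; case: n f fL fd cb => [|n] f fL fd /= cb; first by move=> m; rewrite cb.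
  have [s [sL sE]] := cb; exists (fun x => s (psi n x)); split=> [|m].
    apply/bimod_linear; exact: (linear_comp ((bimod_linear s).1 sL) (cmap_linear cpsi (n := n))).
  by rewrite sE (cmap_d cpsi).
apply: coboundary_eq (coboundary_comb (-1) c1 c2) => m.
by rewrite scaleN1r opprB subrK.
Qed.
End Comparison.
End TwoResolutions.
End ProjectiveResolutions.

(** * The cup product as composition with a chain map *)

Section Yoneda.
Variables (k : fieldType) (B : algType k).
Variables (P : nat -> lmodType (env B)) (d : forall n, P n.+1 -> P n) (e : P 0%N -> bireg B).
Variable T : forall n p q, P n -> atens (P p) (P q).
Hypothesis rP : proj_resolution d e.
Hypothesis TL : lifting d e T.
Hypothesis Tequi : bimod_equivariant T.
Let Tadd := lift_add TL.
Let dL n : linear (@d n) := res_d rP (n := n).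
Let eL : linear e := res_e rP.

(** The diagonal is equivariant for the outer actions, which generate that of B^e. *)
Lemma alift_equivariant_linear p q (N : lmodType (env B)) (phi : P p -> P q -> N) :
  abal (phi : P p -> P q -> kmod N) ->
  (forall a a' u v, phi (epair a 1 *: u) (epair 1 a' *: v) = epair a a' *: phi u v) ->
  linear (fun m : P (p + q)%N => alift (phi : P p -> P q -> kmod N) (@T (p + q)%N p q m) : N).
Proof.
move=> pb pE; have L := alift_linear pb.
pose F m : N := alift (phi : P p -> P q -> kmod N) (@T (p + q)%N p q m).
have add m m' : F (m + m') = F m + F m' by rewrite /F Tadd (linD L).
suff scal z m : F (z *: m) = z *: F m by move=> z m m'; rewrite -/(F _) add scal.
have [s ->] := ktensE z; elim: s => [|[a a'] s IH].
  by rewrite big_nil !scale0r; apply: (addrI (F 0)); rewrite -add !addr0.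
rewrite big_cons !scalerDl add IH; congr (_ + _).
rewrite -[kpair _ _]/(epair a a') /F Tequi.
etransitivity; first exact: (alift_outer a a' _ pb).
move: (@T _ _ _ m); apply: atens_ext => [x y|x y|u v].
- exact: (linD (alift_linear (abal_outer a a' pb))).
- by rewrite (linD L) scalerDr.
etransitivity; first exact: (alift_pair (abal_outer a a' pb)).
rewrite pE; apply: (congr1 (fun n : N => epair a a' *: n)).
exact: esym (alift_pair pb u v).
Qed.

Section Left.
Variables (q : nat) (g : P q -> B).
Hypothesis (gL : bimod_map idfun g) (gd : forall m, g (d m) = 0).

(** The contraction u (x) v |-> u g(v) of the diagonal. *)
Definition yoneda p (m : P (p + q)%N) : P p :=
  alift (fun u v => (epair 1 (g v) *: u : kmod (P p))) (@T (p + q)%N p q m).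

Lemma gE a a' v : g (epair a a' *: v) = a * g v * a'.
Proof. by rewrite (env_map_scale gL) env_map_id sandwich_pair. Qed.

Lemma yoneda_bal p : abal (fun (u : P p) (v : P q) => (epair 1 (g v) *: u : kmod (P p))).
Proof.
split=> [v|u|a u v].
- exact: act_linearr.
- exact: (linear_comp (linear_comp (act_linearl u) (kpair_linr 1)) (bimod_klin gL)).
- rewrite gE mulr1; etransitivity; first exact: (scalerA _ _ (u : P p)).
  by rewrite epairM mul1r.
Qed.

Lemma yoneda_linear p : linear (@yoneda p).
Proof.
apply: alift_equivariant_linear; first exact: yoneda_bal.
move=> a a' u v.
have E : epair 1 (g (epair 1 a' *: v)) * epair a 1 = epair a a' * epair 1 (g v).
  by rewrite gE !epairM (mul1r a) (mulr1 a) !mul1r.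
exact: etrans (scalerA _ _ u) (etrans (congr1 (fun z => z *: u) E) (esym (scalerA _ _ u))).
Qed.

Lemma yoneda_d p (m : P (p + q)%N.+1) : @yoneda p (d m) = d (@yoneda p.+1 m).
Proof.
have b1 := yoneda_bal p; have b2 := yoneda_bal p.+1.
have b3 : abal (fun (u : P p.+1) (v : P q) => (epair 1 (g v) *: d u : kmod (P p))).
  exact: (@abal_comp _ _ _ _ _ _ (@d p) id (dL (n := p)) (fun c x y => erefl) _ _ b1).
rewrite /yoneda (alift_d (lift_chain TL) dL _ b1).
rewrite [X in _ + _ *: X]alift0 => [|u v]; last first.
  by rewrite gd (lin0 (kpair_linr 1 : linear (epair 1))) scale0r.
rewrite scaler0 addr0; move: (@T _ _ _ m); apply: atens_ext => [x y|x y|u v].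
- exact: (linD (alift_linear b3)).
- by rewrite (linD (alift_linear b2)) (linD (@dL p)).
rewrite (alift_pair b3) (alift_pair b2).
exact: esym (linZ (@dL p) _ _).
Qed.

(** Right multiplication by the class of g is induced by a chain map of degree -q. *)
Lemma yoneda_cup p (f : P p -> B) (m : P (p + q)%N) : bimod_map idfun f ->
  f (yoneda m) = cup_cochain T f g m.
Proof.
move=> fL; have b1 := yoneda_bal p; have b2 := cup_bal fL gL.
rewrite /yoneda /cup_cochain; move: (@T _ _ _ m); apply: atens_ext => [x y|x y|u v].
- by rewrite (linD (alift_linear b1)) (bimod_add fL).
- exact: (linD (alift_linear b2)).
rewrite (alift_pair b1) (alift_pair b2).
by etransitivity; [exact: (env_map_scale fL) | rewrite env_map_id sandwich_pair mul1r].
Qed.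
End Left.

Lemma e_bimod : bimod_map idfun e.
Proof. exact/bimod_linear. Qed.

Lemma eE a a' u : (e (epair a a' *: u) : B) = a * e u * a'.
Proof. by rewrite (linZ eL) [_ *: _]sandwich_pair. Qed.

(** The contraction u (x) v |-> e(u) v of the diagonal. *)
Definition unitor n (m : P n) : P n :=
  alift (fun u v => (epair (e u) 1 *: v : kmod (P n))) (@T n 0%N n m).

Lemma unitor_bal n : abal (fun (u : P 0%N) (v : P n) => (epair (e u : B) 1 *: v : kmod (P n))).
Proof.
split=> [v|u|a u v].
- exact: (linear_comp (linear_comp (act_linearl v) (kpair_linl 1)) (bimod_klin e_bimod)).
- exact: act_linearr.
- rewrite eE mul1r; apply: esym; etransitivity; first exact: (scalerA _ _ (v : P n)).
  by rewrite epairM mulr1.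
Qed.

Lemma unitor_linear n : linear (@unitor n).
Proof.
apply: (@alift_equivariant_linear 0 n); first exact: unitor_bal.
move=> a a' u v.
have E : epair (e (epair a 1 *: u) : B) 1 * epair 1 a' = epair a a' * epair (e u : B) 1.
  by rewrite eE !epairM !mulr1 (mul1r a').
exact: etrans (scalerA _ _ v) (etrans (congr1 (fun z => z *: v) E) (esym (scalerA _ _ v))).
Qed.

Lemma unitor_d n (m : P n.+1) : unitor (d m) = d (unitor m).
Proof.
have b1 := unitor_bal n; have b2 := unitor_bal n.+1.
have b3 : abal (fun (u : P 0%N) (v : P n.+1) => (epair (e u : B) 1 *: d v : kmod (P n))).
  exact: (@abal_comp _ _ _ _ _ _ id (@d n) (fun c x y => erefl) (dL (n := n)) _ _ b1).
rewrite /unitor (@alift_d _ _ _ _ _ (lift_chain TL) dL 0%N n _ _ m b1).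
rewrite [X in X + _]alift0 => [|u v]; last first.
  by rewrite (res_ed rP) (lin0 (kpair_linl 1 : linear (fun x => epair x 1))) scale0r.
rewrite add0r scale1r; move: (@T _ _ _ m); apply: atens_ext => [x y|x y|u v].
- exact: (linD (alift_linear b3)).
- by rewrite (linD (alift_linear b2)) (linD (@dL n)).
rewrite (alift_pair b3) (alift_pair b2).
exact: esym (linZ (@dL n) _ _).
Qed.

Lemma unitor_e m : e (unitor m) = e m.
Proof.
have b1 := unitor_bal 0; rewrite -[RHS](lift_aug TL) /unitor.
have b2 := cup_bal e_bimod e_bimod.
move: (@T _ _ _ m); apply: atens_ext => [x y|x y|u v].
- by rewrite (linD (alift_linear b1)) (linD eL).
- exact: (linD (alift_linear b2)).
etransitivity; first exact: (congr1 e (alift_pair b1 u v)).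
etransitivity; first exact: eE.
by rewrite mulr1; exact: esym (alift_pair b2 u v).
Qed.

Section Unit.
Variables (q : nat) (g : P q -> B).
Hypothesis (gL : bimod_map idfun g) (gd : forall m, g (d m) = 0).

Lemma unitor_cup m : g (unitor m) = (e (yoneda g (m : P (0 + q)%N)) : B).
Proof.
have b1 := unitor_bal q; have b2 := yoneda_bal gL 0.
rewrite /unitor /yoneda; move: (@T _ _ _ m); apply: atens_ext => [x y|x y|u v].
- by rewrite (linD (alift_linear b1)) (bimod_add gL).
- by rewrite (linD (alift_linear b2)) (linD eL).
etransitivity; first exact: (congr1 g (alift_pair b1 u v)).
etransitivity; first exact: (gE gL).
apply: esym; etransitivity; first exact: (congr1 e (alift_pair b2 u v)).
by etransitivity; [exact: eE | rewrite mulr1 mul1r].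
Qed.

(** The contraction unitor of the diagonal is a chain map over the identity, hence
    homotopic to it, and g o unitor is the augmentation of yoneda g. *)
Lemma yoneda_augmentation :
  coboundary idfun d (fun m : P q => (e (yoneda g (m : P (0 + q)%N)) : B) - g m).
Proof.
apply: coboundary_eq (endomorphism_cohomologous rP unitor_linear unitor_d unitor_e gL gd).
by move=> m; rewrite unitor_cup.
Qed.
End Unit.
End Yoneda.

(** * The translation map of a Galois extension *)

Section BalancedSquareFacts.
Variables (k : fieldType) (H : algType k) (hH : hopf H) (A B : algType k).
Variables (cB : comod_alg hH B) (gB : galois_ext A cB).
Local Notation D := (comul hH).
Local Notation rho := (coact cB).
Local Notation iota := (incl gB).
Local Notation BAB := (btens iota).
Local Notation ra := (fun (a : A) (b : B) => b * iota a).
Local Notation la := (fun (a : A) (b : B) => iota a * b).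
Local Notation bal := (balanced ra la).
Local Notation blift phi := (tlift phi : BAB -> _).

Lemma coact_coassoc (U : lmodType k) (phi : B -> H -> H -> U) b :
  (forall w x, linear (fun v => phi v w x)) ->
  (forall v x, linear (fun w => phi v w x)) ->
  (forall v w, linear (phi v w)) ->
  klift (fun x y => klift (phi x) (D y)) (rho b) =
  klift (fun x y => klift (fun x0 x1 => phi x0 x1 y) (rho x)) (rho b).
Proof.
move=> L1 L2 L3.
have B1 : bilin (fun v (u : ktens H H) => klift (phi v) u).
  by split=> [u|v]; [apply: klift_linear_arg | apply: klift_linear].
have B2 : bilin (fun (s : ktens B H) x => klift (fun v w => phi v w x) s).
  by split=> [u|v]; [apply: klift_linear | apply: klift_linear_arg].
transitivity (klift (fun v u => klift (phi v) u) (tmap id D (rho b))).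
  by rewrite (klift_tmap id D (rho b) B1).
by rewrite -coactA klift_lift3 // (klift_tmap rho id (rho b) B2).
Qed.

Lemma coact_mul (U : lmodType k) (phi : B -> H -> U) b b' : bilin phi ->
  klift phi (rho (b * b')) =
  klift (fun x y => klift (fun x' y' => phi (x * x') (y * y')) (rho b')) (rho b).
Proof. by move=> pB; rewrite coactM klift_tmul. Qed.

Lemma coact_iota a : rho (iota a) = iota a \ot 1.
Proof. by apply/(coinvP gB); exists a. Qed.

Lemma coact_iotal (U : lmodType k) (phi : B -> H -> U) a b : bilin phi ->
  klift phi (rho (iota a * b)) = klift (fun x y => phi (iota a * x) y) (rho b).
Proof.
move=> pB; have [pl pr] := pB; rewrite coact_mul // coact_iota klift_pair; last by lin.
by apply: eq_klift => x y; rewrite mul1r.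
Qed.

Lemma coact_iotar (U : lmodType k) (phi : B -> H -> U) a b : bilin phi ->
  klift phi (rho (b * iota a)) = klift (fun x y => phi (x * iota a) y) (rho b).
Proof.
move=> pB; have [pl pr] := pB; rewrite coact_mul //; apply: eq_klift => x y.
by rewrite coact_iota klift_pair ?mulr1 //; lin.
Qed.

Lemma bpair_bal : bal (@bpair k A B iota).
Proof. exact: tpair_balanced. Qed.
Lemma bpair_linl v : linear (fun u => bpair iota u v).
Proof. exact: (bal_linl bpair_bal v). Qed.
Lemma bpair_linr u : linear (bpair iota u).
Proof. exact: (bal_linr bpair_bal u). Qed.
Lemma bpair_mid u a v : bpair iota (u * iota a) v = bpair iota u (iota a * v).
Proof. exact: (bal_mid bpair_bal). Qed.

Lemma blift_pair (U : lmodType k) (phi : B -> B -> U) : bal phi ->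
  forall u v, blift phi (bpair iota u v) = phi u v.
Proof. exact: tlift_pair. Qed.
Lemma blift_linear (U : lmodType k) (phi : B -> B -> U) : bal phi -> linear (blift phi).
Proof. exact: tlift_linear. Qed.
Lemma btens_ext (U : lmodType k) (f g : BAB -> U) : linear f -> linear g ->
  (forall u v, f (bpair iota u v) = g (bpair iota u v)) -> f =1 g.
Proof. exact: tens_ext. Qed.

Lemma btensE (s : BAB) : exists r : seq (B * B), s = \sum_(q <- r) bpair iota q.1 q.2.
Proof.
have [r ->] := tensE s; exists [seq (q.1 *: q.2.1, q.2.2) | q <- r].
rewrite big_map; apply: eq_bigr => q _ /=.
by rewrite (linZ (bpair_linl _)).
Qed.
End BalancedSquareFacts.

Opaque bpair tpair kpair qclass.
Ltac lin_bpair :=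
  lazymatch goal with
  | |- GRing.linear_for _ (bpair _ _) => exact: bpair_linr
  | |- GRing.linear_for _ (fun x => bpair _ x _) => exact: bpair_linl
  end.
Ltac lin_known ::= first [lin_antip | lin_bpair].

Section TranslationMap.
Variables (k : fieldType) (H : algType k) (hH : hopf H) (A B : algType k).
Variables (cB : comod_alg hH B) (gB : galois_ext A cB).
Local Notation rho := (coact cB).
Local Notation iota := (incl gB).
Local Notation BAB := (btens iota).
Local Notation tau := (transl gB).
Local Notation ra := (fun (a : A) (b : B) => b * iota a).
Local Notation la := (fun (a : A) (b : B) => iota a * b).
Local Notation bal := (balanced ra la).
Local Notation blift phi := (tlift phi : BAB -> _).

Lemma can_bal : bal (fun b b' => klift (fun x h => (b * x) \ot h) (rho b')).
Proof.
split; [lin | lin | move=> a u v /=].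
by rewrite [RHS]coact_iotal; [apply: eq_klift => x h; rewrite mulrA | lin].
Qed.
Lemma can_linear : linear (can (g := gB)).
Proof. exact: blift_linear can_bal. Qed.
Lemma can_pair u v : can (bpair iota u v) = klift (fun x h => (u * x) \ot h) (rho v).
Proof. exact: blift_pair can_bal _ _. Qed.
Lemma canV_linear : linear (canV gB).
Proof.
by move=> c x y; apply: (can_inj (canK (g := gB))); rewrite can_linear !(canVK gB).
Qed.
Lemma transl_linear : linear tau.
Proof. exact: (linear_comp canV_linear (kpair_linr _)). Qed.
Lemma can_transl h : can (tau h) = 1 \ot h.
Proof. exact: (canVK gB). Qed.
Lemma can_injective : injective (can (g := gB)).
Proof. exact: can_inj (canK (g := gB)). Qed.

(** Maps out of B (x)_A B that factor through beta are evaluated on the elements tau h =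
    beta^-1 (1 (x) h), which determine them. *)
Lemma blift_can (U : lmodType k) (G : B -> H -> U) (F : B -> B -> U) (s : BAB) :
  bilin G -> bal F ->
  (forall u v, F u v = klift (fun x h => G (u * x) h) (rho v)) ->
  blift F s = klift G (can s).
Proof.
move=> [G1 G2] Fb E; move: s; apply: btens_ext.
- exact: blift_linear.
- by apply: (linear_comp (klift_linear _) can_linear); split.
move=> u v; rewrite blift_pair // E can_pair.
rewrite (klift_out (f := klift G)); last by lin.
by apply: eq_klift => x h; rewrite klift_pair //; split.
Qed.

Lemma blift_transl (U : lmodType k) (G : B -> H -> U) (F : B -> B -> U) h :
  bilin G -> bal F ->
  (forall u v, F u v = klift (fun x h => G (u * x) h) (rho v)) ->
  blift F (tau h) = G 1 h.
Proof. by move=> GB Fb E; rewrite (blift_can _ GB Fb E) can_transl klift_pair. Qed.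

Definition lact x (s : BAB) : BAB := blift (fun u v => bpair iota (x * u) v) s.
Definition ract (s : BAB) x : BAB := blift (fun u v => bpair iota u (v * x)) s.
Definition bmul (s : BAB) : B := blift (fun u v => u * v) s.
Definition coactl (s : BAB) : BAB \ox H :=
  blift (fun u v => klift (fun u0 u1 => bpair iota u0 v \ot u1) (rho u)) s.
Definition coactr (s : BAB) : BAB \ox H :=
  blift (fun u v => klift (fun v0 v1 => bpair iota u v0 \ot v1) (rho v)) s.

Lemma lact_bal x : bal (fun u v => bpair iota (x * u) v).
Proof. by split; [lin | lin | move=> a u v /=; rewrite mulrA bpair_mid]. Qed.
Lemma ract_bal x : bal (fun u v => bpair iota u (v * x)).
Proof. by split; [lin | lin | move=> a u v /=; rewrite bpair_mid mulrA]. Qed.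
Lemma bmul_bal : bal (fun u v => u * v).
Proof. by split; [lin | lin | move=> a u v /=; rewrite mulrA]. Qed.
Lemma coactl_bal : bal (fun u v => klift (fun u0 u1 => bpair iota u0 v \ot u1) (rho u)).
Proof.
split; [lin | lin | move=> a u v /=].
by rewrite [LHS]coact_iotar; [apply: eq_klift => x y; rewrite bpair_mid | lin].
Qed.
Lemma coactr_bal : bal (fun u v => klift (fun v0 v1 => bpair iota u v0 \ot v1) (rho v)).
Proof.
split; [lin | lin | move=> a u v /=].
by rewrite [RHS]coact_iotal; [apply: eq_klift => x y; rewrite bpair_mid | lin].
Qed.

Lemma lact_pair x u v : lact x (bpair iota u v) = bpair iota (x * u) v.
Proof. exact: blift_pair (lact_bal x) _ _. Qed.
Lemma ract_pair x u v : ract (bpair iota u v) x = bpair iota u (v * x).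
Proof. exact: blift_pair (ract_bal x) _ _. Qed.
Lemma bmul_pair u v : bmul (bpair iota u v) = u * v.
Proof. exact: blift_pair bmul_bal _ _. Qed.
Lemma coactl_pair u v : coactl (bpair iota u v) =
  klift (fun u0 u1 => bpair iota u0 v \ot u1) (rho u).
Proof. exact: blift_pair coactl_bal _ _. Qed.
Lemma coactr_pair u v : coactr (bpair iota u v) =
  klift (fun v0 v1 => bpair iota u v0 \ot v1) (rho v).
Proof. exact: blift_pair coactr_bal _ _. Qed.
Lemma lact_linear x : linear (lact x). Proof. exact: blift_linear (lact_bal x). Qed.
Lemma lact_linearl s : linear (fun x => lact x s).
Proof. by apply: tlift_linear_arg => u v; lin. Qed.
Lemma ract_linear x : linear (fun s => ract s x). Proof. exact: blift_linear (ract_bal x). Qed.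
Lemma ract_linearr s : linear (ract s).
Proof. by apply: tlift_linear_arg => u v; lin. Qed.
Lemma bmul_linear : linear bmul. Proof. exact: blift_linear bmul_bal. Qed.
Lemma coactl_linear : linear coactl. Proof. exact: blift_linear coactl_bal. Qed.
Lemma coactr_linear : linear coactr. Proof. exact: blift_linear coactr_bal. Qed.
End TranslationMap.
Opaque lact ract bmul coactl coactr tmap can.

Ltac lin_transl :=
  lazymatch goal with
  | |- GRing.linear_for _ (transl _) => exact: transl_linear
  | |- GRing.linear_for _ (@can _ _ _ _ _ _ _) => exact: can_linear
  | |- GRing.linear_for _ (canV _) => exact: canV_linear
  | |- GRing.linear_for _ (lact _) => exact: lact_linear
  | |- GRing.linear_for _ (fun x => lact x _) => exact: lact_linearl
  | |- GRing.linear_for _ (ract _) => exact: ract_linearr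
  | |- GRing.linear_for _ (fun x => ract x _) => exact: ract_linear
  | |- GRing.linear_for _ (@bmul _ _ _ _ _ _ _) => exact: bmul_linear
  | |- GRing.linear_for _ (@coactl _ _ _ _ _ _ _) => exact: coactl_linear
  | |- GRing.linear_for _ (@coactr _ _ _ _ _ _ _) => exact: coactr_linear
  end.
Ltac lin_known ::= first [lin_antip | lin_bpair | lin_transl].

Section TranslationIdentities.
Variables (k : fieldType) (H : algType k) (hH : hopf H) (A B : algType k).
Variables (cB : comod_alg hH B) (gB : galois_ext A cB).
Local Notation S := (antip hH).
Local Notation S' := (antipV hH).
Local Notation D := (comul hH).
Local Notation eps h := (counit hH h : k).
Local Notation rho := (coact cB).
Local Notation iota := (incl gB).
Local Notation BAB := (btens iota).
Local Notation tau := (transl gB).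

Lemma can_lact x (s : BAB) : can (lact x s) = tmul (x \ot 1) (can s).
Proof.
move: s; apply: btens_ext; [lin | lin | move=> u v].
rewrite lact_pair !can_pair (klift_out (f := tmul (x \ot 1))); last by lin.
by apply: eq_klift => y h; rewrite tmul_pair mul1r mulrA.
Qed.

Lemma can_ract x (s : BAB) : can (ract s x) = tmul (can s) (rho x).
Proof.
move: s; apply: btens_ext; [lin | lin | move=> u v].
rewrite ract_pair !can_pair coact_mul; last by lin.
rewrite (klift_out (f := fun w => tmul w (rho x))); last by lin.
apply: eq_klift => y h; rewrite -[in RHS](klift_kpair (rho x)).
rewrite (klift_out (f := tmul _)); last by lin.
by apply: eq_klift => y' h'; rewrite tmul_pair mulrA.
Qed.

Lemma transl1 : tau 1 = bpair iota 1 1.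
Proof.
apply: can_injective; rewrite can_transl can_pair coact1 [RHS]klift_pair ?mulr1 //.
by lin.
Qed.

Lemma bmul_transl h : bmul (tau h) = eps h *: 1.
Proof.
apply: (blift_transl (G := fun x h => eps h *: x)); [lin | exact: bmul_bal | ].
move=> u v; rewrite -[in LHS](coact_counit cB v) (klift_out (f := *%R u)); last by lin.
by apply: eq_klift => x y; rewrite scalerAr.
Qed.

(** Both sides have the image x_0 (x) h x_1 under beta. *)
Lemma lact_transl h x :
  klift (fun x0 x1 => lact x0 (tau (h * x1))) (rho x) = ract (tau h) x.
Proof.
apply: can_injective; rewrite (klift_out (f := can (g := gB))); last by lin.
rewrite [RHS]can_ract can_transl -[in RHS](klift_kpair (rho x)).
rewrite (klift_out (f := tmul _)); last by lin.
by apply: eq_klift => x0 x1; rewrite can_lact can_transl !tmul_pair !mul1r mulr1.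
Qed.

(** The image of the left side under beta is y_0 (x) h S^-1(y_2) y_1 = y (x) h. *)
Lemma ract_transl h y :
  klift (fun y0 y1 => ract (tau (h * S' y1)) y0) (rho y) = lact y (tau h).
Proof.
apply: can_injective; rewrite (klift_out (f := can (g := gB))); last by lin.
transitivity (klift (fun y0 y1 => klift (fun y00 y01 => y00 \ot (h * (S' y1 * y01))) (rho y0)) (rho y)).
  apply: eq_klift => y0 y1; rewrite can_ract can_transl -[in LHS](klift_kpair (rho y0)).
  rewrite (klift_out (f := tmul _)); last by lin.
  by apply: eq_klift => u v; rewrite tmul_pair mul1r mulrA.
rewrite -(@coact_coassoc _ _ _ _ _ _ (fun y00 y01 y1 => y00 \ot (h * (S' y1 * y01)))); try by lin.
rewrite can_lact can_transl tmul_pair mulr1 mul1r.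
rewrite -[in RHS](coact_counit cB y) (klift_out (f := fun y => y \ot h)); last by lin.
apply: eq_klift => x z.
rewrite -(klift_out (f := fun g => x \ot (h * g)) (fun u v => S' v * u)); last by lin.
by rewrite antipV_left -scalerAr mulr1 kpairZl kpairZr.
Qed.

Lemma tmap_can_inj (u v : BAB \ox H) :
  tmap (can (g := gB)) id u = tmap (can (g := gB)) id v -> u = v.
Proof.
have E (w : BAB \ox H) : tmap (canV gB) id (tmap (can (g := gB)) id w) = w.
  move: w; apply: ktens_ext; [lin | by [] | move=> s h].
  by rewrite !tmap_pair ?(canK (g := gB)) //; lin.
exact: (can_inj E).
Qed.

(** Under beta the coaction on the second factor becomes the comultiplication of H. *)
Lemma coactr_transl h :
  coactr (tau h) = klift (fun h1 h2 => tau h1 \ot h2) (D h).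
Proof.
have canL := @can_linear _ _ _ _ _ _ gB; have idL := @lin_id k H.
apply: tmap_can_inj.
transitivity (klift (fun x h => klift (fun h1 h2 => (x \ot h1) \ot h2) (D h)) (can (tau h))).
  move: (tau h); apply: btens_ext; [lin | lin | move=> u v].
  rewrite coactr_pair can_pair.
  rewrite [LHS](klift_out (f := tmap _ _)); last by lin.
  rewrite [RHS](klift_out (f := klift _)); last by lin.
  transitivity (klift (fun v0 v1 => klift (fun v00 v01 =>
    ((u * v00) \ot v01) \ot v1) (rho v0)) (rho v)).
    apply: eq_klift => v0 v1; rewrite (tmap_pair canL idL) can_pair.
    by rewrite [LHS](klift_out (f := fun w => w \ot v1)); last by lin.
  rewrite -[LHS](@coact_coassoc _ _ _ _ _ _ (fun v00 v01 v1 => ((u * v00) \ot v01) \ot v1)); try by lin.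
  by apply: eq_klift => x y; rewrite [RHS]klift_pair; last by lin.
rewrite can_transl [LHS]klift_pair; last by lin.
rewrite [RHS](klift_out (f := tmap _ _)); last by lin.
by apply: eq_klift => h1 h2; rewrite (tmap_pair canL idL) can_transl.
Qed.

(** Under beta the coaction on the first factor becomes b (x) h |-> b_0 (x) h_2 (x) b_1
    S(h_1). *)
Lemma coactl_transl h :
  coactl (tau h) = klift (fun h1 h2 => tau h2 \ot S h1) (D h).
Proof.
have canL := @can_linear _ _ _ _ _ _ gB; have idL := @lin_id k H.
apply: tmap_can_inj.
transitivity (klift (fun b h => klift (fun h1 h2 => klift (fun b0 b1 =>
  (b0 \ot h2) \ot (b1 * S h1)) (rho b)) (D h)) (can (tau h))); last first.
  rewrite can_transl [LHS]klift_pair; last by lin.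
  rewrite [RHS](klift_out (f := tmap _ _)); last by lin.
  apply: eq_klift => h1 h2; rewrite coact1 [LHS]klift_pair; last by lin.
  by rewrite mul1r (tmap_pair canL idL) can_transl.
pose phi (u0 : B) (u1 : H) (v00 : B) (v01 h1 h2 : H) : (B \ox H) \ox H :=
  ((u0 * v00) \ot h2) \ot (u1 * (v01 * S h1)).
move: (tau h); apply: btens_ext; [lin | lin | move=> u v].
pose Phi v g1 g2 :=
  klift (fun u0 u1 => klift (fun h1 h2 => phi u0 u1 v g1 h1 h2) (D g2)) (rho u).
transitivity (klift (fun v0 v1 => klift (Phi v0) (D v1)) (rho v)).
  rewrite coactl_pair [LHS](klift_out (f := tmap _ _)); last by lin.
  transitivity (klift (fun u0 u1 => klift (fun v0 v1 =>
    ((u0 * v0) \ot v1) \ot u1) (rho v)) (rho u)).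
    apply: eq_klift => u0 u1; rewrite (tmap_pair canL idL) can_pair.
    by rewrite [LHS](klift_out (f := fun w => w \ot u1)); last by lin.
  rewrite [LHS]klift_exch; apply: eq_klift => v0 v1.
  rewrite [RHS]klift_exch; apply: eq_klift => u0 u1.
  rewrite [RHS](@coassoc _ _ hH _ (fun g1 h1 h2 => phi u0 u1 v0 g1 h1 h2)); try by rewrite /phi; lin.
  rewrite -[in LHS](comul_counitl hH v1).
  rewrite [LHS](klift_out (f := fun h => ((u0 * v0) \ot h) \ot u1)); last by lin.
  apply: eq_klift => g1 g2; rewrite /phi.
  rewrite -[RHS](klift_out (f := fun g => ((u0 * v0) \ot g2) \ot (u1 * g)) (fun a b => a * S b)); last by lin.
  by rewrite antip_right -scalerAr mulr1 !(kpairZr, kpairZl).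
rewrite [LHS](@coact_coassoc _ _ _ _ _ _ Phi); try by rewrite /Phi /phi; lin.
rewrite can_pair [RHS](klift_out (f := klift _)); last by lin.
apply: eq_klift => v0 v1; rewrite [RHS]klift_pair; last by lin.
transitivity (klift (fun v00 v01 => klift (fun h1 h2 => klift (fun u0 u1 =>
    phi u0 u1 v00 v01 h1 h2) (rho u)) (D v1)) (rho v0)).
  by apply: eq_klift => v00 v01; exact: klift_exch.
rewrite [LHS]klift_exch; apply: eq_klift => h1 h2.
rewrite [RHS]coact_mul; last by lin.
rewrite [LHS]klift_exch; apply: eq_klift => u0 u1; apply: eq_klift => v00 v01.
by rewrite /phi mulrA.
Qed.
End TranslationIdentities.

(** * The trace of a Galois extension *)

Lemma epair_linl (k : fieldType) (A : algType k) (y : A) : linear (fun x => epair x y).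
Proof. exact: kpair_linl. Qed.
Lemma epair_linr (k : fieldType) (A : algType k) (x : A) : linear (epair x).
Proof. exact: kpair_linr. Qed.

Ltac lin_env :=
  lazymatch goal with
  | |- GRing.linear_for _ (epair _) => exact: epair_linr
  | |- GRing.linear_for _ (fun x => epair x _) => exact: epair_linl
  | |- GRing.linear_for _ (sandwich _) => exact: sandwich_linr
  | |- GRing.linear_for _ (fun x => sandwich x _) => exact: sandwich_linl
  | |- GRing.linear_for _ (fun x => GRing.mul x ?b) => exact: (env_mul_linl b)
  | |- GRing.linear_for _ (GRing.mul ?b) => exact: (env_mul_linr b)
  end.
Ltac lin_known ::= first [lin_antip | lin_bpair | lin_transl | lin_env].

Section Trace.
Variables (k : fieldType) (H : algType k) (hH : hopf H) (A B : algType k).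
Variables (cB : comod_alg hH B) (gB : galois_ext A cB).
Local Notation S := (antip hH).
Local Notation S' := (antipV hH).
Local Notation D := (comul hH).
Local Notation eps h := (counit hH h : k).
Local Notation rho := (coact cB).
Local Notation iota := (incl gB).
Local Notation BAB := (btens iota).
Local Notation tau := (transl gB).
Local Notation ra := (fun (a : A) (b : B) => b * iota a).
Local Notation la := (fun (a : A) (b : B) => iota a * b).
Local Notation bal := (balanced ra la).
Local Notation blift phi := (tlift phi : BAB -> _).

Variable F : frob_pair hH.
Local Notation t := (fint F).
Local Notation lam := (flam F).
Let tl := fint_l F.
Let tr_ := fint_r F.
Let St := fint_antip F.
Let lamL : linear lam := flam_linear F.
Let lamt := flam_fint F.
Let lamP := flam_comul F.

Definition trace (b : B) : B := klift (fun x y => (lam y : k) *: x) (rho b).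

Lemma trace_linear : linear trace.
Proof. by rewrite /trace; lin. Qed.

(** b_0 (x) b_1 lam(b_2) = b_0 lam(b_1) (x) 1, because lam is an integral. *)
Lemma trace_coinv b : exists a, iota a = trace b.
Proof.
apply/(coinvP gB); rewrite /trace [LHS](klift_out (f := rho)); last by lin.
transitivity (klift (fun x y => klift (fun x0 x1 => (lam y : k) *: (x0 \ot x1)) (rho x)) (rho b)).
  by apply: eq_klift => x y; rewrite kliftZ klift_kpair linearZ.
rewrite -[LHS](@coact_coassoc _ _ _ _ _ _ (fun x0 x1 y => (lam y : k) *: (x0 \ot x1))); try by lin.
rewrite [RHS](klift_out (f := fun z => z \ot 1)); last by lin.
apply: eq_klift => x y; rewrite [RHS]kpairZl -[RHS]kpairZr -lamP [RHS](klift_out (f := kpair x)); last by lin.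
by apply: eq_klift => u v; rewrite kpairZr.
Qed.

Definition tra (b : B) : A := projT1 (cid (trace_coinv b)).

Lemma traE b : iota (tra b) = trace b.
Proof. by rewrite /tra; case: cid. Qed.

Lemma trace_iotal a b : trace (iota a * b) = iota a * trace b.
Proof.
rewrite /trace [LHS]coact_iotal; last by lin.
rewrite [RHS](klift_out (f := *%R (iota a))); last by lin.
by apply: eq_klift => x y; rewrite scalerAr.
Qed.

Lemma trace_iotar a b : trace (b * iota a) = trace b * iota a.
Proof.
rewrite /trace [LHS]coact_iotar; last by lin.
rewrite [RHS](klift_out (f := fun x => x * iota a)); last by lin.
by apply: eq_klift => x y; rewrite scalerAl.
Qed.

(** Contractions of B (x)_A B against b; they read off coordinates with respect to the
    dual bases found below. *)
Definition trl b (s : BAB) : B := blift (fun u v => trace (b * u) * v) s.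
Definition trr b (s : BAB) : B := blift (fun u v => u * trace (v * b)) s.

Lemma trl_bal b : bal (fun u v => trace (b * u) * v).
Proof.
have T := trace_linear; split; [lin | lin | move=> a u v /=].
by rewrite [b * _]mulrA trace_iotar mulrA.
Qed.
Lemma trr_bal b : bal (fun u v => u * trace (v * b)).
Proof.
have T := trace_linear; split; [lin | lin | move=> a u v /=].
by rewrite -[iota a * v * b]mulrA trace_iotal mulrA.
Qed.
Lemma trl_pair b u v : trl b (bpair iota u v) = trace (b * u) * v.
Proof. exact: blift_pair (trl_bal b) _ _. Qed.
Lemma trr_pair b u v : trr b (bpair iota u v) = u * trace (v * b).
Proof. exact: blift_pair (trr_bal b) _ _. Qed.
Lemma trl_linear b : linear (trl b). Proof. exact: blift_linear (trl_bal b). Qed.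
Lemma trr_linear b : linear (trr b). Proof. exact: blift_linear (trr_bal b). Qed.
Lemma trl_linearl s : linear (fun b => trl b s).
Proof. by have T := trace_linear; apply: tlift_linear_arg => u v; lin. Qed.
Lemma trr_linearl s : linear (fun b => trr b s).
Proof. by have T := trace_linear; apply: tlift_linear_arg => u v; lin. Qed.

(** l tr(r b) = l r_0 b_0 lam(r_1 b_1) factors through beta, and at tau t it is b_0
    lam(t b_1) = b. *)
Lemma trr_integral b : trr b (tau t) = b.
Proof.
rewrite /trr (blift_transl (G := fun x h => klift (fun b0 b1 => (lam (h * b1) : k) *: (x * b0)) (rho b))).
- rewrite -[RHS](coact_counit cB b); apply: eq_klift => x y.
  by rewrite tr_ (linZ lamL) lamt mul1r [_ *: (1 : k^o)]mulr1.
- by lin.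
- exact: trr_bal.
move=> u v; rewrite /trace coact_mul; last by lin.
rewrite [LHS](klift_out (f := *%R u)); last by lin.
apply: eq_klift => x y; rewrite [LHS](klift_out (f := *%R u)); last by lin.
by apply: eq_klift => x' y'; rewrite -scalerAr mulrA.
Qed.

(** tr(b l) r = b_0 l_0 r lam(b_1 l_1). At tau t the coaction on l contributes S t = t,
    which leaves b_0 lam(b_1 t) = b. *)
Lemma trl_integral b : trl b (tau t) = b.
Proof.
have T := trl_linear b.
have L1 b0 b1 : bilin (fun (s : BAB) x => (lam (b1 * x) : k) *: (b0 * bmul s)) by lin.
transitivity (klift (fun b0 b1 => klift (fun s x => (lam (b1 * x) : k) *: (b0 * bmul s)) (coactl (tau t))) (rho b)).
  move: (tau t); apply: btens_ext; [lin | lin | move=> u v].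
  rewrite trl_pair coactl_pair /trace.
  rewrite [LHS](klift_out (f := fun x => x * v)); last by lin.
  rewrite [LHS]coact_mul; last by lin.
  apply: eq_klift => b0 b1.
  rewrite [RHS](klift_out (f := klift _)); last exact: klift_linear.
  apply: eq_klift => u0 u1; rewrite [RHS](klift_pair (L1 _ _)) bmul_pair.
  by rewrite -scalerAl mulrA.
rewrite coactl_transl -[RHS](coact_counit cB b); apply: eq_klift => b0 b1.
rewrite [LHS](klift_out (f := klift _)); last exact: klift_linear.
transitivity (klift (fun h1 h2 => eps h2 *: ((lam (b1 * S h1) : k) *: b0)) (D t)).
  apply: eq_klift => h1 h2; rewrite [LHS](klift_pair (L1 _ _)) bmul_transl.
  by rewrite -scalerAr mulr1 !scalerA mulrC.
transitivity ((lam (b1 * S t) : k) *: b0).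
  rewrite -[in RHS](comul_counitr hH t).
  rewrite [RHS](klift_out (f := fun h => (lam (b1 * S h) : k) *: b0)); last by lin.
  have L2 : linear (fun h => lam (b1 * S h)) by lin.
  by apply: eq_klift => x y; rewrite (linZ L2) -scalerA.
by rewrite St tl (linZ lamL) lamt [_ *: 1]mulr1.
Qed.

(** B (x) B carries the codiagonal coaction, whose coinvariants are Gamma; this is its
    integral against lam. *)
Definition gtrace (z : env B) : env B :=
  klift (fun x y => klift (fun x0 x1 => klift (fun y0 y1 =>
    (lam (x1 * y1) : k) *: epair x0 y0) (rho y)) (rho x)) z.

Lemma gtrace_linear : linear gtrace.
Proof. by rewrite /gtrace; lin. Qed.

Lemma gtrace_pair x y : gtrace (epair x y) =
  klift (fun x0 x1 => klift (fun y0 y1 => (lam (x1 * y1) : k) *: epair x0 y0) (rho y)) (rho x).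
Proof. by rewrite [LHS]klift_pair; last by lin. Qed.

(** h_1 lam(h_2 g) = h_1 g_2 S^-1(g_1) lam(h_2 g_3) = S^-1(g_1) lam(h g_2). *)
Lemma lam_shift h g :
  klift (fun h1 h2 => (lam (h2 * g) : k) *: h1) (D h) =
  klift (fun g1 g2 => (lam (h * g2) : k) *: S' g1) (D g).
Proof.
transitivity (klift (fun h1 h2 => klift (fun g' g2 => klift (fun g11 g12 =>
   (lam (h2 * g2) : k) *: (h1 * (g12 * S' g11))) (D g')) (D g)) (D h)).
  apply: eq_klift => h1 h2.
  rewrite -[in LHS](comul_counitl hH g).
  rewrite [LHS](klift_out (f := fun g => (lam (h2 * g) : k) *: h1)); last by lin.
  apply: eq_klift => g' g2.
  rewrite -[RHS](klift_out (f := fun x => (lam (h2 * g2) : k) *: (h1 * x)) (fun u v => v * S' u)); last by lin.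
  have L : linear (fun g => lam (h2 * g)) by lin.
  rewrite (linZ L) antipV_right -[h1 * _]scalerAr mulr1 scalerA.
  by congr (_ *: _); exact: mulrC.
transitivity (klift (fun h1 h2 => klift (fun g1 g' => klift (fun g21 g22 =>
   (lam (h2 * g22) : k) *: (h1 * (g21 * S' g1))) (D g')) (D g)) (D h)).
  apply: eq_klift => h1 h2; apply: esym.
  by rewrite [LHS](@coassoc _ _ hH _ (fun g1 g21 g22 => (lam (h2 * g22) : k) *: (h1 * (g21 * S' g1)))); try by lin.
rewrite [LHS]klift_exch.
transitivity (klift (fun g1 g' => klift (fun g21 g22 => klift (fun h1 h2 =>
   (lam (h2 * g22) : k) *: (h1 * (g21 * S' g1))) (D h)) (D g')) (D g)).
  by apply: eq_klift => g1 g'; exact: klift_exch.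
apply: eq_klift => g1 g2.
rewrite [LHS]klift_exch.
transitivity (klift (fun x y => (lam y : k) *: (x * S' g1)) (D (h * g2))).
  rewrite comulM [RHS]klift_tmul; last by lin.
  by apply: eq_klift => h1 h2; apply: eq_klift => u v; rewrite mulrA.
transitivity (klift (fun x y => (lam y : k) *: x) (D (h * g2)) * S' g1).
  rewrite [RHS](klift_out (f := fun x => x * S' g1)); last by lin.
  by apply: eq_klift => x y; rewrite scalerAl.
by rewrite lamP -scalerAl mul1r.
Qed.

(** lam_shift exchanges the remaining coaction of x for S^-1 of that of y, which is the
    relation that defines Gamma. *)
Lemma gtrace_in_gamma z : gtrace z \in in_gamma cB.
Proof.
have gL := gammaL_linear cB; have gR := gammaR_linear cB; have T := gtrace_linear.
apply/asboolP; move: z; apply: env_ext; [lin | lin | move=> x y].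
rewrite !gtrace_pair [LHS](klift_out _ _ gL) [RHS](klift_out _ _ gR).
transitivity (klift (fun x0 x1 => klift (fun y0 y1 => klift (fun h1 h2 =>
   (lam (h2 * y1) : k) *: (x0 \ot (h1 \ot y0))) (D x1)) (rho y)) (rho x)).
  transitivity (klift (fun x' x2 => klift (fun x0 x1 => klift (fun y0 y1 =>
     (lam (x2 * y1) : k) *: (x0 \ot (x1 \ot y0))) (rho y)) (rho x')) (rho x)).
    apply: eq_klift => x' x2; rewrite [LHS](klift_out _ _ gL) [RHS]klift_exch.
    apply: eq_klift => y0 y1; rewrite (linZ gL) gammaL_pair.
    by rewrite -[LHS]kliftZ.
  rewrite -[LHS](@coact_coassoc _ _ _ _ _ _ (fun x0 x1 x2 => klift (fun y0 y1 =>
     (lam (x2 * y1) : k) *: (x0 \ot (x1 \ot y0))) (rho y))); try by lin.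
  by apply: eq_klift => x0 x1; exact: klift_exch.
apply: eq_klift => x0 x1; rewrite [RHS](klift_out _ _ gR).
transitivity (klift (fun y0 y1 => klift (fun g1 g2 =>
   (lam (x1 * g2) : k) *: (x0 \ot (S' g1 \ot y0))) (D y1)) (rho y)).
  apply: eq_klift => y0 y1.
  transitivity (x0 \ot (klift (fun h1 h2 => (lam (h2 * y1) : k) *: h1) (D x1) \ot y0)).
    rewrite [RHS](klift_out (f := fun h => x0 \ot (h \ot y0))); last by lin.
    by apply: eq_klift => h1 h2; rewrite [in RHS]kpairZl [RHS]kpairZr.
  rewrite lam_shift [LHS](klift_out (f := fun h => x0 \ot (h \ot y0))); last by lin.
  by apply: eq_klift => h1 h2; rewrite [in LHS]kpairZl [LHS]kpairZr.
rewrite [LHS](@coact_coassoc _ _ _ _ _ _ (fun y0 g1 g2 =>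
   (lam (x1 * g2) : k) *: (x0 \ot (S' g1 \ot y0)))); try by lin.
apply: eq_klift => y' y2; rewrite (linZ gR) gammaR_pair.
by rewrite -[RHS]kliftZ.
Qed.

Definition trg (z : env B) : Gamma cB := MkGamma (gtrace_in_gamma z).
End Trace.

(** * Dual bases for the trace *)

Opaque trl trr gtrace env_mul sandwich gammaL gammaR.

Ltac lin_trace :=
  lazymatch goal with
  | |- GRing.linear_for _ (trace _ _) => exact: trace_linear
  | |- GRing.linear_for _ (trl _ _) => exact: trl_linear
  | |- GRing.linear_for _ (fun x => trl _ x _) => exact: trl_linearl
  | |- GRing.linear_for _ (trr _ _) => exact: trr_linear
  | |- GRing.linear_for _ (fun x => trr _ x _) => exact: trr_linearl
  | |- GRing.linear_for _ (gtrace _ _) => exact: gtrace_linear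
  | |- GRing.linear_for _ (flam _) => exact: flam_linear
  | |- GRing.linear_for _ (gammaL _) => exact: gammaL_linear
  | |- GRing.linear_for _ (gammaR _) => exact: gammaR_linear
  end.
Ltac lin_known ::= first [lin_antip | lin_bpair | lin_transl | lin_env | lin_trace].

Section GammaTrace.
Variables (k : fieldType) (H : algType k) (hH : hopf H) (A B : algType k).
Variables (cB : comod_alg hH B) (gB : galois_ext A cB).
Variable F : frob_pair hH.
Local Notation t := (fint F).
Local Notation lam := (flam F).
Local Notation S' := (antipV hH).
Local Notation rho := (coact cB).
Local Notation iota := (incl gB).
Local Notation BAB := (btens iota).
Local Notation tau := (transl gB).
Local Notation ra := (fun (a : A) (b : B) => b * iota a).
Local Notation la := (fun (a : A) (b : B) => iota a * b).
Local Notation bal := (balanced ra la).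
Local Notation blift phi := (tlift phi : BAB -> _).
Local Notation trace := (trace cB F).
Local Notation gtrace := (gtrace cB F).

Definition gdiag (z : env B) : env B \ox H :=
  klift (fun x y => klift (fun x0 x1 => klift (fun y0 y1 =>
    epair x0 y0 \ot (x1 * y1)) (rho y)) (rho x)) z.

Lemma gdiag_linear : linear gdiag.
Proof. by rewrite /gdiag; lin. Qed.

Lemma gdiag_pair x y : gdiag (epair x y) =
  klift (fun x0 x1 => klift (fun y0 y1 => epair x0 y0 \ot (x1 * y1)) (rho y)) (rho x).
Proof. by rewrite [LHS]klift_pair; last by lin. Qed.

(** Multiply the relation that defines Gamma by the coaction of y; S^-1(y_2) y_1
    cancels. *)
Lemma gamma_coinv (g : Gamma cB) : gdiag (gval g) = gval g \ot 1.
Proof.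
case: g => /= z /asboolP E; have gL := gdiag_linear.
pose Psi (w : B \ox (H \ox B)) : env B \ox H :=
  klift (fun x u => klift (fun h y => klift (fun y0 y1 =>
    epair x y0 \ot (h * y1)) (rho y)) u) w.
have B2 x : bilin (fun h y => klift (fun y0 y1 => epair x y0 \ot (h * y1)) (rho y)) by lin.
have B1 : bilin (fun x u => klift (fun h y => klift (fun y0 y1 =>
    epair x y0 \ot (h * y1)) (rho y)) u) by lin.
have PL : linear Psi by exact: klift_linear.
have Ppair x h y : Psi (x \ot (h \ot y)) = klift (fun y0 y1 => epair x y0 \ot (h * y1)) (rho y).
  by rewrite /Psi [LHS](klift_pair B1) [LHS](klift_pair (B2 _)).
have EL w : Psi (gammaL cB w) = gdiag w.
  move: w; apply: env_ext; [lin | lin | move=> x y].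
  rewrite gdiag_pair gammaL_pair [LHS](klift_out _ _ PL).
  by apply: eq_klift => x0 x1; rewrite Ppair.
have ER w : Psi (gammaR cB w) = w \ot 1.
  move: w; apply: env_ext; [lin | lin | move=> x y].
  rewrite gammaR_pair [LHS](klift_out _ _ PL).
  transitivity (klift (fun y' y1 => klift (fun y0 y01 => epair x y0 \ot (S' y1 * y01)) (rho y')) (rho y)).
    by apply: eq_klift => y' y1; rewrite Ppair.
  rewrite -[LHS](@coact_coassoc _ _ _ _ _ _ (fun y0 y01 y1 => epair x y0 \ot (S' y1 * y01))); try by lin.
  rewrite -[in RHS](coact_counit cB y) [RHS](klift_out (f := fun y => epair x y \ot 1)); last by lin.
  apply: eq_klift => y0 y1; rewrite (linZ (epair_linr x)) [RHS]kpairZl -[RHS]kpairZr -antipV_left.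
  by rewrite [RHS](klift_out (f := kpair (epair x y0))); last by lin.
by rewrite -EL E ER.
Qed.

(** By gamma_coinv the coaction of g does not contribute to the argument of lam. *)
Lemma gtraceM z (g : Gamma cB) : gtrace (z * gval g) = gtrace z * gval g.
Proof.
move: z; apply: env_ext; [lin | lin | move=> x y].
have B1 x0 x1 y0 y1 : bilin (fun (w : env B) h => (lam (x1 * h * y1) : k) *: (epair x0 y0 * w)) by lin.
have E w : gtrace (epair x y * w) = klift (fun x0 x1 => klift (fun y0 y1 =>
    klift (fun w h => (lam (x1 * h * y1) : k) *: (epair x0 y0 * w)) (gdiag w)) (rho y)) (rho x).
  have gL := gdiag_linear; move: w; apply: env_ext; [lin | lin | move=> x' y'].
  rewrite epairM gtrace_pair [LHS]coact_mul; last by lin.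
  apply: eq_klift => x0 x1.
  transitivity (klift (fun x0' x1' => klift (fun y0' y1' => klift (fun y0 y1 =>
     (lam (x1 * x1' * (y1' * y1)) : k) *: epair (x0 * x0') (y0' * y0)) (rho y)) (rho y')) (rho x')).
    by apply: eq_klift => x0' x1'; rewrite [LHS]coact_mul; last by lin.
  transitivity (klift (fun x0' x1' => klift (fun y0 y1 => klift (fun y0' y1' =>
     (lam (x1 * x1' * (y1' * y1)) : k) *: epair (x0 * x0') (y0' * y0)) (rho y')) (rho y)) (rho x')).
    by apply: eq_klift => x0' x1'; exact: klift_exch.
  rewrite [LHS]klift_exch; apply: eq_klift => y0 y1.
  rewrite gdiag_pair [RHS](klift_out _ _ (klift_linear (B1 _ _ _ _))).
  apply: eq_klift => x0' x1'.
  rewrite [RHS](klift_out _ _ (klift_linear (B1 _ _ _ _))).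
  apply: eq_klift => y0' y1'; rewrite [RHS](klift_pair (B1 _ _ _ _)).
  by rewrite epairM !mulrA.
rewrite E gamma_coinv gtrace_pair [RHS](klift_out (f := fun z : env B => (z * gval g : env B))); last by lin.
apply: eq_klift => x0 x1; rewrite [RHS](klift_out (f := fun z : env B => (z * gval g : env B))); last by lin.
apply: eq_klift => y0 y1; rewrite [LHS](klift_pair (B1 _ _ _ _)) mulr1.
exact: env_scaleAl.
Qed.

Lemma sandwich_gtrace z a : sandwich (gtrace z) (iota a) = trace (sandwich z (iota a)).
Proof.
move: z; apply: env_ext; [lin | lin | move=> x y].
rewrite sandwich_pair -[RHS]/(klift (fun u h => (lam h : k) *: u) (rho (x * iota a * y))) [RHS]coact_mul; last by lin.
rewrite [RHS]coact_iotar; last by lin.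
rewrite gtrace_pair [LHS](klift_out (f := (@sandwich k B)^~ (iota a))); last by lin.
apply: eq_klift => x0 x1; rewrite [LHS](klift_out (f := (@sandwich k B)^~ (iota a))); last by lin.
by apply: eq_klift => y0 y1; rewrite (linZ (sandwich_linl (iota a))) sandwich_pair.
Qed.

(** A finite presentation tau t = sum u_q (x)_A v_q: the u_q and v_q are dual bases of B
    over A for the trace. *)
Definition fbasis : seq (B * B) := projT1 (cid (btensE (tau t))).

Lemma fbasisE : tau t = \sum_(q <- fbasis) bpair iota q.1 q.2.
Proof. by rewrite /fbasis; case: cid. Qed.

Lemma fbasis_sum (U : lmodType k) (phi : B -> B -> U) : bal phi ->
  \sum_(q <- fbasis) phi q.1 q.2 = blift phi (tau t).
Proof.
move=> pb; rewrite fbasisE (lin_sum (blift_linear pb)).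
by apply: eq_bigr => q _; rewrite blift_pair.
Qed.

Lemma fbasis_r b : \sum_(q <- fbasis) q.1 * trace (q.2 * b) = b.
Proof.
by rewrite -[RHS](trr_integral gB F b) (fbasis_sum (trr_bal gB F b)).
Qed.

Lemma fbasis_l b : \sum_(q <- fbasis) trace (b * q.1) * q.2 = b.
Proof.
by rewrite -[RHS](trl_integral gB F b) (fbasis_sum (trl_bal gB F b)).
Qed.

Lemma gtrace_iotal a z : gtrace (epair (iota a) 1 * z) = epair (iota a) 1 * gtrace z.
Proof.
move: z; apply: env_ext; [lin | lin | move=> x y].
rewrite epairM mulr1 !gtrace_pair [LHS]coact_iotal; last by lin.
rewrite [RHS](klift_out (f := fun z : env B => (epair (iota a) 1 * z : env B))); last by lin.
apply: eq_klift => x0 x1; rewrite [RHS](klift_out (f := fun z : env B => (epair (iota a) 1 * z : env B))); last by lin.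
by apply: eq_klift => y0 y1; rewrite -env_scaleAr epairM mulr1.
Qed.

Lemma epair1_mulA u v (z : env B) : epair u 1 * (epair v 1 * z) = epair (u * v) 1 * z.
Proof. by rewrite mulrA epairM (mulr1 (1 : B)). Qed.

(** The u_q (x) 1 are a dual basis of B (x) B as a right Gamma-module as well: the sum
    is x_0 (x) y_0 lam(t x_1 y_1), as for trr_integral. *)
Lemma fbasis_gamma z : \sum_(q <- fbasis) epair q.1 1 * gtrace (epair q.2 1 * z) = z.
Proof.
have pb (w : env B) : bal (fun u v => epair u 1 * gtrace (epair v 1 * w)).
  split; [lin | lin | move=> a u v /=].
  have E : gtrace (epair (iota a * v) 1 * w) = epair (iota a) 1 * gtrace (epair v 1 * w).
    etransitivity; last exact: gtrace_iotal.
    exact: (congr1 gtrace (esym (epair1_mulA _ _ _))).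
  etransitivity; last exact: (congr1 (fun z => epair u 1 * z) (esym E)).
  exact: esym (epair1_mulA _ _ _).
move: z; apply: env_ext; [lin | lin | move=> x y].
rewrite (fbasis_sum (pb _)).
rewrite (blift_transl (G := fun b h => klift (fun x0 x1 => klift (fun y0 y1 =>
  (lam (h * (x1 * y1)) : k) *: epair (b * x0) y0) (rho y)) (rho x))).
- rewrite -[in RHS](coact_counit cB x) [RHS](klift_out (f := fun x => epair x y)); last by lin.
  apply: eq_klift => x0 x1; rewrite (linZ (epair_linl y)).
  rewrite -[in RHS](coact_counit cB y) [in RHS](klift_out (f := epair x0)); last by lin.
  rewrite -[RHS]kliftZ; apply: eq_klift => y0 y1; rewrite (linZ (epair_linr x0)).
  rewrite fint_r (linZ (flam_linear F)) flam_fint mul1r rmorphM scalerA.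
  by congr (_ *: _); exact: mulr1.
- by lin.
- exact: pb.
move=> u v; rewrite epairM mulr1 gtrace_pair [in LHS]coact_mul; last by lin.
rewrite [LHS](klift_out (f := fun z : env B => (epair u 1 * z : env B))); last by lin.
apply: eq_klift => v0 v1.
rewrite [LHS](klift_out (f := fun z : env B => (epair u 1 * z : env B))); last by lin.
apply: eq_klift => x0 x1.
rewrite [LHS](klift_out (f := fun z : env B => (epair u 1 * z : env B))); last by lin.
apply: eq_klift => y0 y1.
by rewrite -env_scaleAr epairM mulr1 !mulrA.
Qed.
End GammaTrace.

(** * Elements of Gamma defined by the translation map *)

Opaque gdiag.

Section Averaging.
Variables (k : fieldType) (H : algType k) (hH : hopf H) (A B : algType k).
Variables (cB : comod_alg hH B) (gB : galois_ext A cB).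
Variable F : frob_pair hH.
Local Notation S := (antip hH).
Local Notation S' := (antipV hH).
Local Notation D := (comul hH).
Local Notation eps h := (counit hH h : k).
Local Notation rho := (coact cB).
Local Notation iota := (incl gB).
Local Notation BAB := (btens iota).
Local Notation tau := (transl gB).
Local Notation trace := (trace cB F).
Local Notation trl := (trl F).
Local Notation trr := (trr F).

Lemma trl_lact b x (s : BAB) : trl b (lact x s) = trl (b * x) s.
Proof.
move: s; apply: btens_ext; [lin | lin | move=> u v].
by rewrite lact_pair !trl_pair mulrA.
Qed.
Lemma trl_ract b x (s : BAB) : trl b (ract s x) = trl b s * x.
Proof.
move: s; apply: btens_ext; [lin | lin | move=> u v].
by rewrite ract_pair !trl_pair mulrA.
Qed.
Lemma trr_lact b x (s : BAB) : trr b (lact x s) = x * trr b s.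
Proof.
move: s; apply: btens_ext; [lin | lin | move=> u v].
by rewrite lact_pair !trr_pair mulrA.
Qed.
Lemma trr_ract b x (s : BAB) : trr b (ract s x) = trr (x * b) s.
Proof.
move: s; apply: btens_ext; [lin | lin | move=> u v].
by rewrite ract_pair !trr_pair mulrA.
Qed.

Lemma trl_mul b h x :
  trl b (tau h) * x = klift (fun x0 x1 => trl (b * x0) (tau (h * x1))) (rho x).
Proof.
rewrite -trl_ract -lact_transl [LHS](klift_out (f := trl b)); last by lin.
by apply: eq_klift => x0 x1; rewrite trl_lact.
Qed.
Lemma trr_mul b h y :
  y * trr b (tau h) = klift (fun y0 y1 => trr (y0 * b) (tau (h * S' y1))) (rho y).
Proof.
rewrite -trr_lact -ract_transl [LHS](klift_out (f := trr b)); last by lin.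
by apply: eq_klift => x0 x1; rewrite trr_ract.
Qed.

Lemma coact_trl b h :
  rho (trl b (tau h)) = klift (fun h1 h2 => trl b (tau h1) \ot h2) (D h).
Proof.
have B1 : bilin (fun (s : BAB) (x : H) => trl b s \ot x) by lin.
transitivity (klift (fun s x => trl b s \ot x) (coactr (tau h))).
  move: (tau h); apply: btens_ext; [lin | lin | move=> u v].
  rewrite trl_pair coactr_pair -(traE gB F) -[LHS]klift_kpair [LHS]coact_iotal; last by lin.
  rewrite [RHS](klift_out _ _ (klift_linear B1)); apply: eq_klift => v0 v1.
  by rewrite [RHS](klift_pair B1) trl_pair traE.
rewrite coactr_transl [LHS](klift_out _ _ (klift_linear B1)); apply: eq_klift => h1 h2.
exact: (klift_pair B1).
Qed.

Lemma coact_trr b h :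
  rho (trr b (tau h)) = klift (fun h1 h2 => trr b (tau h2) \ot S h1) (D h).
Proof.
have B1 : bilin (fun (s : BAB) (x : H) => trr b s \ot x) by lin.
transitivity (klift (fun s x => trr b s \ot x) (coactl (tau h))).
  move: (tau h); apply: btens_ext; [lin | lin | move=> u v].
  rewrite trr_pair coactl_pair -(traE gB F) -[LHS]klift_kpair [LHS]coact_iotar; last by lin.
  rewrite [RHS](klift_out _ _ (klift_linear B1)); apply: eq_klift => v0 v1.
  by rewrite [RHS](klift_pair B1) trr_pair traE.
rewrite coactl_transl [LHS](klift_out _ _ (klift_linear B1)); apply: eq_klift => h1 h2.
exact: (klift_pair B1).
Qed.

Definition gamv b b' h : env B :=
  klift (fun h1 h2 => epair (trl b (tau h1)) (trr b' (tau h2))) (D h).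

(** The left leg coacts by h_1 (x) h_2 and the right one by S, which the S^-1 in the
    definition of Gamma undoes; both sides become the iterated comultiplication of h. *)
Lemma gamv_in_gamma b b' h : gamv b b' h \in in_gamma cB.
Proof.
apply/asboolP; rewrite /gamv.
pose phi (h1 h2 h3 : H) := trl b (tau h1) \ot (h2 \ot trr b' (tau h3)).
rewrite [LHS](klift_out _ _ (gammaL_linear cB)) [RHS](klift_out _ _ (gammaR_linear cB)).
transitivity (klift (fun h' h3 => klift (fun h1 h2 => phi h1 h2 h3) (D h')) (D h)).
  apply: eq_klift => h' h3; rewrite gammaL_pair coact_trl.
  have B1 : bilin (fun (x0 : B) (x1 : H) => x0 \ot (x1 \ot trr b' (tau h3))) by lin.
  rewrite [LHS](klift_out _ _ (klift_linear B1)); apply: eq_klift => h1 h2.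
  exact: (klift_pair B1).
rewrite -[LHS](@coassoc _ _ hH _ phi); try by rewrite /phi; lin.
apply: eq_klift => h1 h'; rewrite gammaR_pair coact_trr.
have B1 : bilin (fun (y0 : B) (y1 : H) => trl b (tau h1) \ot (S' y1 \ot y0)) by lin.
rewrite [RHS](klift_out _ _ (klift_linear B1)); apply: eq_klift => h2 h3.
by rewrite [RHS](klift_pair B1) antipK.
Qed.

(** tr(b l(h_1)) r(h_1) (x) l(h_2) tr(r(h_2) b'): the middle part of sum l(h_1) (x)
    r(h_1) (x) l(h_2) (x) r(h_2), read off by the trace. *)
Definition gam b b' h : Gamma cB := MkGamma (gamv_in_gamma b b' h).

Lemma gamv_linear b b' : linear (gamv b b').
Proof. by rewrite /gamv; lin. Qed.

(** For g = sum x (x) y, the first factor moves past tau by lact_transl and the second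
    by ract_transl. These leave h_1 x_1 and h_2 S^-1(y_1), and the relation that defines
    Gamma turns S^-1(y_1) into x_2. *)
Lemma gamv_mul b b' h (g : Gamma cB) :
  gamv b b' h * gval g =
  klift (fun x y => klift (fun x0 x1 => gamv (b * x0) (y * b') (h * x1)) (rho x)) (gval g).
Proof.
pose Z (h1 h2 : H) (w : B \ox (H \ox B)) : env B :=
  klift (fun x u => klift (fun g y => klift (fun x0 x1 =>
    epair (trl (b * x0) (tau (h1 * x1))) (trr (y * b') (tau (h2 * g)))) (rho x)) u) w.
have B2 (h1 h2 : H) (x : B) : bilin (fun (g : H) (y : B) => klift (fun x0 x1 =>
    epair (trl (b * x0) (tau (h1 * x1))) (trr (y * b') (tau (h2 * g)))) (rho x)) by lin.
have B1 (h1 h2 : H) : bilin (fun (x : B) (u : H \ox B) => klift (fun g y => klift (fun x0 x1 =>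
    epair (trl (b * x0) (tau (h1 * x1))) (trr (y * b') (tau (h2 * g)))) (rho x)) u) by lin.
have ZL (h1 h2 : H) : linear (Z h1 h2) by exact: klift_linear.
have Zpair (h1 h2 : H) (x : B) (g' : H) (y : B) : Z h1 h2 (x \ot (g' \ot y)) = klift (fun x0 x1 =>
    epair (trl (b * x0) (tau (h1 * x1))) (trr (y * b') (tau (h2 * g')))) (rho x).
  by rewrite /Z [LHS](klift_pair (B1 _ _)) [LHS](klift_pair (B2 _ _ _)).
have ER (h1 h2 : H) (w : env B) : epair (trl b (tau h1)) (trr b' (tau h2)) * w = Z h1 h2 (gammaR cB w).
  have ZL' := ZL h1 h2; move: w; apply: env_ext; [lin | lin | move=> x y].
  rewrite epairM gammaR_pair [RHS](klift_out _ _ (ZL _ _)).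
  rewrite trl_mul trr_mul [LHS](klift_out (f := fun z => epair z _)); last by lin.
  transitivity (klift (fun x0 x1 => klift (fun y0 y1 =>
     epair (trl (b * x0) (tau (h1 * x1))) (trr (y0 * b') (tau (h2 * S' y1)))) (rho y)) (rho x)).
    apply: eq_klift => x0 x1.
    by rewrite [LHS](klift_out (f := epair (trl (b * x0) (tau (h1 * x1))))); last by lin.
  by rewrite [LHS]klift_exch; apply: eq_klift => y0 y1; rewrite Zpair.
pose phi (h1 h2 : H) (y x0 : B) (x1 x2 : H) :=
  epair (trl (b * x0) (tau (h1 * x1))) (trr (y * b') (tau (h2 * x2))).
transitivity (klift (fun h1 h2 => Z h1 h2 (gammaL cB (gval g))) (D h)).
  rewrite /gamv [LHS](klift_out (f := fun z : env B => (z * gval g : env B))); last by lin.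
  apply: eq_klift => h1 h2; etransitivity; first exact: ER.
  by case: g => z /= /asboolP ->.
transitivity (klift (fun x y => klift (fun h1 h2 =>
   klift (fun x0 x' => klift (fun x1 x2 => phi h1 h2 y x0 x1 x2) (D x')) (rho x)) (D h)) (gval g)).
  transitivity (klift (fun h1 h2 => klift (fun x y =>
     klift (fun x0 x' => klift (fun x1 x2 => phi h1 h2 y x0 x1 x2) (D x')) (rho x)) (gval g)) (D h));
     last exact: klift_exch.
  apply: eq_klift => h1 h2; have ZL' := ZL h1 h2.
  move: (gval g); apply: env_ext; [lin | by rewrite /phi; lin | move=> x y].
  rewrite gammaL_pair [LHS](klift_out _ _ (ZL _ _)) [RHS]klift_pair; last by rewrite /phi; lin.
  rewrite [RHS](@coact_coassoc _ _ _ _ _ _ (phi h1 h2 y)); try by rewrite /phi; lin.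
  by apply: eq_klift => x' x2; rewrite Zpair.
apply: eq_klift => x y; rewrite [LHS]klift_exch; apply: eq_klift => x0 x1.
rewrite /gamv comulM [RHS]klift_tmul; last by lin.
by apply: eq_klift => h1 h2; apply: eq_klift => u v.
Qed.

Local Notation fb := (fbasis gB F).

Lemma trace_dual b u : \sum_(q <- fb) trace (b * q.1) * trace (q.2 * u) = trace (b * u).
Proof.
rewrite -[in RHS](fbasis_r gB F u) mulr_sumr (lin_sum (trace_linear cB F)).
apply: eq_bigr => q _; rewrite -!(traE gB F) mulrA.
by rewrite [in RHS](traE gB F) trace_iotar traE.
Qed.

Lemma fbasis_trl b (s : BAB) : \sum_(q <- fb) trace (b * q.1) * trl q.2 s = trl b s.
Proof.
move: s; apply: btens_ext; [lin | lin | move=> u v].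
rewrite trl_pair -trace_dual mulr_suml; apply: eq_bigr => q _.
by rewrite trl_pair mulrA.
Qed.

Lemma fbasis_trr b (s : BAB) : \sum_(q <- fb) trr q.1 s * trace (q.2 * b) = trr b s.
Proof.
move: s; apply: btens_ext; [lin | lin | move=> u v].
rewrite trr_pair -trace_dual mulr_sumr; apply: eq_bigr => q _.
by rewrite trr_pair mulrA.
Qed.

Lemma fbasis_bmull (s : BAB) : \sum_(q <- fb) q.1 * trl q.2 s = bmul s.
Proof.
move: s; apply: btens_ext; [lin | lin | move=> u v].
rewrite bmul_pair -[in RHS](fbasis_r gB F u) mulr_suml; apply: eq_bigr => q _.
by rewrite trl_pair mulrA.
Qed.

Lemma fbasis_bmulr (s : BAB) : \sum_(q <- fb) trr q.1 s * q.2 = bmul s.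
Proof.
move: s; apply: btens_ext; [lin | lin | move=> u v].
rewrite bmul_pair -[in RHS](fbasis_l gB F v) mulr_sumr; apply: eq_bigr => q _.
by rewrite trr_pair mulrA.
Qed.

Lemma fbasis_bpairl (s : BAB) : \sum_(q <- fb) bpair iota q.1 (trl q.2 s) = s.
Proof.
move: s; apply: btens_ext; [lin | lin | move=> u v].
rewrite -[in RHS](fbasis_r gB F u) (lin_sum (bpair_linl gB v)); apply: eq_bigr => q _.
by rewrite trl_pair -(traE gB F) bpair_mid.
Qed.

Lemma fbasis_bpairr (s : BAB) : \sum_(q <- fb) bpair iota (trr q.1 s) q.2 = s.
Proof.
move: s; apply: btens_ext; [lin | lin | move=> u v].
rewrite -[in RHS](fbasis_l gB F v) (lin_sum (bpair_linr gB u)); apply: eq_bigr => q _.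
by rewrite trr_pair -(traE gB F) bpair_mid.
Qed.

Lemma epair_sum2 (f g : B * B -> B) :
  \sum_(q <- fb) \sum_(r <- fb) epair (f q) (g r) =
  epair (\sum_(q <- fb) f q) (\sum_(r <- fb) g r).
Proof.
rewrite (lin_sum (epair_linl _)); apply: eq_bigr => q _.
by rewrite (lin_sum (epair_linr _)).
Qed.

Lemma gamv_dual b b' h :
  \sum_(q <- fb) \sum_(r <- fb)
    epair (trace (b * q.1)) (trace (r.2 * b')) * gamv q.2 r.1 h = gamv b b' h.
Proof.
rewrite /gamv.
transitivity (\sum_(q <- fb) \sum_(r <- fb) klift (fun h1 h2 =>
   epair (trace (b * q.1) * trl q.2 (tau h1)) (trr r.1 (tau h2) * trace (r.2 * b'))) (D h)).
  apply: eq_bigr => q _; apply: eq_bigr => r _.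
  rewrite [LHS](klift_out (f := fun z : env B => (epair (trace (b * q.1)) (trace (r.2 * b')) * z : env B))); last by lin.
  by apply: eq_klift => h1 h2; rewrite epairM.
under eq_bigr => q _ do rewrite -klift_sum.
rewrite -klift_sum; apply: eq_klift => h1 h2.
by rewrite epair_sum2 fbasis_trl fbasis_trr.
Qed.

(** Recombining the outer factors gives l(h_1) r(h_1) (x) l(h_2) r(h_2), which is a
    scalar. *)
Lemma gamv_bmul h :
  \sum_(q <- fb) \sum_(r <- fb) epair q.1 r.2 * gamv q.2 r.1 h = eps h *: (epair 1 1 : env B).
Proof.
rewrite /gamv.
transitivity (\sum_(q <- fb) \sum_(r <- fb) klift (fun h1 h2 =>
   epair (q.1 * trl q.2 (tau h1)) (trr r.1 (tau h2) * r.2)) (D h)).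
  apply: eq_bigr => q _; apply: eq_bigr => r _.
  rewrite [LHS](klift_out (f := fun z : env B => (epair q.1 r.2 * z : env B))); last by lin.
  by apply: eq_klift => h1 h2; rewrite epairM.
under eq_bigr => q _ do rewrite -klift_sum.
rewrite -klift_sum -[in RHS](comul_counitr hH h).
rewrite [RHS](klift_out (f := fun h => eps h *: (epair 1 1 : env B))); last by lin.
apply: eq_klift => h1 h2.
rewrite epair_sum2 fbasis_bmull fbasis_bmulr !bmul_transl.
rewrite (linZ (epair_linl _)) (linZ (epair_linr _)) linearZ /= scalerA.
apply: (congr1 (fun c : k => c *: (epair 1 1 : env B))); exact: esym (linZ (counit_lin hH) _ _).
Qed.

Lemma gamv1 b b' : gamv b b' 1 = epair (trace b) (trace b').
Proof.
rewrite /gamv comul1 [LHS]klift_pair; last by lin.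
by rewrite transl1 trl_pair trr_pair mulr1 mul1r mulr1 mul1r.
Qed.

Lemma gamv1_dual :
  \sum_(q <- fb) \sum_(r <- fb) epair q.1 r.2 * epair (trace q.2) (trace r.1) = epair 1 1.
Proof.
transitivity (\sum_(q <- fb) \sum_(r <- fb) epair (q.1 * trace q.2) (trace r.1 * r.2)).
  by apply: eq_bigr => q _; apply: eq_bigr => r _; rewrite epairM.
rewrite epair_sum2; congr epair.
  by rewrite -[RHS](fbasis_r gB F 1); apply: eq_bigr => q _; rewrite mulr1.
by rewrite -[RHS](fbasis_l gB F 1); apply: eq_bigr => q _; rewrite mul1r.
Qed.
End Averaging.

(** * Averaging operators *)

Opaque gamv.

Ltac lin_gamv :=
  lazymatch goal with
  | |- GRing.linear_for _ (gamv _ _ _ _) => exact: gamv_linear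
  end.
Ltac lin_known ::= first [lin_antip | lin_bpair | lin_transl | lin_env | lin_trace | lin_gamv].

Section AveragingModules.
Variables (k : fieldType) (H : algType k) (hH : hopf H) (A B : algType k).
Variables (cB : comod_alg hH B) (gB : galois_ext A cB).
Variable F : frob_pair hH.
Local Notation t := (fint F).
Local Notation eps h := (counit hH h : k).
Local Notation rho := (coact cB).
Local Notation iota := (incl gB).
Local Notation trace := (trace cB F).

Local Notation fb := (fbasis gB F).
Local Notation G := (Gamma cB).
Local Notation gam := (gam gB F).
Local Notation gamv := (gamv gB F).

(** Linearity over A^e and, below, over Gamma, for maps into a B^e-module. *)
Definition elin (M : lmodType G) (N : lmodType (env B)) (f : M -> N) : Prop :=
  (forall m m', f (m + m') = f m + f m') /\
  forall z m, f (env_gamma gB z *: m) = env_map iota z *: f m.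

Definition glin (M : lmodType G) (N : lmodType (env B)) (f : M -> N) : Prop :=
  (forall m m', f (m + m') = f m + f m') /\
  forall (g : G) m, f (g *: m) = gval g *: f m.

Lemma glin_elin (M : lmodType G) (N : lmodType (env B)) (f : M -> N) : glin f -> elin f.
Proof. by case=> fD fZ; split=> // z m; rewrite fZ. Qed.

(** Gamma as a vector space over k, whose scalars act through A^e. *)
Definition gspace : lmodType k := kmod (resA gB (G^o)).

Lemma gval_linear : linear (fun g : gspace => gval (g : G)).
Proof.
move=> c u v.
have -> : gval (c *: u + v : G) = env_map iota (env_const A c) * gval (u : G) + gval (v : G).
  by [].
congr (_ + _); rewrite /env_const (linZ (env_map_linear iota)) env_map_pair rmorph1.
by rewrite -env_scaleAl; congr (_ *: _); exact: mul1r.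
Qed.

Lemma kmod_scaleE (R : algType k) (N : lmodType (env R)) c (n : N) :
  c *: (n : kmod N) = env_const R c *: n.
Proof. by []. Qed.

Lemma elin_gspace (M : lmodType G) (N : lmodType (env B)) (f : M -> N) z m : elin f ->
  linear (fun g : gspace => (z *: f ((g : G) *: m) : kmod N)).
Proof.
move=> [fD fZ] c u v.
have -> : (((c *: u + v : gspace) : G) *: m) = env_gamma gB (env_const A c) *: ((u : G) *: m) + (v : G) *: m.
  by rewrite scalerDl scalerA.
rewrite fD fZ env_mapc scalerDr; congr (_ + _).
have E := congr1 (fun w => w *: f ((u : G) *: m)) (env_const_mulC z c).
exact: etrans (scalerA z _ _) (etrans E (esym (scalerA _ z _))).
Qed.

(** The action of h on Hom_{A^e}(M, N), written in the dual bases; N is an arbitrary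
    B^e-module. *)
Definition avg (M : lmodType G) (N : lmodType (env B)) (f : M -> N) (h : H) (m : M) : N :=
  \sum_(q <- fb) \sum_(r <- fb) epair q.1 r.2 *: f (gam q.2 r.1 h *: m).

Lemma gval_sum I (s : seq I) (E : I -> G) :
  gval (\sum_(i <- s) E i) = \sum_(i <- s) gval (E i).
Proof. by elim: s => [|i s IH]; rewrite ?big_nil // !big_cons -IH. Qed.

Lemma gam_linear b b' : linear (gam b b' : H -> gspace).
Proof.
move=> c u v; apply: val_inj; rewrite /=.
rewrite [RHS](gval_linear c (gam b b' u) (gam b b' v)) /=.
exact: gamv_linear.
Qed.

Lemma avg_linear (M : lmodType G) (N : lmodType (env B)) (f : M -> N) m : elin f -> linear (fun h => avg f h m : kmod N).
Proof.
move=> fE; apply: lin_big => q; apply: lin_big => r.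
exact: (linear_comp (elin_gspace (epair q.1 r.2) m fE) (gam_linear q.2 r.1)).
Qed.

Lemma elin_sum (M : lmodType G) (N : lmodType (env B)) (f : M -> N) I (s : seq I) (E : I -> M) : elin f ->
  f (\sum_(i <- s) E i) = \sum_(i <- s) f (E i).
Proof.
move=> [fD fZ]; elim: s => [|i s IH]; last by rewrite !big_cons fD IH.
by rewrite !big_nil; apply: (addrI (f 0)); rewrite -fD !addr0.
Qed.

Lemma epair_fbasis x y (N : lmodType (env B)) (n : N) :
  epair x y *: n = \sum_(q <- fb) \sum_(r <- fb)
     epair q.1 r.2 *: (env_map iota (epair (tra gB F (q.2 * x)) (tra gB F (y * r.1))) *: n).
Proof.
transitivity ((\sum_(q <- fb) \sum_(r <- fb) epair (q.1 * trace (q.2 * x)) (trace (y * r.1) * r.2)) *: n).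
  by rewrite epair_sum2 fbasis_r fbasis_l.
rewrite scaler_suml; apply: eq_bigr => q _; rewrite scaler_suml; apply: eq_bigr => r _.
by rewrite scalerA env_map_pair !traE epairM.
Qed.

Lemma exchange_big4 (U : zmodType) I (s : seq I) (X : I -> I -> I -> I -> U) :
  \sum_(a <- s) \sum_(b <- s) \sum_(c <- s) \sum_(d <- s) X a b c d =
  \sum_(c <- s) \sum_(d <- s) \sum_(a <- s) \sum_(b <- s) X a b c d.
Proof.
under eq_bigr => a _ do rewrite exchange_big.
rewrite exchange_big; apply: eq_bigr => c _.
under eq_bigr => a _ do rewrite exchange_big.
exact: exchange_big.
Qed.

(** The outer factors are expanded in the dual bases with coordinates in A, which pass
    through f and are absorbed by gam. *)
Lemma avg_act (M : lmodType G) (N : lmodType (env B)) (f : M -> N) x y h m : elin f ->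
  epair x y *: avg f h m =
  \sum_(q <- fb) \sum_(r <- fb) epair q.1 r.2 *: f (gam (q.2 * x) (y * r.1) h *: m).
Proof.
move=> fE; pose X q' r' q r := epair q.1 r.2 *: f ((env_gamma gB
   (epair (tra gB F (q.2 * x * q'.1)) (tra gB F (r'.2 * (y * r.1)))) * gam q'.2 r'.1 h) *: m).
transitivity (\sum_(q' <- fb) \sum_(r' <- fb) \sum_(q <- fb) \sum_(r <- fb) X q' r' q r).
  rewrite /avg scaler_sumr; apply: eq_bigr => q' _; rewrite scaler_sumr.
  apply: eq_bigr => r' _; rewrite scalerA epairM epair_fbasis.
  apply: eq_bigr => q _; apply: eq_bigr => r _.
  by rewrite /X -[_ * gam _ _ _ *: m]scalerA fE.2 !mulrA.
rewrite exchange_big4; apply: eq_bigr => q _; apply: eq_bigr => r _.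
have -> : gam (q.2 * x) (y * r.1) h = \sum_(q' <- fb) \sum_(r' <- fb)
   env_gamma gB (epair (tra gB F (q.2 * x * q'.1)) (tra gB F (r'.2 * (y * r.1)))) * gam q'.2 r'.1 h.
  apply: val_inj; rewrite [RHS]gval_sum -[LHS]gamv_dual; apply: eq_bigr => q' _.
  rewrite gval_sum; apply: eq_bigr => r' _ /=.
  by rewrite env_map_pair !traE.
rewrite scaler_suml (elin_sum _ _ fE) scaler_sumr; apply: eq_bigr => q' _.
by rewrite scaler_suml (elin_sum _ _ fE) scaler_sumr; apply: eq_bigr => r' _.
Qed.

(** The key identity: on g m the operator at h is the operator at h x_1, followed by x_0
    (x) y, for g = sum x (x) y in Gamma. At h = 1 it shows that invariant maps are
    Gamma-linear, and at the integral that averages are. *)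
Lemma avg_gamma (M : lmodType G) (N : lmodType (env B)) (f : M -> N) h (g : G) m : elin f ->
  avg f h (g *: m) =
  klift (fun x y => klift (fun x0 x1 => (epair x0 y *: avg f (h * x1) m : kmod N)) (rho x)) (gval g).
Proof.
move=> fE.
have gE b b' : gam b b' h * g = klift (fun x y => klift (fun x0 x1 =>
    (gam (b * x0) (y * b') (h * x1) : gspace)) (rho x)) (gval g).
  apply: val_inj; rewrite /= gamv_mul.
  rewrite [RHS](klift_out _ _ gval_linear); apply: eq_klift => x y.
  by rewrite [RHS](klift_out _ _ gval_linear).
pose X (q r : B * B) (x y x0 : B) (x1 : H) : kmod N := epair q.1 r.2 *: f (gam (q.2 * x0) (y * r.1) (h * x1) *: m).
apply: esym; transitivity (klift (fun x y => klift (fun x0 x1 =>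
    \sum_(q <- fb) \sum_(r <- fb) X q r x y x0 x1) (rho x)) (gval g)).
  by apply: (@eq_klift _ _ _ (kmod N)) => x y; apply: (@eq_klift _ _ _ (kmod N)) => x0 x1; exact: avg_act.
transitivity (klift (fun x y => \sum_(q <- fb) \sum_(r <- fb) klift (X q r x y) (rho x)) (gval g)).
  apply: (@eq_klift _ _ _ (kmod N)) => x y; rewrite klift_sum; apply: eq_bigr => q _; exact: klift_sum.
rewrite klift_sum; apply: eq_bigr => q _; rewrite klift_sum; apply: eq_bigr => r _.
have L := elin_gspace (epair q.1 r.2) m fE.
apply: esym; rewrite scalerA gE; etransitivity; first exact: (klift_out _ _ L).
by apply: (@eq_klift _ _ _ (kmod N)) => x y; exact: (klift_out _ _ L).
Qed.

Lemma avg1 (M : lmodType G) (N : lmodType (env B)) (f : M -> N) m : elin f -> avg f 1 m = f m.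
Proof.
move=> fE; rewrite /avg; transitivity ((epair 1 1 : env B) *: f m); last exact: scale1r.
rewrite -(gamv1_dual gB F) scaler_suml.
apply: eq_bigr => q _; rewrite scaler_suml; apply: eq_bigr => r _.
rewrite -scalerA; congr (_ *: _).
rewrite -(traE gB F) -(traE gB F r.1) -env_map_pair -fE.2; congr (f (_ *: m)).
by apply: val_inj; rewrite /= gamv1 env_map_pair !traE.
Qed.

Lemma glin_avg (M : lmodType G) (N : lmodType (env B)) (f : M -> N) h m : glin f ->
  avg f h m = eps h *: (f m : kmod N).
Proof.
move=> [fD fZ]; rewrite /avg.
transitivity ((\sum_(q <- fb) \sum_(r <- fb) epair q.1 r.2 * gamv q.2 r.1 h) *: f m).
  rewrite scaler_suml; apply: eq_bigr => q _; rewrite scaler_suml; apply: eq_bigr => r _.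
  by rewrite fZ scalerA.
by rewrite gamv_bmul kmod_scaleE.
Qed.

Lemma sandwich_kmod (N : lmodType (env B)) (z : env B) (n : N) :
  z *: n = klift (fun x y => (epair x y *: n : kmod N)) z.
Proof.
have B1 : bilin (fun x y => (epair x y *: n : kmod N)).
  by split=> [y|x]; [apply: (linear_comp (act_linearl n) (epair_linl y)) | apply: (linear_comp (act_linearl n) (epair_linr x))].
move: z; apply: (env_ext (U := kmod N)) => [||x y].
- exact: act_linearl.
- exact: klift_linear.
by rewrite [RHS](klift_pair B1).
Qed.

Lemma invariant_glin (M : lmodType G) (N : lmodType (env B)) (f : M -> N) : elin f ->
  (forall h m, avg f h m = eps h *: (f m : kmod N)) -> glin f.
Proof.
move=> fE inv; split; first exact: fE.1.
move=> g m; rewrite -[LHS](avg1 _ fE) avg_gamma // [RHS]sandwich_kmod.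
apply: (@eq_klift _ _ _ (kmod N)) => x y; rewrite -[in RHS](coact_counit cB x).
have L := linear_comp (act_linearl (f m)) (epair_linl y).
rewrite [RHS](klift_out (f := fun x => (epair x y *: f m : kmod N))) //.
apply: (@eq_klift _ _ _ (kmod N)) => x0 x1; rewrite mul1r inv.
rewrite (linZ L); apply: (linZ (act_linearr (epair x0 y))).
Qed.

(** In avg_gamma the integral absorbs x_1, which leaves g acting on the average. *)
Lemma avg_integral_glin (M : lmodType G) (N : lmodType (env B)) (f : M -> N) : elin f ->
  glin (avg f t).
Proof.
move=> fE; split=> [m m'|g m].
  rewrite /avg -big_split; apply: eq_bigr => q _; rewrite -big_split.
  by apply: eq_bigr => r _; rewrite scalerDr fE.1 scalerDr.
rewrite avg_gamma // [RHS]sandwich_kmod; apply: (@eq_klift _ _ _ (kmod N)) => x y.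
rewrite -[in RHS](coact_counit cB x).
have L := linear_comp (act_linearl (avg f t m)) (epair_linl y).
rewrite [RHS](klift_out (f := fun x => (epair x y *: avg f t m : kmod N))) //.
apply: (@eq_klift _ _ _ (kmod N)) => x0 x1; rewrite fint_r (linZ (avg_linear m fE)).
rewrite (linZ L); apply: (linZ (act_linearr (epair x0 y))).
Qed.

Lemma avg_elin (M : lmodType G) (N : lmodType (env B)) (f : M -> N) h : elin f -> elin (avg f h).
Proof.
move=> fE; split=> [m m'|z m].
  rewrite /avg -big_split; apply: eq_bigr => q _; rewrite -big_split.
  by apply: eq_bigr => r _; rewrite scalerDr fE.1 scalerDr.
rewrite avg_gamma //=; apply: esym; rewrite [LHS]sandwich_kmod.
rewrite /env_map [LHS]klift_tmap; last first.
  by split=> [y|x]; [apply: (linear_comp (act_linearl _) (epair_linl y)) | apply: (linear_comp (act_linearl _) (epair_linr x))].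
have B1 y : bilin (fun x0 x1 => (epair x0 y *: avg f (h * x1) m : kmod N)).
  split=> [x1|x0]; first exact: (linear_comp (act_linearl _) (epair_linl y)).
  by apply: (linear_comp (act_linearr _)); apply: (linear_comp (avg_linear m fE)); lin.
have B2 : bilin (fun x y => klift (fun x0 x1 => (epair x0 y *: avg f (h * x1) m : kmod N)) (rho x)).
  split=> [y|x]; first by apply: (linear_comp (klift_linear (B1 y))); lin.
  by apply: klift_linear_arg => x0 x1; exact: (linear_comp (act_linearl _) (epair_linr _)).
rewrite [RHS](klift_tmap _ _ _ B2); apply: (@eq_klift _ _ _ (kmod N)) => a a'.
by rewrite coact_iota [RHS](klift_pair (B1 _)) mulr1.
Qed.

Lemma avg_comp (M : lmodType G) (N N' : lmodType (env B)) (f : M -> N) (p : N -> N') h m :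
  linear p -> p (avg f h m) = avg (fun m => p (f m)) h m.
Proof.
move=> pL; rewrite /avg (lin_sum pL); apply: eq_bigr => q _.
by rewrite (lin_sum pL); apply: eq_bigr => r _; rewrite (linZ pL).
Qed.

End AveragingModules.

(** * The Hopf action on bimodule maps *)

Section HopfAction.
Variables (k : fieldType) (H : algType k) (hH : hopf H) (A B : algType k).
Variables (cB : comod_alg hH B) (gB : galois_ext A cB).
Variable F : frob_pair hH.
Local Notation t := (fint F).
Local Notation D := (comul hH).
Local Notation iota := (incl gB).
Local Notation BAB := (btens iota).
Local Notation tau := (transl gB).
Local Notation trace := (trace cB F).
Local Notation trl := (trl F).
Local Notation trr := (trr F).

Local Notation fb := (fbasis gB F).
Local Notation G := (Gamma cB).
Local Notation gam := (gam gB F).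

Lemma bimod_elin (M : lmodType G) (f : M -> B) :
  bimod_map iota (f : resA gB M -> B) <-> elin gB (f : M -> bireg B).
Proof.
split=> [fL|[fD fZ] c u v].
  split=> [m m'|z m]; first exact: (linD fL).
  exact: (linZ fL).
by rewrite fD; congr (_ + _); exact: fZ.
Qed.

Lemma hact_decomp_fbasis h :
  hact_decomp gB h [seq ((q.1, gam q.2 r.1 h), r.2) | q <- fb, r <- fb].
Proof.
rewrite /hact_decomp big_allpairs_dep /= -[RHS]klift_kpair.
rewrite [RHS]klift_tmap; last by lin.
transitivity (\sum_(q <- fb) \sum_(r <- fb) klift (fun h1 h2 =>
   bpair iota q.1 (trl q.2 (tau h1)) \ot bpair iota (trr r.1 (tau h2)) r.2) (D h)).
  apply: eq_bigr => q _; apply: eq_bigr => r _.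
  have B1 : bilin (fun x y => bpair iota q.1 x \ot bpair iota y r.2) by lin.
  rewrite [LHS](klift_out _ _ (klift_linear B1)); apply: eq_klift => h1 h2.
  exact: (klift_pair B1).
under eq_bigr => q _ do rewrite -klift_sum.
rewrite -klift_sum; apply: eq_klift => h1 h2.
rewrite -[in RHS](fbasis_bpairl F (tau h1)) (lin_sum (kpair_linl _)).
apply: eq_bigr => q _.
by rewrite -[in RHS](fbasis_bpairr F (tau h2)) (lin_sum (kpair_linr _)).
Qed.

(** The dual bases provide a decomposition for every h, so the action is not the one of
    the default value. *)
Lemma hact_termsP h : hact_decomp gB h (hact_terms gB h).
Proof. apply: xgetPex; exists [seq ((q.1, gam q.2 r.1 h), r.2) | q <- fb, r <- fb]; exact: hact_decomp_fbasis. Qed.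

(** The action of h does not depend on the decomposition used to define it: the trace
    reads gam off from any of them. *)
Lemma hactE (M : lmodType G) (f : M -> B) h m : elin gB (f : M -> bireg B) ->
  hact gB f h m = avg gB F (f : M -> bireg B) h m.
Proof.
move=> fE; have dec := hact_termsP h; rewrite /hact.
set s := hact_terms gB h in dec *.
transitivity (\sum_(p <- s) \sum_(q <- fb) \sum_(r <- fb) epair q.1 r.2 *:
   (f ((env_gamma gB (epair (tra gB F (q.2 * p.1.1)) (tra gB F (p.2 * r.1))) * p.1.2) *: m) : bireg B)).
  apply: eq_bigr => p _; rewrite -sandwich_pair.
  etransitivity; first exact: (epair_fbasis gB F p.1.1 p.2 (f (p.1.2 *: m) : bireg B)).
  apply: eq_bigr => q _; apply: eq_bigr => r _.
  by rewrite -[in RHS]scalerA fE.2.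
rewrite exchange_big; apply: eq_bigr => q _.
rewrite exchange_big; apply: eq_bigr => r _.
rewrite -scaler_sumr -(elin_sum _ _ fE) -scaler_suml; apply: (congr1 (fun g : G => epair q.1 r.2 *: (f (g *: m) : bireg B))).
apply: val_inj; rewrite [LHS]gval_sum /=.
have B1 : bilin (fun s s' : BAB => epair (trl q.2 s) (trr r.1 s')) by lin.
have := congr1 (klift (fun s s' : BAB => epair (trl q.2 s) (trr r.1 s'))) dec.
rewrite (lin_sum (klift_linear B1)) [X in _ = X -> _](klift_tmap _ _ _ B1) /= => E.
etransitivity; last exact: E.
apply: eq_bigr => p _; rewrite env_map_pair !traE.
move: (gval p.1.2); apply: env_ext; [lin | | move=> x y].
  by apply: (linear_comp (klift_linear B1)); lin.
have B2 : bilin (fun x y => bpair iota p.1.1 x \ot bpair iota y p.2) by lin.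
by rewrite epairM [in RHS](klift_pair B2) [RHS](klift_pair B1) trl_pair trr_pair.
Qed.

Lemma kmod_biregE c (b : B) : c *: ((b : bireg B) : kmod (bireg B)) = c *: b.
Proof.
transitivity (sandwich (env_const B c) b); first by [].
by rewrite /env_const (linZ (sandwich_linl b)) sandwich_pair mul1r mulr1.
Qed.

(** The invariant bimodule maps are the Gamma-linear ones; this is where the isomorphism
    Theta comes from. *)
Lemma hinvariant_glin (M : lmodType G) (f : M -> B) :
  bimod_map iota (f : resA gB M -> B) -> hinvariant gB f -> glin (f : M -> bireg B).
Proof.
move=> /bimod_elin fE inv; apply: (invariant_glin (F := F) fE) => h m.
by rewrite -hactE // inv; exact: esym (kmod_biregE _ _).
Qed.

Lemma glin_hinvariant (M : lmodType G) (f : M -> B) : glin (f : M -> bireg B) ->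
  bimod_map iota (f : resA gB M -> B) /\ hinvariant gB f.
Proof.
move=> fG; have fE := glin_elin gB fG; split; first exact/bimod_elin.
move=> h m; rewrite (hactE _ _ fE) (glin_avg gB F _ _ fG).
exact: kmod_biregE.
Qed.

Lemma hact_bimod (M : lmodType G) (f : M -> B) h :
  bimod_map iota (f : resA gB M -> B) -> bimod_map iota (hact gB f h : resA gB M -> B).
Proof.
move=> /bimod_elin fE; apply/bimod_elin.
have -> : hact gB f h = avg gB F (f : M -> bireg B) h by apply/funext => m; exact: hactE.
exact: avg_elin.
Qed.

Lemma hact_integral_glin (M : lmodType G) (f : M -> B) :
  bimod_map iota (f : resA gB M -> B) -> glin (hact gB f t : M -> bireg B).
Proof.
move=> /bimod_elin fE.
have -> : hact gB f t = avg gB F (f : M -> bireg B) t by apply/funext => m; exact: hactE.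
exact: avg_integral_glin.
Qed.
End HopfAction.

(** * Induction from Gamma to the enveloping algebra *)

Section Induction.
Variables (k : fieldType) (H : algType k) (hH : hopf H) (A B : algType k).
Variables (cB : comod_alg hH B) (gB : galois_ext A cB).
Variable F : frob_pair hH.
Local Notation t := (fint F).
Local Notation iota := (incl gB).
Local Notation gtrace := (gtrace cB F).

Local Notation fb := (fbasis gB F).
Local Notation G := (Gamma cB).

Section Module.
Variable M : lmodType G.
Local Notation rg := (fun (g : G) (z : env B) => z * gval g).
Local Notation lg :=
  (fun (g : G) (m : kmod (resA gB M)) => (g *: (m : M) : M) : kmod (resA gB M)).
Local Notation TM := (tens rg lg).

Lemma ipair_bal : balanced rg lg (fun z m => ipair gB z (m : M) : TM).
Proof. exact: tpair_balanced. Qed.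

Lemma ipairDl z z' (m : M) : ipair gB (z + z') m = ipair gB z m + ipair gB z' m.
Proof. exact: (linD (bal_linl ipair_bal m)). Qed.
Lemma ipairDr z (m m' : M) : ipair gB z (m + m') = ipair gB z m + ipair gB z m'.
Proof. exact: (linD (bal_linr ipair_bal z)). Qed.
Lemma ipair_mid z (g : G) (m : M) : ipair gB (z * gval g) m = ipair gB z (g *: m).
Proof. exact: (bal_mid ipair_bal g z m). Qed.
Lemma ipair0r z : ipair gB z (0 : M) = 0.
Proof. exact: (lin0 (bal_linr ipair_bal z)). Qed.
Lemma ipair_suml I (s : seq I) (E : I -> env B) (m : M) :
  ipair gB (\sum_(i <- s) E i) m = \sum_(i <- s) ipair gB (E i) m.
Proof. exact: (lin_sum (bal_linl ipair_bal m)). Qed.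

Lemma indE (x : ind gB M) : exists s : seq (env B * M), x = \sum_(q <- s) ipair gB q.1 q.2.
Proof.
have [s ->] := tensE (x : TM); exists [seq (q.1 *: q.2.1, q.2.2 : M) | q <- s].
rewrite big_map; apply: eq_bigr => q _ /=.
exact: esym (linZ (bal_linl ipair_bal _) _ _).
Qed.

Lemma ind_scale_pair z w (m : M) : z *: ipair gB w m = ipair gB (z * w) m.
Proof.
have [L R C] := ipair_bal.
apply: (tlift_pair (phi := fun w (m : kmod (resA gB M)) => ipair gB (z * w) (m : M) : TM)).
split=> [m'|w'|g w' m'].
- exact: (linear_comp (L m') (env_mul_linr z)).
- exact: R.
- have E1 := congr1 (fun u => ipair gB u (m' : M)) (mulrA z w' (gval g)).
  have E2 := C g (z * w') m'.
  by cbv beta in E1, E2 |- *; exact: (etrans E1 E2).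
Qed.

Lemma ind_ext (X : zmodType) (f g : ind gB M -> X) :
  (forall x y, f (x + y) = f x + f y) -> (forall x y, g (x + y) = g x + g y) ->
  (forall z m, f (ipair gB z m) = g (ipair gB z m)) -> f =1 g.
Proof.
move=> fD gD E x; have [s ->] := indE x.
have z0 (h : ind gB M -> X) : (forall x y, h (x + y) = h x + h y) -> h 0 = 0.
  by move=> hD; apply: (addrI (h 0)); rewrite -hD !addr0.
elim: s => [|q s IH]; first by rewrite !big_nil !z0.
by rewrite !big_cons fD gD E IH.
Qed.

Lemma ind_ext1 (N : lmodType (env B)) (f g : ind gB M -> N) : linear f -> linear g ->
  (forall m, f (ipair gB 1 m) = g (ipair gB 1 m)) -> f =1 g.
Proof.
move=> fL gL E; apply: ind_ext => [||z m]; [exact: linD | exact: linD | ].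
have -> : ipair gB z m = z *: ipair gB 1 m.
  by rewrite ind_scale_pair; congr (ipair gB _ m); exact: esym (mulr1 z).
by rewrite !linZ // E.
Qed.

Section Lift.
Variables (N : lmodType (env B)) (f : M -> N).
Hypothesis fG : glin f.

Definition glift (x : ind gB M) : N :=
  ilift (fun z m => (z *: f m : kmod N)) x.

Lemma glift_bal : balanced rg lg (fun z m => (z *: f (m : M) : kmod N)).
Proof.
have [fD fZ] := fG; split=> [m|z|g z m].
- exact: act_linearl.
- apply: (linear_comp (act_linearr z)) => c u v; rewrite fD; congr (_ + _).
  have [_ eZ] := glin_elin gB fG.
  by etransitivity; [exact: eZ | rewrite env_mapc].
- by rewrite fZ scalerA.
Qed.

Lemma glift_pair z m : glift (ipair gB z m) = z *: f m.
Proof. exact: (tlift_pair glift_bal). Qed.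

Lemma glift_add x y : glift (x + y) = glift x + glift y.
Proof. exact: (linD (tlift_linear glift_bal)). Qed.

Lemma glift_linear : linear glift.
Proof.
move=> z x y; rewrite glift_add; congr (_ + _); move: x; apply: ind_ext.
- by move=> x x'; rewrite scalerDr glift_add.
- by move=> x x'; rewrite glift_add scalerDr.
move=> w m; rewrite ind_scale_pair [LHS]glift_pair.
exact: etrans (esym (scalerA z w (f m))) (congr1 ( *:%R z) (esym (glift_pair w m))).
Qed.
End Lift.

Lemma theta_bal (f : M -> B) : glin (f : M -> bireg B) ->
  balanced rg lg (fun z (m : kmod (resA gB M)) => sandwich z (f m)).
Proof.
move=> fG; have [fD fZ] := fG; split=> [m'|w|g w m'].
- exact: sandwich_linl.
- apply: (linear_comp (sandwich_linr w)) => c u v.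
  rewrite -[LHS]/(f (env_gamma gB (env_const A c) *: (u : M) + v)) fD; congr (_ + _).
  rewrite -kmod_biregE; have [_ eZ] := glin_elin gB fG.
  by etransitivity; [exact: eZ | rewrite env_mapc].
- have := congr1 (sandwich w) (fZ g m') => ->; exact: esym (bireg_scaleA _ _ _).
Qed.

Lemma theta_glift (f : M -> B) : glin (f : M -> bireg B) ->
  theta gB f =1 glift (f : M -> bireg B).
Proof.
move=> fG; have tb := theta_bal fG; apply: ind_ext => [x y|x y|z m].
- exact: (linD (tlift_linear tb)).
- exact: (glift_add fG).
- etransitivity; first exact: (tlift_pair tb).
  by rewrite (glift_pair fG).
Qed.

Lemma theta_pair (f : M -> B) z m : glin (f : M -> bireg B) ->
  theta gB f (ipair gB z m) = sandwich z (f m).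
Proof. by move=> fG; exact: (tlift_pair (theta_bal fG)). Qed.

Lemma theta_linear (f : M -> B) : glin (f : M -> bireg B) ->
  linear (theta gB f : ind gB M -> bireg B).
Proof. by move=> fG c x y; rewrite !(theta_glift fG); exact: (glift_linear fG). Qed.

(** The coordinates of x dual to the u_q (x) 1. *)
Definition gcoef (v : B) (x : ind gB M) : M :=
  ilift (fun z m => (trg cB F (epair v 1 * z) *: m : kmod (resA gB M))) x.

Lemma gact_linear (m : M) : linear (fun g : gspace gB => ((g : G) *: m : kmod (resA gB M))).
Proof.
move=> c u v; rewrite -[LHS]/((env_gamma gB (env_const A c) * (u : G) + v) *: m).
by rewrite scalerDl -[_ * _ *: m]scalerA.
Qed.

Lemma env_gammaC (g : G) c : g * env_gamma gB (env_const A c) = env_gamma gB (env_const A c) * g.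
Proof. by apply: val_inj; rewrite /= env_mapc; exact: env_const_mulC. Qed.

Lemma gact_linearr (g : G) :
  linear (fun m : kmod (resA gB M) => (g *: (m : M) : kmod (resA gB M))).
Proof.
move=> c u v; rewrite -[LHS]/(g *: (env_gamma gB (env_const A c) *: (u : M) + (v : M))).
rewrite scalerDr; congr (_ + _); rewrite scalerA env_gammaC.
exact: esym (scalerA _ _ (u : M)).
Qed.

Lemma gcoef_bal v : balanced rg lg
  (fun z (m : kmod (resA gB M)) => (trg cB F (epair v 1 * z) *: (m : M) : kmod (resA gB M))).
Proof.
split=> [m|z|g z m].
- apply: (linear_comp (gact_linear m) (g := fun z => trg cB F (epair v 1 * z) : gspace gB)).
  move=> c z z'; apply: val_inj; rewrite [RHS]gval_linear /=.
  have L : linear (fun z : env B => gtrace (epair v 1 * z)) by lin.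
  exact: L.
- exact: gact_linearr.
- have E : trg cB F (epair v 1 * (z * gval g)) = trg cB F (epair v 1 * z) * g.
    apply: val_inj; exact: etrans (congr1 gtrace (mulrA _ _ _)) (gtraceM _ _ _).
  exact: etrans (congr1 (fun g : G => g *: (m : M)) E) (esym (scalerA _ _ _)).
Qed.

Lemma gcoef_pair v z m : gcoef v (ipair gB z m) = trg cB F (epair v 1 * z) *: m.
Proof. exact: (tlift_pair (gcoef_bal v)). Qed.

Lemma gcoef_add v x y : gcoef v (x + y) = gcoef v x + gcoef v y.
Proof. exact: (linD (tlift_linear (gcoef_bal v))). Qed.

Lemma gcoefE x : x = \sum_(q <- fb) ipair gB (epair q.1 1) (gcoef q.2 x).
Proof.
move: x; apply: ind_ext => [//|x y|z m].
  by rewrite -big_split; apply: eq_bigr => q _; rewrite gcoef_add ipairDr.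
rewrite -[in LHS](fbasis_gamma gB F z) ipair_suml; apply: eq_bigr => q _.
by rewrite gcoef_pair -ipair_mid.
Qed.
End Module.
Arguments gcoef {M} v x.

Section Maps.
Variables (M N : lmodType G) (p : M -> N).
Hypothesis pL : linear p.
Local Notation rg := (fun (g : G) (z : env B) => z * gval g).
Local Notation lg M :=
  (fun (g : G) (m : kmod (resA gB M)) => (g *: (m : M) : M) : kmod (resA gB M)).

Lemma ind_map_bal : balanced rg (lg M)
  (fun z (m : kmod (resA gB M)) => ipair gB z (p m) : tens rg (lg N)).
Proof.
have [L R C] := ipair_bal N; split=> [m|z|g z m].
- exact: L.
- apply: (linear_comp (R z)) => c u v.
  rewrite -[LHS]/(p (env_gamma gB (env_const A c) *: (u : M) + (v : M))).
  exact: pL.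
- have E1 := C g z (p m).
  have E2 := congr1 (fun n : N => ipair gB z n) (linZ pL g (m : M)).
  by cbv beta in E1, E2 |- *; exact: (etrans E1 (esym E2)).
Qed.

Lemma ind_map_pair z m : ind_map gB p (ipair gB z m) = ipair gB z (p m).
Proof. exact: (tlift_pair ind_map_bal). Qed.

Lemma ind_map_add x y : ind_map gB p (x + y) = ind_map gB p x + ind_map gB p y.
Proof. exact: (linD (tlift_linear ind_map_bal)). Qed.

Lemma ind_map_linear : linear (ind_map gB p).
Proof.
move=> z x y; rewrite ind_map_add; congr (_ + _); move: x; apply: ind_ext.
- by move=> x x'; rewrite scalerDr ind_map_add.
- by move=> x x'; rewrite ind_map_add scalerDr.
move=> w m; rewrite ind_scale_pair; etransitivity; first exact: ind_map_pair.
exact: etrans (esym (ind_scale_pair _ _ _)) (congr1 ( *:%R z) (esym (ind_map_pair w m))).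
Qed.

Lemma gcoef_map v x : gcoef v (ind_map gB p x) = p (gcoef v x).
Proof.
move: x; apply: ind_ext => [x y|x y|z m].
- by rewrite ind_map_add gcoef_add.
- by rewrite gcoef_add (linD pL).
etransitivity; first exact: (congr1 (gcoef v) (ind_map_pair z m)).
etransitivity; first exact: gcoef_pair.
exact: etrans (esym (linZ pL _ _)) (congr1 p (esym (gcoef_pair v z m))).
Qed.
End Maps.

(** Preimages of the coordinates of x assemble to a preimage of x. *)
Lemma ind_image (M M' : lmodType G) (p : M -> M') (x : ind gB M') : linear p ->
  (forall q : B * B, exists y, p y = gcoef q.2 x) -> exists y, ind_map gB p y = x.
Proof.
move=> pL c0; pose y q := projT1 (cid (c0 q)).
exists (\sum_(q <- fb) ipair gB (epair q.1 1) (y q)).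
rewrite (lin_sum (ind_map_linear pL)) [RHS]gcoefE; apply: eq_bigr => q _.
by rewrite (ind_map_pair pL) /y; case: cid => /= _ ->.
Qed.

(** Coordinates reduce exactness of the induced sequence to that of the given one. *)
Lemma ind_exact (M M' M'' : lmodType G) (p : M -> M') (p' : M' -> M'') :
  linear p -> linear p' -> (forall x, p' x = 0 <-> exists y, p y = x) ->
  forall x, ind_map gB p' x = 0 <-> exists y, ind_map gB p y = x.
Proof.
move=> pL p'L ex x; split=> [x0|[y <-]].
  apply: ind_image => // q; apply/ex; rewrite -(gcoef_map p'L) x0.
  by apply: (addrI (gcoef q.2 (0 : ind gB M''))); rewrite -gcoef_add !addr0.
move: y; apply: ind_ext => [y y'|_ _|z m].
- by rewrite !ind_map_add.
- by rewrite addr0.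
rewrite (ind_map_pair pL) (ind_map_pair p'L).
have -> : p' (p m) = 0 by apply/ex; exists m.
exact: ipair0r.
Qed.

(** A lift over A^e becomes a lift over Gamma after averaging over the integral. *)
Lemma ind_projective (M : lmodType G) : projective (resA gB M) -> projective (ind gB M).
Proof.
move=> pM X Y p f pL ps fL.
pose f1 m := f (ipair gB 1 m).
have f1G : glin (f1 : M -> Y).
  split=> [m m'|g m]; rewrite /f1; first by rewrite ipairDr (linD fL).
  rewrite -(linZ fL) ind_scale_pair -ipair_mid; apply: (congr1 (fun z => f (ipair gB z m))).
  exact: etrans (mul1r _) (esym (mulr1 _)).
have [fD fZ] := glin_elin gB f1G.
pose XA := restr (env_map iota) X; pose YA := restr (env_map iota) Y.
have pAL : linear (p : XA -> YA) by move=> c u v; exact: pL.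
have fAL : linear (f1 : resA gB M -> YA) by move=> c u v; rewrite fD; congr (_ + _); exact: fZ.
have [g [gL gE]] := pM XA YA p f1 pAL ps fAL.
have gel : elin gB (g : M -> X).
  by split=> [m m'|z m]; [exact: (linD gL) | exact: (linZ gL)].
have aG := avg_integral_glin F gel.
exists (glift (avg gB F (g : M -> X) t)); split; first exact: (glift_linear aG).
apply: ind_ext1 => //; first exact: (linear_comp pL (glift_linear aG)).
move=> m; rewrite (glift_pair aG) scale1r (avg_comp gB F _ _ _ pL).
have -> : (fun m => p (g m)) = f1 by apply/funext.
by rewrite (glin_avg gB F _ _ f1G) fint_counit scale1r.
Qed.
End Induction.

(** * The comultiplication of Gamma *)

Section GammaCoproduct.
Variables (k : fieldType) (H : algType k) (hH : hopf H) (A B : algType k).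
Variables (cB : comod_alg hH B) (gB : galois_ext A cB).
Local Notation rho := (coact cB).
Local Notation iota := (incl gB).
Local Notation BAB := (btens iota).
Local Notation tau := (transl gB).

Local Notation G := (Gamma cB).

Lemma comul_decomp_iota a a' :
  comul_decomp gB (env_gamma gB (epair a a')) [:: (env_gamma gB (epair a 1), env_gamma gB (epair 1 a'))].
Proof.
rewrite /comul_decomp big_seq1 /= !env_map_pair rmorph1.
rewrite [LHS]klift_pair; last by lin.
rewrite [LHS]klift_pair; last by lin.
rewrite [RHS]klift_pair; last by lin.
rewrite coact_iota [RHS]klift_pair; last by lin.
by rewrite transl1.
Qed.

(** Contracting the middle of sum x_0 (x) l(x_1) (x) r(x_1) (x) y gives back x (x) y,
    because l(h) r(h) = eps(h). The next two lemmas come from the same contraction. *)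
Lemma comul_decomp_right (g : G) s b : comul_decomp gB g s ->
  \sum_(q <- s) epair 1 (sandwich (gval q.2) b) * gval q.1 = gval g * epair 1 b.
Proof.
move=> dec; pose L (w : B \ox (BAB \ox B)) : env B :=
  klift (fun x u => klift (fun (c : BAB) y => epair x (bmul c * b * y)) u) w.
have B2 x : bilin (fun (c : BAB) y => epair x (bmul c * b * y)) by lin.
have B1 : bilin (fun x (u : BAB \ox B) => klift (fun c y => epair x (bmul c * b * y)) u) by lin.
have LL : linear L by exact: klift_linear.
have LE x c y : L (x \ot (c \ot y)) = epair x (bmul c * b * y).
  by rewrite /L [LHS](klift_pair B1) [LHS](klift_pair (B2 _)).
have E := congr1 L dec; rewrite (lin_sum LL) in E.
transitivity (L (klift (fun x y => klift (fun x0 x1 => x0 \ot (tau x1 \ot y)) (rho x)) (gval g))).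
  rewrite -[RHS]E; apply: eq_bigr => q _; clear E.
  move: (gval q.1); apply: env_ext; [lin | lin | move=> x y].
  rewrite [in RHS]klift_pair; last by lin.
  move: (gval q.2); apply: env_ext; [lin | lin | move=> x' y'].
  rewrite [in RHS]klift_pair; last by lin.
  by rewrite sandwich_pair epairM LE bmul_pair !(mul1r x) !mulrA.
clear E; move: (gval g); apply: env_ext; [lin | lin | move=> x y].
rewrite [in LHS]klift_pair; last by lin.
rewrite [LHS](klift_out _ _ LL) epairM mulr1 -[in RHS](coact_counit cB x).
rewrite [RHS](klift_out (f := fun x => epair x (b * y))); last by lin.
apply: eq_klift => x0 x1; rewrite LE bmul_transl.
by rewrite -!scalerAl mul1r (linZ (epair_linr _)) (linZ (epair_linl _)).
Qed.

Lemma comul_decomp_left (g : G) s b : comul_decomp gB g s ->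
  \sum_(q <- s) epair (sandwich (gval q.1) b) 1 * gval q.2 = gval g * epair b 1.
Proof.
move=> dec; pose L (w : B \ox (BAB \ox B)) : env B :=
  klift (fun x u => klift (fun (c : BAB) y => epair (x * b * bmul c) y) u) w.
have B2 x : bilin (fun (c : BAB) y => epair (x * b * bmul c) y) by lin.
have B1 : bilin (fun x (u : BAB \ox B) => klift (fun c y => epair (x * b * bmul c) y) u) by lin.
have LL : linear L by exact: klift_linear.
have LE x c y : L (x \ot (c \ot y)) = epair (x * b * bmul c) y.
  by rewrite /L [LHS](klift_pair B1) [LHS](klift_pair (B2 _)).
have E := congr1 L dec; rewrite (lin_sum LL) in E.
transitivity (L (klift (fun x y => klift (fun x0 x1 => x0 \ot (tau x1 \ot y)) (rho x)) (gval g))).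
  rewrite -[RHS]E; apply: eq_bigr => q _; clear E.
  move: (gval q.1); apply: env_ext; [lin | lin | move=> x y].
  rewrite [in RHS]klift_pair; last by lin.
  move: (gval q.2); apply: env_ext; [lin | lin | move=> x' y'].
  rewrite [in RHS]klift_pair; last by lin.
  by rewrite sandwich_pair epairM LE bmul_pair mulr1 !mulrA.
clear E; move: (gval g); apply: env_ext; [lin | lin | move=> x y].
rewrite [in LHS]klift_pair; last by lin.
rewrite [LHS](klift_out _ _ LL) epairM mul1r -[in RHS](coact_counit cB x).
rewrite [RHS](klift_out (f := fun x => epair (x * b) y)); last by lin.
apply: eq_klift => x0 x1; rewrite LE bmul_transl.
by rewrite -!scalerAr mulr1 -scalerAl.
Qed.

Lemma comul_decomp_mul (g : G) s b c : comul_decomp gB g s ->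
  \sum_(q <- s) sandwich (gval q.1) b * sandwich (gval q.2) c = sandwich (gval g) (b * c).
Proof.
move=> /(comul_decomp_left b)/(congr1 (fun z => sandwich z c)).
rewrite (lin_sum (sandwich_linl c)) => E.
transitivity (sandwich (gval g * epair b 1) c); last first.
  rewrite -[LHS](bireg_scaleA (gval g) (epair b 1) c); congr (sandwich _ _).
  by rewrite sandwich_pair mulr1.
rewrite -E; apply: eq_bigr => q _.
rewrite -[RHS](bireg_scaleA (epair (sandwich (gval q.1) b) 1) (gval q.2) c).
by rewrite sandwich_pair mulr1.
Qed.
End GammaCoproduct.

(** * The induced resolution *)

Section InducedResolution.
Variables (k : fieldType) (H : algType k) (hH : hopf H) (A B : algType k).
Variables (cB : comod_alg hH B) (gB : galois_ext A cB).
Variable F : frob_pair hH.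
Local Notation t := (fint F).
Local Notation eps h := (counit hH h : k).
Local Notation iota := (incl gB).
Local Notation trace := (trace cB F).

Local Notation G := (Gamma cB).

Variables (K : nat -> lmodType G) (d : forall n, K n.+1 -> K n) (e : K 0%N -> A).
Hypothesis GR : gamma_resolution gB d e.
Let dL n : linear (@d n) := gres_d GR (n := n).
Local Notation KA := (KA gB K).

Lemma aug_glin : glin (fun m : K 0%N => iota (e m) : bireg B).
Proof.
split=> [m m'|g m]; first by rewrite (gres_eD GR) rmorphD.
exact: (gres_eG GR).
Qed.

Lemma aug_d m : e (@d 0%N m) = 0.
Proof. by have [_ ex _] := gres_exact GR; apply/ex; exists m. Qed.

Lemma aug_pair z m : et (gB := gB) e (ipair gB z m) = sandwich z (iota (e m)).
Proof. exact: (theta_pair gB z m aug_glin). Qed.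

(** On B itself the coordinates are given by the trace. *)
Lemma aug_gcoef v x : iota (e (gcoef F v x)) = trace (v * (et (gB := gB) e x : B)).
Proof.
have aG := aug_glin; have tL := theta_linear (gB := gB) aG; have trL := trace_linear cB F.
move: x; apply: ind_ext => [x y|x y|z m].
- by rewrite gcoef_add (gres_eD GR) rmorphD.
- have E : (et (gB := gB) e (x + y) : B) = et (gB := gB) e x + et (gB := gB) e y := linD tL x y.
  by rewrite E mulrDr (linD trL).
rewrite gcoef_pair (gres_eG GR) sandwich_gtrace; congr (trace _).
rewrite aug_pair -[LHS](bireg_scaleA (epair v 1) z).
by rewrite sandwich_pair mulr1.
Qed.

(** Exactness at the augmentation is not an instance of ind_exact, as A is not given as
    a Gamma-module; there it follows from aug_gcoef. *)
Lemma ind_resolution : proj_resolution (dt (gB := gB) d) (et (gB := gB) e).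
Proof.
have aG := aug_glin; split.
- by move=> n; exact: (ind_map_linear (dL (n := n))).
- exact: (theta_linear (gB := gB) aG).
- have [s0 ex0 exS] := gres_exact GR; split.
  + move=> x; have [m em] := s0 1; exists (ipair gB (epair x 1) m).
    by rewrite aug_pair em rmorph1 sandwich_pair !mulr1.
  + move=> x; split=> [x0|[y <-]].
      apply: (ind_image (F := F) (dL (n := 0%N))) => q; apply/ex0.
      apply: (incl_inj (g := gB)); rewrite aug_gcoef x0 mulr0 rmorph0.
      exact: lin0 (trace_linear cB F).
    have L : linear (fun y => et (gB := gB) e (dt (gB := gB) d y) : bireg B).
      exact: (linear_comp (theta_linear (gB := gB) aG) (ind_map_linear (dL (n := 0%N)))).
    move: y; apply: ind_ext => [y y'|_ _|z m]; [exact: (linD L) | by rewrite addr0 | ].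
    etransitivity; first exact: (congr1 (et (gB := gB) e) (ind_map_pair gB (dL (n := 0%N)) z m)).
    by rewrite aug_pair aug_d rmorph0; exact: (lin0 (sandwich_linr _)).
  + move=> n; exact: (ind_exact F (dL (n := n.+1)) (dL (n := n)) (exS n)).
- by move=> n; exact: (ind_projective F (@gres_proj _ _ _ _ _ _ _ _ _ _ GR n)).
Qed.

Local Notation cocycK n := (@is_cocycle k A B iota KA (dA (gB := gB) d) n).
Local Notation clK := (coh_class iota (dA (gB := gB) d)).
Local Notation cbK := (coboundary iota (dA (gB := gB) d)).
Local Notation HA := (HA gB d).

Lemma hact_d n (f : K n -> B) h : (fun m => hact gB f h (@d n m)) = hact gB (fun m => f (@d n m)) h.
Proof.
apply/funext => m; rewrite /hact; apply: eq_bigr => q _.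
by rewrite (linZ (@dL n)).
Qed.

Lemma hact_cocycle n (f : K n -> B) h : f \in cocycK n -> (hact gB f h : KA n -> B) \in cocycK n.
Proof.
move=> /cocycleP[fL fd]; apply/cocycleP; split; first exact: (hact_bimod F).
move=> m; rewrite -[LHS]/((fun m => hact gB f h (@d n m)) m) hact_d /hact big1 // => q _.
by rewrite [f _]fd mulr0 mul0r.
Qed.

Lemma hact_coboundary n (f : K n -> B) h : cbK (f : KA n -> B) -> cbK (hact gB f h : KA n -> B).
Proof.
case: n f => [|n] f /=.
  by move=> f0 m; rewrite /hact big1 // => q _; rewrite f0 mulr0 mul0r.
move=> [s [sL sE]]; exists (hact gB s h); split; first exact: (hact_bimod F).
move=> m; rewrite -[RHS]/((fun m => hact gB s h (@d n m)) m) hact_d.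
by rewrite /hact; apply: eq_bigr => q _; rewrite sE.
Qed.

Lemma hact_sub (M : lmodType G) (f g : M -> B) h m :
  hact gB f h m - hact gB g h m = hact gB (fun m => f m - g m) h m.
Proof.
by rewrite /hact -sumrB; apply: eq_bigr => q _; rewrite mulrBr mulrBl.
Qed.

Lemma hact_classE n (f : K n -> B) h : f \in cocycK n ->
  hact_class (clK (f : KA n -> B) : HA n) h = clK (hact gB f h : KA n -> B).
Proof.
move=> fc; rewrite /hact_class; set f' := coh_repr _.
have f'c : f' \in cocycK n by exact: coh_reprP.
apply/coh_classE; [exact: hact_cocycle | exact: hact_cocycle | ].
have cb : cbK (fun m : KA n => f' m - f m) by apply/coh_classE => //; exact: coh_reprK.
by apply: coboundary_eq (hact_coboundary h cb) => m; rewrite -hact_sub.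
Qed.

(** The average of a representative over the integral t is invariant, and its class is
    unchanged because eps t = 1. *)
Lemma hinv_representative n (x : HA n) : hinv_class x ->
  exists f : K n -> B, [/\ (f : KA n -> B) \in cocycK n, glin (f : K n -> bireg B)
    & clK (f : KA n -> B) = x].
Proof.
move=> inv; have fc := coh_reprP x; set f := coh_repr x in fc.
exists (hact gB (f : K n -> B) t); split; first exact: hact_cocycle.
  by have [fL _] := (cocycleP _ _ _).1 fc; exact: (hact_integral_glin F).
by rewrite -hact_classE // coh_reprK inv fint_counit scale1r.
Qed.

Lemma coh_class0 n : clK (fun _ : KA n => 0) = 0.
Proof.
have c0 : (fun _ : KA n => 0) \in cocycK n.
  apply/cocycleP; split=> //; apply: bimod_intro => [m m'|z m]; first by rewrite addr0.
  by rewrite (lin0 (sandwich_linr _)).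
have E := coh_class_comb 1 c0 c0.
apply: (addrI (clK (fun _ : KA n => 0))); rewrite addr0.
apply: etrans (congr1 (+%R^~ _) (esym (scale1r _))) (etrans (esym E) _).
by congr (coh_class _ _ _); apply/funext => m; rewrite scaler0 addr0.
Qed.

Lemma glin_hinv_class n (f : K n -> B) : (f : KA n -> B) \in cocycK n ->
  glin (f : K n -> bireg B) -> hinv_class (clK (f : KA n -> B) : HA n).
Proof.
move=> fc fG h; have [_ inv] := glin_hinvariant gB F fG.
rewrite hact_classE //.
have c0 : (fun _ : KA n => 0) \in cocycK n.
  apply/cocycleP; split=> //; apply: bimod_intro => [m m'|z m]; first by rewrite addr0.
  by rewrite (lin0 (sandwich_linr _)).
have E := coh_class_comb (eps h) fc c0; rewrite coh_class0 addr0 in E.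
apply: etrans E; by congr (coh_class _ _ _); apply/funext => m; rewrite inv addr0.
Qed.

Lemma glin_comb (M : lmodType G) (f g : M -> B) c : glin (f : M -> bireg B) ->
  glin (g : M -> bireg B) -> glin ((fun m => c *: f m + g m) : M -> bireg B).
Proof.
move=> [fD fZ] [gD gZ]; split=> [m m'|z m].
  by rewrite fD gD scalerDr addrACA.
rewrite fZ gZ; apply: esym; etransitivity; first exact: (linD (sandwich_linr (gval z))).
by congr (_ + _); exact: (linZ (sandwich_linr (gval z))).
Qed.

Lemma aug_cocycle : (fun m : KA 0%N => iota (e m)) \in cocycK 0%N.
Proof.
have [eL _] := glin_hinvariant gB F aug_glin.
by apply/cocycleP; split=> // m; rewrite [e _]aug_d rmorph0.
Qed.

(** Restriction along m |-> 1 (x) m is the inverse of Theta. *)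
Lemma glin_restrict (M : lmodType G) (g : ind gB M -> B) :
  linear (g : ind gB M -> bireg B) -> glin ((fun m => g (ipair gB 1 m)) : M -> bireg B).
Proof.
move=> gL; split=> [m m'|z m]; first by rewrite ipairDr (linD gL).
rewrite -(linZ gL) ind_scale_pair -ipair_mid; apply: (congr1 (fun z => g (ipair gB z m))).
exact: etrans (mul1r _) (esym (mulr1 _)).
Qed.

Lemma theta_restrict (M : lmodType G) (g : ind gB M -> B) :
  linear (g : ind gB M -> bireg B) -> theta gB (fun m => g (ipair gB 1 m)) = g.
Proof.
move=> gL; have rG := glin_restrict gL; apply/funext.
apply: (ind_ext1 (theta_linear (gB := gB) rG) gL) => m.
etransitivity; first exact: (theta_pair gB _ _ rG).
exact: bireg_scale1.
Qed.

Lemma theta1 (M : lmodType G) (f : M -> B) m : glin (f : M -> bireg B) ->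
  theta gB f (ipair gB 1 m) = f m.
Proof.
by move=> fG; etransitivity; [exact: (theta_pair gB _ _ fG) | exact: bireg_scale1].
Qed.

Lemma theta_d n (f : K n -> B) x : glin (f : K n -> bireg B) ->
  theta gB (fun m => f (@d n m)) x = theta gB f (dt (gB := gB) d x).
Proof.
move=> fG; have fdG : glin ((fun m => f (@d n m)) : K n.+1 -> bireg B).
  by have [fD fZ] := fG; split=> [m m'|g m]; rewrite ?(linD (@dL n)) ?(linZ (@dL n)) ?fD ?fZ.
have dtL := ind_map_linear (gB := gB) (@dL n).
move: x; apply: (ind_ext1 (theta_linear (gB := gB) fdG) (linear_comp (theta_linear (gB := gB) fG) dtL)) => m.
etransitivity; first exact: theta1.
apply: esym; etransitivity; first exact: (congr1 (theta gB f) (ind_map_pair gB (@dL n) 1 m)).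
exact: theta1.
Qed.

Lemma theta_comb (M : lmodType G) (f g : M -> B) c x : glin (f : M -> bireg B) ->
  glin (g : M -> bireg B) ->
  theta gB (fun m => c *: f m + g m) x = c *: theta gB f x + theta gB g x.
Proof.
move=> fG gG; have hG := glin_comb c fG gG.
have fL := theta_linear (gB := gB) fG; have gL := theta_linear (gB := gB) gG.
move: x; apply: ind_ext => [x y|x y|z m].
- exact: (linD (theta_linear (gB := gB) hG)).
- by rewrite [theta gB f _](linD fL) [theta gB g _](linD gL) scalerDr addrACA.
rewrite !theta_pair // (linD (sandwich_linr z)); congr (_ + _).
exact: (linZ (sandwich_linr z)).
Qed.
End InducedResolution.

(** * Contractions of the diagonal on the induced resolution *)

Section InducedCup.
Variables (k : fieldType) (H : algType k) (hH : hopf H) (A B : algType k).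
Variables (cB : comod_alg hH B) (gB : galois_ext A cB).
Variable F : frob_pair hH.
Local Notation iota := (incl gB).

Local Notation G := (Gamma cB).

Variables (K : nat -> lmodType G) (d : forall n, K n.+1 -> K n) (e : K 0%N -> A).
Hypothesis GR : gamma_resolution gB d e.
Let dL n : linear (@d n) := gres_d GR (n := n).
Local Notation KA := (KA gB K).
Local Notation Kt := (Kt gB K).
Local Notation et := (et (gB := gB) e).
Local Notation dt := (dt (gB := gB) d).
Variable T : forall n p q, KA n -> atens (KA p) (KA q).
Arguments T : clear implicits.
Hypothesis TL : lifting (dA (gB := gB) d) e T.
Hypothesis GE : gamma_equivariant T.

Lemma dA_linear n : linear (dA (gB := gB) d (n := n)).
Proof. by move=> c x y; exact: (@dL n). Qed.

Lemma dt_linear n : linear (dt (n := n)).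
Proof. exact: (ind_map_linear (@dL n)). Qed.

Lemma ipair_klinl (M : lmodType G) (m : M) :
  linear ((fun z => ipair gB z m) : env B -> kmod (ind gB M)).
Proof.
move=> c z w; rewrite ipairDl; congr (_ + _).
apply: esym; etransitivity; first exact: (ind_scale_pair gB (env_const B c) z m).
by rewrite env_const_mul.
Qed.

Lemma ipair_klinr (M : lmodType G) (z : env B) :
  linear ((fun m => ipair gB z m) : kmod (resA gB M) -> kmod (ind gB M)).
Proof.
move=> c m m'; rewrite ipairDr; congr (_ + _).
apply: etrans (esym (ipair_mid gB z (env_gamma gB (env_const A c)) m)) _.
apply: esym; etransitivity; first exact: (ind_scale_pair gB (env_const B c) z m).
by rewrite /= env_mapc env_const_mulC.
Qed.

Lemma theta0 (M : lmodType G) (f : M -> B) x : (forall m, f m = 0) -> theta gB f x = 0.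
Proof.
move=> f0; have fG : glin (f : M -> bireg B).
  by split=> [m m'|z m]; rewrite ?f0 ?addr0 ?scaler0.
move: x; apply: (ind_ext (fun x y => linD (theta_linear (gB := gB) fG) x y)) => [x y|z m].
  by rewrite addr0.
by rewrite theta_pair // f0 (lin0 (sandwich_linr _)).
Qed.

Lemma theta_klin (M : lmodType G) (f : M -> B) : glin (f : M -> bireg B) ->
  linear (theta gB f : kmod (ind gB M) -> B).
Proof.
move=> fG; apply: bimod_klin; apply/bimod_linear; exact: theta_linear.
Qed.

Lemma eq_alift (M N : lmodType (env A)) (U : lmodType k) (phi psi : M -> N -> U)
    (w : atens M N) : (forall u v, phi u v = psi u v) -> alift phi w = alift psi w.
Proof. by move=> E; congr (alift _ _); apply/funext => u; apply/funext => v; exact: E. Qed.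

Lemma alift_out (M N : lmodType (env A)) (U X : lmodType k) (L : U -> X) phi
    (w : atens M N) : abal (phi : M -> N -> U) -> linear L ->
  L (alift phi w) = alift (fun u v => L (phi u v)) w.
Proof.
move=> pb LL; have [bl br bm] := pb.
have Lb : abal (fun u v => L (phi u v)).
  split=> [v|u|a u v]; [exact: (linear_comp LL (bl v)) | exact: (linear_comp LL (br u)) | ].
  exact: (congr1 L (bm a u v)).
move: w; apply: atens_ext => [x y|x y|u v].
- by rewrite (linD (alift_linear pb)) (linD LL).
- exact: (linD (alift_linear Lb)).
by rewrite (alift_pair pb) (alift_pair Lb).
Qed.

Lemma bimod_pair (M : lmodType (env A)) (f : M -> B) a a' m : bimod_map iota f ->
  f (epair a a' *: m) = iota a * f m * iota a'.
Proof. by move=> fL; rewrite (env_map_scale fL) env_map_pair sandwich_pair. Qed.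

(** A^e is contained in Gamma and comultiplies as a (x) a' |-> (a (x) 1) (x)_A (1 (x)
    a'). *)
Lemma gamma_bimod_equivariant : bimod_equivariant T.
Proof.
move=> p q a a' m; have [act da E] := GE p q.
etransitivity; first exact: (E (env_gamma gB (epair a a')) m).
have ob := abal_outer a a' (@apair_bal k A (KA p) (KA q)).
move: (T _ p q m); apply: atens_ext => [x y|x y|u v].
- exact: (linD (diag_linear da _)).
- exact: (linD (alift_linear ob)).
etransitivity; first exact: (diag_formula da (comul_decomp_iota gB a a') u v).
by rewrite big_seq1 /amap (alift_pair ob).
Qed.

(** As T is Gamma-equivariant, a contraction of the diagonal is Gamma-linear as soon as
    it is compatible with the comultiplication of Gamma. *)
Lemma alift_glin p q (N : lmodType (env B)) (phi : K p -> K q -> N) :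
  abal (phi : KA p -> KA q -> kmod N) ->
  (forall g s u v, comul_decomp gB g s ->
     \sum_(r <- s) phi (r.1 *: u) (r.2 *: v) = gval g *: phi u v) ->
  glin (fun m : K (p + q)%N =>
    alift (phi : KA p -> KA q -> kmod N) (T (p + q)%N p q m) : N).
Proof.
move=> pb pE; have aL := alift_linear pb; split=> [m m'|g m].
  by rewrite (lift_add TL) (linD aL).
have [act da E] := GE p q; rewrite E.
have [s dec] := diag_decomp da g.
move: (T _ p q m); apply: atens_ext => [x y|x y|u v].
- by rewrite (linD (diag_linear da g)) (linD aL).
- by rewrite (linD aL) scalerDr.
have E1 : act g (apair (u : KA p) (v : KA q)) =
    \sum_(r <- s) apair (r.1 *: u : KA p) (r.2 *: v : KA q) := diag_formula da dec u v.
apply: (etrans (congr1 (alift (phi : KA p -> KA q -> kmod N)) E1)).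
have E2 := lin_sum aL s (fun r => apair (r.1 *: u : KA p) (r.2 *: v : KA q)).
apply: (etrans E2).
apply: esym; etransitivity; first exact: (congr1 (fun x : N => gval g *: x) (alift_pair pb u v)).
apply: etrans (esym (pE g s u v dec)) _.
by apply: eq_bigr => r _; exact: (esym (alift_pair pb _ _)).
Qed.

Lemma augE (g : G) m : iota (e (g *: m)) = sandwich (gval g) (iota (e m)).
Proof. exact: (gres_eG GR). Qed.

Lemma cup_glin p q (f : K p -> B) (g : K q -> B) : glin (f : K p -> bireg B) ->
  glin (g : K q -> bireg B) -> glin (cup_cochain T f g : K (p + q)%N -> bireg B).
Proof.
move=> fG gG; have [_ fZ] := fG; have [_ gZ] := gG.
have [[fL _] [gL _]] := (glin_hinvariant gB F fG, glin_hinvariant gB F gG).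
have fgb := cup_bal fL gL; have [bl br bm] := fgb.
have idL : linear ((fun b => b) : B -> kmod (bireg B)) by move=> c b b'; rewrite kmod_biregE.
have -> : (cup_cochain T f g : K (p + q)%N -> bireg B) = (fun m =>
    alift ((fun u v => f u * g v) : KA p -> KA q -> kmod (bireg B)) (T (p + q)%N p q m)).
  by apply/funext => m; exact: (alift_out _ fgb idL).
apply: (@alift_glin p q (bireg B) (fun u v => f u * g v)).
  split=> [v|u|//]; [exact: (linear_comp idL (bl v)) | exact: (linear_comp idL (br u))].
move=> h s u v dec; apply: etrans _ (comul_decomp_mul (f u) (g v) dec).
by apply: eq_bigr => r _; rewrite fZ gZ.
Qed.

Section Right.
Variables (q : nat) (g : K q -> B).
Hypotheses (gG : glin (g : K q -> bireg B)) (gd : forall m, g (@d q m) = 0).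

(** The contraction u (x) v |-> (1 (x) g(v)) (x)_Gamma u: the analogue of yoneda for the
    induced resolution, which needs a diagonal on K only. *)
Definition slant p (m : K (p + q)%N) : Kt p :=
  alift (fun (u : KA p) (v : KA q) => (ipair gB (epair 1 (g v)) u : kmod (Kt p)))
    (T (p + q)%N p q m).

Lemma g_klin : linear (g : kmod (KA q) -> B).
Proof. have [gL _] := glin_hinvariant gB F gG; exact: (@bimod_klin k A B iota (KA q) g gL). Qed.

Lemma slant_bal p :
  abal (fun (u : KA p) (v : KA q) => (ipair gB (epair 1 (g v)) u : kmod (Kt p))).
Proof.
split=> [v|u|a u v].
- exact: ipair_klinr.
- exact: (linear_comp (ipair_klinl u) (linear_comp (epair_linr 1) g_klin)).
apply: etrans (esym (ipair_mid gB (epair 1 (g v)) (env_gamma gB (epair 1 a)) u)) _.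
apply: (congr1 (fun z => ipair gB z u)).
rewrite /= env_map_pair rmorph1 epairM mulr1; congr (epair _ _).
have [gL _] := glin_hinvariant gB F gG.
by apply: esym; apply: etrans (bimod_pair a 1 v gL) _; rewrite rmorph1 mulr1.
Qed.

Lemma slant_glin p : glin (@slant p).
Proof.
apply: (alift_glin (@slant_bal p)) => h s u v dec.
apply: esym; etransitivity; first exact: (ind_scale_pair gB (gval h) (epair 1 (g v)) u).
etransitivity; first exact: (congr1 (fun z => ipair gB z u) (esym (comul_decomp_right (g v) dec))).
etransitivity; first exact: ipair_suml.
apply: eq_bigr => r _; etransitivity; first exact: ipair_mid.
by apply: (congr1 (fun b => ipair gB (epair 1 b) (r.1 *: u))); rewrite (gG.2).
Qed.

Lemma slant_d p m : @slant p (@d (p + q)%N m) = dt (@slant p.+1 m).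
Proof.
have dtL := ind_map_linear (gB := gB) (@dL p).
etransitivity; first exact: (alift_d (lift_chain TL) dA_linear m (slant_bal p)).
rewrite [X in _ *: X]alift0 => [|u v]; last first.
  etransitivity; first exact: (congr1 (fun b => ipair gB (epair 1 b) u) (gd v)).
  by rewrite (lin0 (epair_linr 1)); exact: (lin0 (ipair_klinl u)).
rewrite scaler0 addr0; apply: esym.
etransitivity; first exact: (alift_out _ (slant_bal p.+1) (kmod_lin dtL)).
by apply: (@eq_alift (KA p.+1) (KA q) (kmod (Kt p))) => u v; exact: (ind_map_pair gB (@dL p)).
Qed.

Lemma theta_slant p (f : K p -> B) m : glin (f : K p -> bireg B) ->
  theta gB f (@slant p m) = cup_cochain T f g m.
Proof.
move=> fG; etransitivity; first exact: (alift_out _ (slant_bal p) (theta_klin fG)).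
apply: eq_alift => u v.
by etransitivity; [exact: (theta_pair gB _ _ fG) | rewrite sandwich_pair mul1r].
Qed.

Definition ind_slant p : Kt (p + q)%N -> Kt p := glift (@slant p).

Lemma ind_slant_linear p : linear (@ind_slant p).
Proof. exact: (glift_linear (@slant_glin p)). Qed.

Lemma ind_slant1 p m : @ind_slant p (ipair gB 1 m) = slant m.
Proof. by etransitivity; [exact: (glift_pair gB (@slant_glin p)) | rewrite scale1r]. Qed.

Lemma ind_slant_d p x : @ind_slant p (dt x) = dt (@ind_slant p.+1 x).
Proof.
have L1 : linear (fun x : Kt (p + q)%N.+1 => @ind_slant p (dt x)).
  exact: (linear_comp (@ind_slant_linear p) (@dt_linear (p + q)%N)).
have L2 : linear (fun x : Kt (p + q)%N.+1 => dt (@ind_slant p.+1 x)).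
  exact: (linear_comp (@dt_linear p) (@ind_slant_linear p.+1)).
move: x; apply: (ind_ext1 L1 L2) => m.
etransitivity; first exact: (congr1 (@ind_slant p) (ind_map_pair gB (@dL (p + q)%N) 1 m)).
etransitivity; first exact: ind_slant1.
etransitivity; first exact: slant_d.
exact: (congr1 (fun y => dt (n := p) y) (esym (@ind_slant1 p.+1 m))).
Qed.

Lemma theta_ind_slant p (f : K p -> B) x : glin (f : K p -> bireg B) ->
  theta gB f (@ind_slant p x) = theta gB (cup_cochain T f g) x.
Proof.
move=> fG; have cG := cup_glin fG gG.
have fL := theta_linear (gB := gB) fG; have cL := theta_linear (gB := gB) cG.
move: x; apply: (ind_ext1 (linear_comp fL (@ind_slant_linear p)) cL) => m.
etransitivity; first exact: (congr1 (theta gB f) (ind_slant1 m)).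
by rewrite theta_slant // theta1.
Qed.
End Right.

(** The contraction u (x) v |-> (e(u) (x) 1) (x)_Gamma v, the analogue of unitor. *)
Definition lunit n (m : K n) : Kt n :=
  alift (fun (u : KA 0%N) (v : KA n) => (ipair gB (epair (iota (e u)) 1) v : kmod (Kt n)))
    (T n 0%N n m).

Let aG := aug_glin GR.

Lemma aug_klin : linear ((fun u => iota (e u)) : kmod (KA 0%N) -> B).
Proof. have [gL _] := glin_hinvariant gB F aG; exact: (@bimod_klin k A B iota (KA 0%N) _ gL). Qed.

Lemma lunit_bal n : abal (fun (u : KA 0%N) (v : KA n) =>
  (ipair gB (epair (iota (e u)) 1) v : kmod (Kt n))).
Proof.
split=> [v|u|a u v].
- exact: (linear_comp (ipair_klinl v) (linear_comp (epair_linl 1) aug_klin)).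
- exact: ipair_klinr.
apply: etrans _ (ipair_mid gB (epair (iota (e u)) 1) (env_gamma gB (epair a 1)) v).
apply: (congr1 (fun z => ipair gB z v)).
rewrite /= env_map_pair rmorph1 epairM mulr1; congr (epair _ _).
have [gL _] := glin_hinvariant gB F aG.
by apply: etrans (bimod_pair 1 a u gL) _; rewrite rmorph1 mul1r.
Qed.

Lemma lunit_glin n : glin (@lunit n).
Proof.
apply: (@alift_glin 0%N n (Kt n) _ (@lunit_bal n)) => h s u v dec.
apply: esym; etransitivity; first exact: (ind_scale_pair gB (gval h) (epair (iota (e u)) 1) v).
etransitivity; first exact: (congr1 (fun z => ipair gB z v) (esym (comul_decomp_left (iota (e u)) dec))).
etransitivity; first exact: ipair_suml.
apply: eq_bigr => r _; etransitivity; first exact: ipair_mid.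
by apply: (congr1 (fun b => ipair gB (epair b 1) (r.2 *: v))); rewrite augE.
Qed.

Lemma lunit_d n m : @lunit n (@d n m) = dt (@lunit n.+1 m).
Proof.
have dtL := ind_map_linear (gB := gB) (@dL n).
etransitivity; first exact: (@alift_d _ _ _ _ _ (lift_chain TL) dA_linear 0%N n _ _ m (lunit_bal n)).
rewrite expr0 scale1r alift0 => [|u v]; last first.
  etransitivity; first exact: (congr1 (fun a => ipair gB (epair (iota a) 1) v) (aug_d GR u)).
  by rewrite rmorph0 (lin0 (epair_linl 1)); exact: (lin0 (ipair_klinl v)).
rewrite add0r; apply: esym.
etransitivity; first exact: (alift_out _ (lunit_bal n.+1) (kmod_lin dtL)).
by apply: (@eq_alift (KA 0%N) (KA n.+1) (kmod (Kt n))) => u v; exact: (ind_map_pair gB (@dL n)).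
Qed.

Lemma theta_lunit n (f : K n -> B) m : glin (f : K n -> bireg B) ->
  theta gB f (@lunit n m) = alift (fun (u : KA 0%N) (v : KA n) => iota (e u) * f v) (T n 0%N n m).
Proof.
move=> fG; etransitivity; first exact: (alift_out _ (lunit_bal n) (theta_klin fG)).
apply: eq_alift => u v.
by etransitivity; [exact: (theta_pair gB _ _ fG) | rewrite sandwich_pair mulr1].
Qed.

Lemma iotaL : linear (iota : A -> B).
Proof. exact: linearP. Qed.

Lemma aug_bal : abal (fun u v : KA 0%N => e u * e v).
Proof.
have inj := @incl_inj _ _ _ _ _ _ gB; have [eL _] := glin_hinvariant gB F aG.
have eK : linear (e : kmod (KA 0%N) -> A).
  by move=> c u v; apply: inj; rewrite linearP; exact: aug_klin.
split=> [v|u|a u v].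
- exact: (linear_comp (mul_linl _) eK).
- exact: (linear_comp (mul_linr _) eK).
have -> : e (epair 1 a *: (u : KA 0%N)) = e u * a.
  by apply: inj; apply: etrans (bimod_pair 1 a u eL) _; rewrite rmorph1 mul1r rmorphM.
have -> : e (epair a 1 *: (v : KA 0%N)) = a * e v.
  by apply: inj; apply: etrans (bimod_pair a 1 v eL) _; rewrite rmorph1 mulr1 rmorphM.
by rewrite mulrA.
Qed.

Definition ind_lunit n : Kt n -> Kt n := glift (@lunit n).

Lemma ind_lunit_linear n : linear (@ind_lunit n).
Proof. exact: (glift_linear (@lunit_glin n)). Qed.

Lemma ind_lunit1 n m : @ind_lunit n (ipair gB 1 m) = lunit m.
Proof. by etransitivity; [exact: (glift_pair gB (@lunit_glin n)) | rewrite scale1r]. Qed.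

Lemma ind_lunit_d n x : @ind_lunit n (dt x) = dt (@ind_lunit n.+1 x).
Proof.
have L1 : linear (fun x : Kt n.+1 => @ind_lunit n (dt x)).
  exact: (linear_comp (@ind_lunit_linear n) (@dt_linear n)).
have L2 : linear (fun x : Kt n.+1 => dt (@ind_lunit n.+1 x)).
  exact: (linear_comp (@dt_linear n) (@ind_lunit_linear n.+1)).
move: x; apply: (ind_ext1 L1 L2) => m.
etransitivity; first exact: (congr1 (@ind_lunit n) (ind_map_pair gB (@dL n) 1 m)).
etransitivity; first exact: ind_lunit1.
etransitivity; first exact: lunit_d.
exact: (congr1 (fun y => dt (n := n) y) (esym (@ind_lunit1 n.+1 m))).
Qed.

Lemma ind_lunit_aug x : et (@ind_lunit 0%N x) = et x.
Proof.
have tL := theta_linear (gB := gB) aG.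
move: x; apply: (ind_ext1 (linear_comp tL (@ind_lunit_linear 0%N)) tL) => m.
etransitivity; first exact: (congr1 et (ind_lunit1 m)).
etransitivity; first exact: (theta_lunit m aG).
apply: esym; etransitivity; first exact: theta1.
rewrite -(lift_aug TL m); etransitivity; first exact: (alift_out _ aug_bal iotaL).
by apply: eq_alift => u v; exact: rmorphM.
Qed.

(** The endomorphism ind_lunit is homotopic to the identity, and Theta g o ind_lunit is
    the augmentation of ind_slant g. *)
Lemma ind_slant_augmentation q (g : K q -> B) : glin (g : K q -> bireg B) ->
  (forall m, g (@d q m) = 0) ->
  coboundary idfun (fun n => dt (n := n))
    (fun x : Kt q => (et (@ind_slant q g 0%N x) : B) - theta gB g x).
Proof.
move=> gG gd; have gL := theta_linear (gB := gB) gG.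
have td x : theta gB g (dt (n := q) x) = 0.
  by rewrite -(theta_d GR) // theta0.
have E := endomorphism_cohomologous (ind_resolution F GR) ind_lunit_linear ind_lunit_d ind_lunit_aug
  ((bimod_linear _).2 gL) td.
apply: (coboundary_eq _ E) => x; apply: (congr1 (fun b => b - theta gB g x)).
have L1 : linear (fun x : Kt q => theta gB g (@ind_lunit q x) : bireg B).
  exact: (linear_comp gL (@ind_lunit_linear q)).
have L2 : linear (fun x : Kt q => et (@ind_slant q g 0%N x)).
  exact: (linear_comp (theta_linear (gB := gB) aG) (@ind_slant_linear q g gG 0%N)).
move: x; apply: (ind_ext1 L1 L2) => m.
etransitivity; first exact: (congr1 (theta gB g) (@ind_lunit1 q m)).
apply: etrans (theta_lunit m gG) _; apply: esym.
etransitivity; first exact: (congr1 et (@ind_slant1 q g gG 0%N m)).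
exact: (@theta_slant q g gG 0%N (fun u => iota (e u)) m aG).
Qed.
End InducedCup.

(** * Transport of classes to Hochschild cohomology *)

Section Transfer.
Variables (k : fieldType) (H : algType k) (hH : hopf H) (A B : algType k).
Variables (cB : comod_alg hH B) (gB : galois_ext A cB).
Variable F : frob_pair hH.
Local Notation t := (fint F).
Local Notation iota := (incl gB).

Local Notation G := (Gamma cB).

Variables (K : nat -> lmodType G) (d : forall n, K n.+1 -> K n) (e : K 0%N -> A).
Hypothesis GR : gamma_resolution gB d e.
Let dL n : linear (@d n) := gres_d GR (n := n).
Local Notation KA := (KA gB K).
Local Notation Kt := (Kt gB K).
Local Notation et := (et (gB := gB) e).
Local Notation dt := (dt (gB := gB) d).
Local Notation cocycK n := (@is_cocycle k A B iota KA (dA (gB := gB) d) n).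
Variable T : forall n p q, KA n -> atens (KA p) (KA q).
Arguments T : clear implicits.
Hypothesis TL : lifting (dA (gB := gB) d) e T.
Hypothesis GE : gamma_equivariant T.

Variables (P : nat -> lmodType (env B)) (dP : forall n, P n.+1 -> P n) (eP : P 0%N -> bireg B).
Variable TP : forall n p q, P n -> atens (P p) (P q).
Variable phi : forall n, P n -> Kt n.
Hypothesis rP : proj_resolution dP eP.
Hypothesis TPL : lifting dP eP TP.
Hypothesis TPE : bimod_equivariant TP.
Hypothesis cphi : chain_map_over dP eP (fun n => dt (n := n)) et phi.
Local Notation clK := (coh_class iota (dA (gB := gB) d)).
Local Notation cbK := (coboundary iota (dA (gB := gB) d)).
Local Notation HA := (HA gB d).
Local Notation clP := (coh_class idfun dP).
Local Notation cbP := (coboundary idfun dP).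
Local Notation cocycP n := (@is_cocycle k B B idfun P dP n).
Local Notation glinB f := (glin (f : _ -> bireg B)).

Lemma phi_linear n : linear (@phi n). Proof. exact: (cmap_linear cphi (n := n)). Qed.
Lemma phi_d n m : @phi n (dP m) = dt (@phi n.+1 m). Proof. exact: (cmap_d cphi). Qed.

Lemma theta_cocycle n (f : K n -> B) : glinB f -> (forall m, f (@d n m) = 0) ->
  (fun m => theta gB f (@phi n m)) \in cocycP n.
Proof.
move=> fG fd; apply/cocycleP; split.
  apply/bimod_linear; exact: (linear_comp (theta_linear (gB := gB) fG) (@phi_linear n)).
by move=> m; rewrite phi_d -(theta_d GR) // theta0.
Qed.

Lemma cocycle_d n (f : K n -> B) : (f : KA n -> B) \in cocycK n -> forall m, f (@d n m) = 0.
Proof. by move=> /cocycleP[_ fd] m; exact: (fd m). Qed.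

Lemma glin_cocycle n (f : K n -> B) : glinB f -> (forall m, f (@d n m) = 0) ->
  (f : KA n -> B) \in cocycK n.
Proof.
by move=> fG fd; have [fL _] := glin_hinvariant gB F fG; apply/cocycleP; split.
Qed.

(** A Gamma-linear coboundary is the coboundary of a Gamma-linear cochain, by averaging
    over the integral. *)
Lemma theta_coboundary n (f : K n -> B) : glinB f -> cbK (f : KA n -> B) ->
  cbP (fun m => theta gB f (@phi n m)).
Proof.
case: n f => [|n] f fG; first by move=> f0 m; exact: theta0.
move=> [s [sL sE]].
have sG : glinB (hact gB (s : K n -> B) t) by exact: (hact_integral_glin F).
have fE : f = (fun m => hact gB (s : K n -> B) t (@d n m)).
  rewrite (hact_d GR); have -> : (fun m => s (@d n m)) = f by apply/funext => m; rewrite sE.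
  apply/funext => m; have [_ inv] := glin_hinvariant gB F fG.
  by rewrite inv fint_counit scale1r.
exists (fun m => theta gB (hact gB (s : K n -> B) t) (@phi n m)); split.
  apply/bimod_linear; exact: (linear_comp (theta_linear (gB := gB) sG) (@phi_linear n)).
by move=> m; rewrite phi_d {1}fE (theta_d GR).
Qed.

Lemma sub_comb (f g : B) : f - g = (-1) *: g + f.
Proof. by rewrite scaleN1r addrC. Qed.

Lemma glin_sub (M : lmodType G) (f g : M -> B) : glinB f -> glinB g ->
  glinB (fun m => f m - g m).
Proof.
move=> fG gG; have := glin_comb (-1) gG fG.
by congr (glin _); apply/funext => m; rewrite sub_comb.
Qed.

Lemma theta_sub (M : lmodType G) (f g : M -> B) x : glinB f -> glinB g ->
  theta gB (fun m => f m - g m) x = theta gB f x - theta gB g x.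
Proof.
move=> fG gG; rewrite sub_comb -theta_comb //; congr (theta gB _ x).
by apply/funext => m; rewrite sub_comb.
Qed.

(** The invariant representative chosen by psi differs from f by an invariant
    coboundary, and theta_coboundary applies to the difference. *)
Lemma psi_class n (f : K n -> B) : (f : KA n -> B) \in cocycK n -> glinB f ->
  psi dP phi (clK (f : KA n -> B)) = clP (fun m => theta gB f (@phi n m)).
Proof.
move=> fc fG; rewrite /psi; set f' := xget _ _.
have [f'c f'i f'E] : [/\ (f' : KA n -> B) \in cocycK n, hinvariant gB f'
    & clK (f' : KA n -> B) = clK (f : KA n -> B)].
  apply: (@xgetPex _ (fun=> 0) [set f1 : K n -> B | [/\ (f1 : KA n -> B) \in cocycK n,
    hinvariant gB f1 & clK (f1 : KA n -> B) = clK (f : KA n -> B)]]%classic).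
  by exists f; split=> //; have [] := glin_hinvariant gB F fG.
have f'G : glinB f' by have [f'L _] := (cocycleP _ _ _).1 f'c; exact: (hinvariant_glin F f'L f'i).
apply/(coh_classE (theta_cocycle f'G (cocycle_d f'c)) (theta_cocycle fG (cocycle_d fc))).
have cb : cbK (fun m : KA n => f' m - f m) by apply/coh_classE.
apply: (coboundary_eq _ (theta_coboundary (glin_sub f'G fG) cb)) => m.
by rewrite theta_sub.
Qed.

Lemma psi_linear n c (x y : HA n) : hinv_class x -> hinv_class y ->
  psi dP phi (c *: x + y) = c *: psi dP phi x + psi dP phi y.
Proof.
move=> /(hinv_representative F GR)[f [fc fG <-]] /(hinv_representative F GR)[g [gc gG <-]].
have hG := glin_comb c fG gG.
have hc := cocycle_comb c fc gc.
rewrite -(coh_class_comb c fc gc) (psi_class hc hG) !psi_class //.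
rewrite -(coh_class_comb c (theta_cocycle fG (cocycle_d fc)) (theta_cocycle gG (cocycle_d gc))).
by congr (coh_class _ _ _); apply/funext => m; exact: theta_comb.
Qed.

Lemma theta_bimod n (f : K n -> B) : glinB f -> bimod_map idfun (theta gB f : Kt n -> B).
Proof. by move=> fG; apply/bimod_linear; exact: (theta_linear (gB := gB) fG). Qed.

Lemma theta_dt0 n (f : K n -> B) x : glinB f -> (forall m, f (@d n m) = 0) ->
  theta gB f (dt x) = 0.
Proof. by move=> fG fd; rewrite -(theta_d GR) // theta0. Qed.

Lemma coboundary_restrict n (f : K n -> B) : glinB f ->
  coboundary idfun (fun n => dt (n := n)) (theta gB f : Kt n -> B) -> cbK (f : KA n -> B).
Proof.
case: n f => [|n] f fG; first by move=> f0 m; rewrite -(theta1 gB m fG); exact: f0.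
move=> [s [/bimod_linear sL sE]]; have sG := glin_restrict sL.
exists (fun m : KA n => s (ipair gB 1 m)); split; first by have [] := glin_hinvariant gB F sG.
move=> m; rewrite -(theta1 gB m fG); apply: etrans (sE _) _.
exact: (congr1 s (ind_map_pair gB (@dL n) 1 m)).
Qed.

Lemma psi_injective n (x y : HA n) : hinv_class x -> hinv_class y ->
  psi dP phi x = psi dP phi y -> x = y.
Proof.
move=> /(hinv_representative F GR)[f [fc fG <-]] /(hinv_representative F GR)[g [gc gG <-]].
rewrite !psi_class // => /coh_classE E.
have cb := E (theta_cocycle fG (cocycle_d fc)) (theta_cocycle gG (cocycle_d gc)).
have hG := glin_sub fG gG.
apply/coh_classE => //; apply: (coboundary_restrict hG).
apply: (comparison_injective rP (ind_resolution F GR) cphi (theta_bimod hG)).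
  by move=> m; apply: theta_dt0 => // m'; rewrite !cocycle_d // subrr.
by apply: (coboundary_eq _ cb) => m; rewrite theta_sub.
Qed.

Lemma psi_surjective n (z : Coh idfun dP n) :
  exists2 x : HA n, hinv_class x & psi dP phi x = z.
Proof.
have gc := coh_reprP z; have [gL gd] := (cocycleP _ _ _).1 gc.
have [f [/bimod_linear fL fd cb]] :=
  comparison_surjective rP (ind_resolution F GR) cphi gL gd.
have fG := glin_restrict fL.
have fc : (fun m : KA n => f (ipair gB 1 m)) \in cocycK n.
  apply: (glin_cocycle fG) => m; apply: etrans _ (fd (ipair gB 1 m)).
  exact: (congr1 f (esym (ind_map_pair gB (@dL n) 1 m))).
exists (clK (fun m : KA n => f (ipair gB 1 m))); first exact: (glin_hinv_class F GR).
rewrite psi_class // -[RHS]coh_reprK.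
apply/(coh_classE (theta_cocycle fG (cocycle_d fc)) gc).
by apply: (coboundary_eq _ cb) => m; rewrite theta_restrict.
Qed.

Lemma coboundary_pullback n (w : Kt n -> B) :
  coboundary idfun (fun n => dt (n := n)) w -> cbP (fun m => w (@phi n m)).
Proof.
case: n w => [|n] w; first by move=> w0 m; exact: w0.
move=> [s [/bimod_linear sL sE]]; exists (fun m => s (@phi n m)); split.
  apply/bimod_linear; exact: (linear_comp sL (@phi_linear n)).
by move=> m; rewrite phi_d; exact: sE.
Qed.

Lemma hinv_cup p q (x : HA p) (y : HA q) : hinv_class x -> hinv_class y ->
  hinv_class (cup T x y : HA (p + q)%N).
Proof.
move=> /(hinv_representative F GR)[f [fc fG <-]] /(hinv_representative F GR)[g [gc gG <-]].
have TE := gamma_bimod_equivariant GE.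
rewrite (cup_class (lift_add TL) (lift_chain TL) TE (dA_linear GR) fc gc).
apply: (glin_hinv_class F GR); last exact: (cup_glin F TL GE fG gG).
exact: (cup_cocycle (lift_add TL) (lift_chain TL) TE (dA_linear GR) fc gc).
Qed.

(** The chain maps phi o yoneda and ind_slant o phi of degree -q both have an
    augmentation cohomologous to Theta g o phi, so that cocycles do not distinguish
    them. Composed with Theta f they give the two cup products. *)
Lemma psi_cup p q (x : HA p) (y : HA q) : hinv_class x -> hinv_class y ->
  psi dP phi (cup T x y : HA (p + q)%N) = cup TP (psi dP phi x) (psi dP phi y).
Proof.
move=> /(hinv_representative F GR)[f [fc fG <-]] /(hinv_representative F GR)[g [gc gG <-]].
have TE := gamma_bimod_equivariant GE; have rK := ind_resolution F GR.
have cc := cup_cocycle (lift_add TL) (lift_chain TL) TE (dA_linear GR) fc gc.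
have cG := cup_glin F TL GE fG gG.
have fP := theta_cocycle fG (cocycle_d fc); have gP := theta_cocycle gG (cocycle_d gc).
have [gPL gPd] := (cocycleP _ _ _).1 gP; have [fPL fPd] := (cocycleP _ _ _).1 fP.
have dPL n : linear (@dP n) := res_d rP (n := n).
have cP := cup_cocycle (lift_add TPL) (lift_chain TPL) TPE dPL fP gP.
rewrite (cup_class (lift_add TL) (lift_chain TL) TE (dA_linear GR) fc gc).
rewrite (psi_class cc cG) !psi_class //.
rewrite (cup_class (lift_add TPL) (lift_chain TPL) TPE dPL fP gP); apply: esym.
apply/(coh_classE cP (theta_cocycle cG (cocycle_d cc))).
pose Y p (m : P (p + q)%N) : Kt p := @phi p (yoneda TP (fun m => theta gB g (@phi q m)) m).
pose Y' p (m : P (p + q)%N) : Kt p := ind_slant T g (@phi (p + q)%N m).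
have YL n : linear (@Y n).
  exact: (linear_comp (@phi_linear n) (yoneda_linear TPL TPE gPL (p := n))).
have YL' n : linear (@Y' n).
  exact: (linear_comp (ind_slant_linear F TL GE gG (p := n)) (@phi_linear (n + q)%N)).
have Yd n m : @Y n (dP m) = dt (@Y n.+1 m).
  by rewrite /Y -phi_d (yoneda_d rP TPL gPL gPd).
have Yd' n m : @Y' n (dP m) = dt (@Y' n.+1 m).
  rewrite /Y' phi_d; exact: (ind_slant_d F GR TL GE gG (cocycle_d gc)).
have aug : cbP (fun m : P q => (et (@Y 0%N m) : B) - et (@Y' 0%N m)).
  have E1 := yoneda_augmentation rP TPL TPE gPL gPd.
  have E2 := coboundary_pullback (ind_slant_augmentation F GR TL GE gG (cocycle_d gc)).
  apply: (coboundary_eq _ (coboundary_comb (-1) E2 E1)) => m.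
  rewrite -sub_comb opprB addrA subrK; congr (_ - _).
  exact: (esym (cmap_aug cphi _)).
have E := shifted_chain_map_unique rP rK YL YL' Yd Yd' aug (theta_bimod fG)
  (fun x => theta_dt0 x fG (cocycle_d fc)) (p := p).
apply: (coboundary_eq _ E) => m; congr (_ - _).
  exact: (yoneda_cup TP gPL m fPL).
exact: (theta_ind_slant F TL GE gG (@phi (p + q)%N m) fG).
Qed.
End Transfer.

(** * The isomorphism of algebras *)

Theorem theorem1p1
  (k : fieldType) (H : algType k) (hH : hopf H)
  (A B : algType k) (cB : comod_alg hH B) (gB : galois_ext A cB)
  (K : nat -> lmodType (Gamma cB))
  (d : forall n, K n.+1 -> K n) (e : K 0%N -> A)
  (T : forall n p q, KA gB K n -> atens (KA gB K p) (KA gB K q)) :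
  semisimple_ring H ->
  gamma_resolution gB d e ->
  lifting (dA d) e T ->
  gamma_equivariant T ->
  [/\ (* Theta is an isomorphism of complexes *)
      forall n,
      [/\ forall f : K n -> B,
            bimod_map (incl gB) (f : KA gB K n -> B) -> hinvariant gB f ->
            linear (theta gB f : Kt gB K n -> bireg B) /\
            forall b b' m, theta gB f (ipair gB (epair b b') m) = b * f m * b',
          forall g : Kt gB K n -> B,
            linear (g : Kt gB K n -> bireg B) ->
            exists! f : K n -> B,
              [/\ bimod_map (incl gB) (f : KA gB K n -> B), hinvariant gB f
                & theta gB f = g]
        & forall f : K n -> B,
            bimod_map (incl gB) (f : KA gB K n -> B) -> hinvariant gB f ->
            hinvariant gB (fun m => f (d n m)) /\
            forall t, theta gB (fun m => f (d n m)) t = theta gB f (dt d t)],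
      (* B^e (x)_Gamma K is a projective resolution of B *)
      proj_resolution (dt (gB := gB) d) (et e),
      (* H(A, B)^H is represented by H-invariant cocycles *)
      forall n (x : HA gB d n), hinv_class x ->
        exists f : K n -> B,
          [/\ (f : KA gB K n -> B) \in @is_cocycle k A B (incl gB) (KA gB K) (dA d) n,
              hinvariant gB f
            & coh_class (incl gB) (dA d) (f : KA gB K n -> B) = x],
      (* H(A, B)^H is a subalgebra of H(A, B) *)
      [/\ forall n, hinv_class (0 : HA gB d n),
          forall n c (x y : HA gB d n),
            hinv_class x -> hinv_class y -> hinv_class (c *: x + y),
          hinv_class (coh_unit gB d e)
        & forall p q (x : HA gB d p) (y : HA gB d q),
            hinv_class x -> hinv_class y ->
            hinv_class (cup T x y : HA gB d (p + q)%N)]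
    & (* the isomorphism H(A, B)^H -> HH(B) preserves cup products *)
      forall (P : nat -> lmodType (env B)) (dP : forall n, P n.+1 -> P n)
             (eP : P 0%N -> bireg B)
             (TP : forall n p q, P n -> atens (P p) (P q))
             (phi : forall n, P n -> Kt gB K n),
        proj_resolution dP eP ->
        lifting dP eP TP ->
        bimod_equivariant TP ->
        chain_map_over dP eP (dt d) (et e) phi ->
        [/\ forall n (f : K n -> B),
              (f : KA gB K n -> B) \in @is_cocycle k A B (incl gB) (KA gB K) (dA d) n ->
              hinvariant gB f ->
              psi dP phi (coh_class (incl gB) (dA d) (f : KA gB K n -> B)) =
              coh_class idfun dP (fun m => theta gB f (phi n m)),
            forall n c (x y : HA gB d n),
              hinv_class x -> hinv_class y ->
              psi dP phi (c *: x + y) = c *: psi dP phi x + psi dP phi y,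
            forall n (x y : HA gB d n),
              hinv_class x -> hinv_class y ->
              psi dP phi x = psi dP phi y -> x = y,
            forall n (z : Coh idfun dP n),
              exists2 x : HA gB d n, hinv_class x & psi dP phi x = z
          & forall p q (x : HA gB d p) (y : HA gB d q),
              hinv_class x -> hinv_class y ->
              psi dP phi (cup T x y : HA gB d (p + q)%N) =
              cup TP (psi dP phi x) (psi dP phi y)]].

Proof.
move=> ss GR TL GE; have [F] := semisimple_frob_pair hH ss.
have dL n : linear (d n) := gres_d GR (n := n).
split.
- move=> n; split.
  + move=> f fL fi; have fG := hinvariant_glin F fL fi.
    split=> [|b b' m]; first exact: (theta_linear fG).
    by rewrite (theta_pair gB _ _ fG) sandwich_pair.
  + move=> g gL; have fG := glin_restrict gL; have [fL fi] := glin_hinvariant gB F fG.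
    exists (fun m => g (ipair gB 1 m)); split; first by split=> //; exact: theta_restrict.
    move=> f [f'L f'i <-]; apply/funext => m.
    exact: (theta1 gB m (hinvariant_glin F f'L f'i)).
  + move=> f fL fi; have fG := hinvariant_glin F fL fi.
    split=> [|x]; last exact: (theta_d GR).
    have fdG : glin ((fun m => f (d n m)) : K n.+1 -> bireg B).
      by have [fD fZ] := fG; split=> [m m'|g m]; rewrite ?(linD (dL n)) ?(linZ (dL n)) ?fD ?fZ.
    by have [] := glin_hinvariant gB F fdG.
- exact: (ind_resolution F GR).
- move=> n x /(hinv_representative F GR)[f [fc fG fE]]; exists f; split=> //.
  by have [] := glin_hinvariant gB F fG.
- split.
  + move=> n; rewrite -(coh_class0 gB d n); apply: (glin_hinv_class F GR).
      have z0 : glin ((fun=> 0) : K n -> bireg B) by split=> [m m'|z m]; rewrite ?addr0 ?scaler0.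
      exact: (glin_cocycle gB F (d := d) z0 (fun=> erefl)).
    by split=> [m m'|z m]; rewrite ?addr0 ?scaler0.
  + move=> n c x y /(hinv_representative F GR)[f [fc fG <-]].
    move=> /(hinv_representative F GR)[g [gc gG <-]].
    rewrite -(coh_class_comb c fc gc); apply: (glin_hinv_class F GR (cocycle_comb c fc gc)).
    exact: glin_comb.
  + exact: (glin_hinv_class F GR (aug_cocycle F GR) (aug_glin GR)).
  + exact: (hinv_cup F GR TL GE).
- move=> P dP eP TP phi rP TPL TPE cphi; split.
  + move=> n f fc fi; have [fL _] := (cocycleP _ _ _).1 fc.
    exact: (psi_class F GR cphi fc (hinvariant_glin F fL fi)).
  + exact: (psi_linear F GR cphi).
  + exact: (psi_injective F GR rP cphi).
  + exact: (psi_surjective F GR rP cphi).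
  + exact: (psi_cup F GR TL GE rP TPL TPE cphi).
Qed.
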